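(* Let $P=\sum_{i=0}^m A_i(x)\frac{d^i}{dx^i}$ with $A_i\in M_N(\mathbb{C}[x])$ and $\det A_m(x)\not\equiv 0$, and let $n$, $J$, $l(k)$, $\nu$, $v$, $\chi$ be as defined in the context. (i) If $l(k)\not\equiv 0$, then $\chi(P;\mathbb{C}[[x]]^N)=nN$. (ii) If $m\in J$, then $P$ is singular regular at $0$ if and only if $v(\det A_m)=\nu(A_m)\,N$.
   Context: Write $A_i(x)=A_i^0+A_i^1x+\dots+A_i^{d_i}x^{d_i}$ with constant $N\times N$ complex matrices $A_i^j$. For $f=\sum f_jx^j\in\mathbb{C}[[x]][x^{-1}]$, $v(f)=\inf\{j: f_j\neq 0\}$, with $v(0)=+\infty$; for a matrix $A=(a_{ij})$ over $\mathbb{C}[x]$, $\nu(A)=\inf_{i,j} v(a_{ij})$. Put $n_i=\nu(A_i)=\inf\{j: A_i^j\neq 0\}$ (so $n_i=+\infty$ if $A_i\equiv0$), $n=\sup_{0\le i\le m}(i-n_i)$, $J=\{j: j-n_j=n\}$, $L(k)=\sum_{j\in J}k(k-1)\cdots(k-j+1)A_j^{n_j}$ and $l(k)=\det L(k)$, a polynomial in $k$ (the indicial polynomial of $P$ at $0$). For a linear map $u:E\to E$ of a $\mathbb{C}$-vector space with $\dim\ker u$ and $\dim\mathrm{Coker}\,u$ finite, $u$ is said to have an index, and $\chi(u;E)=\dim\ker u-\dim\mathrm{Coker}\,u$. The operator $P$ acts on $\mathbb{C}[[x]]^N$ (column vectors) by formal differentiation. $P$ is called singular regular at $a\in\mathbb{C}$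 if every determination (branch) $f$ of every solution of $Pu=0$ has moderate growth near $a$, i.e. for every sector $S$ with vertex $a$ there is $\beta\in\mathbb{N}$ with $\lim_{x\to a,\,x\in S}(x-a)^\beta f=0$.
   Formalization: In (ii), ''singular regular implies v(det A_m)=ν(A_m)N'' is proved under the added hypothesis l(k)≢0; without it the claim fails, e.g. m=1, N=2, A_1=diag(1,x), A_0=0, where all solutions are constant but v(det A_1)=1≠0. The other direction is unconditional. *)

(* Defs.v *)
From HB Require Import structures.
From mathcomp Require Import all_boot all_order all_algebra.
From mathcomp Require Import complex.
From mathcomp Require Import all_classical all_reals all_analysis.

Set Implicit Arguments.
Unset Strict Implicit.
Unset Printing Implicit Defensive.

Import Order.TTheory GRing.Theory Num.Theory.
Import numFieldNormedType.Exports.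

Local Open Scope classical_set_scope.
Local Open Scope ring_scope.

(* Stated with the bundled type [numClosedFieldType] so that the topology and
   the (complex) derivative that the library attaches to such a field are
   found on it. *)
Definition Cplx (R : realType) : numClosedFieldType := R[i]%C.

Section Valuation.
Variable K : fieldType.

(* Order of vanishing at 0; the infimum over the empty set is +oo. *)
Definition val0 (p : {poly K}) : \bar int :=
  \big[Order.min/+oo%E]_(j < size p | p`_j != 0) (j%:Z)%:E.

Definition mxval0 (N : nat) (A : 'M[{poly K}]_N) : \bar int :=
  \big[Order.min/+oo%E]_(r < N) \big[Order.min/+oo%E]_(s < N) val0 (A r s).

Definition coef_mx (N : nat) (A : 'M[{poly K}]_N) (j : nat) : 'M[K]_N :=
  map_mx (coefp j) A.

End Valuation.

(* The operator sum_(i <= m) A_i (d/dx)^i is given by A : 'I_m.+1 -> 'M_N. *)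
Section Indicial.
Variables (K : fieldType) (N m : nat) (A : 'I_m.+1 -> 'M[{poly K}]_N).

Definition slope (i : 'I_m.+1) : \bar int := ((i%:Z)%:E - mxval0 (A i))%E.

Definition max_slope : \bar int := \big[Order.max/-oo%E]_(i < m.+1) slope i.

Definition Jset : {set 'I_m.+1} := [set j | slope j == max_slope].

(* n_j as a natural number; the value at n_j = +oo is irrelevant, since then j
   is not in Jset unless all A_i vanish. *)
Definition mxval0_nat (j : 'I_m.+1) : nat := `|fine (mxval0 (A j))|%N.

Definition indicial_mx : 'M[{poly K}]_N :=
  \sum_(j in Jset)
    (\prod_(h < j) ('X - (h%:R)%:P))
      *: map_mx polyC (coef_mx (A j) (mxval0_nat j)).

Definition indicial_poly : {poly K} := \det indicial_mx.

End Indicial.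

(* K[[x]]^N: the sequence u stands for the series sum_k u_k x^k with
   coefficients u_k in K^N. *)
Notation fseries K N := (nat -> 'cV[K]_N).

Section FormalAction.
Variables (K : fieldType) (N : nat).
Implicit Type u : fseries K N.

Definition fderiv u : fseries K N := fun k => (k.+1)%:R *: u k.+1.

Definition fmulmx (B : 'M[{poly K}]_N) u : fseries K N :=
  fun k => \sum_(j < k.+1) coef_mx B j *m u (k - j)%N.

Definition formal_op (m : nat) (A : 'I_m.+1 -> 'M[{poly K}]_N) u
    : fseries K N :=
  \sum_(i < m.+1) fmulmx (A i) (iter i fderiv u).

Fact fderiv_is_linear : linear fderiv.
Proof.
move=> a u v; apply/funext => k; rewrite /fderiv.
rewrite [RHS](_ : _ = a *: (k.+1%:R *: u k.+1) + k.+1%:R *: v k.+1) //.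
rewrite [X in _ *: X](_ : _ = a *: u k.+1 + v k.+1) //.
by rewrite scalerDr !scalerA mulrC.
Qed.

Fact fmulmx_is_linear B : linear (fmulmx B).
Proof.
move=> a u v; apply/funext => k; rewrite /fmulmx /=.
rewrite [RHS](_ : _ = a *: (\sum_(j < k.+1) coef_mx B j *m u (k - j)%N)
  + \sum_(j < k.+1) coef_mx B j *m v (k - j)%N) //.
rewrite scaler_sumr -big_split /=; apply: eq_bigr => j _.
rewrite [X in _ *m X](_ : _ = a *: u (k - j)%N + v (k - j)%N) //.
by rewrite mulmxDr scalemxAr.
Qed.

Fact formal_op_is_linear m (A : 'I_m.+1 -> 'M[{poly K}]_N) :
  linear (formal_op A).
Proof.
have itD i : linear (iter i fderiv).
  by elim: i => [|i IH] a u v //=; rewrite IH fderiv_is_linear.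
move=> a u v; rewrite /formal_op scaler_sumr -big_split /=.
by apply: eq_bigr => i _; rewrite itD fmulmx_is_linear.
Qed.

HB.instance Definition _ m (A : 'I_m.+1 -> 'M[{poly K}]_N) :=
  GRing.isLinear.Build K (fseries K N) (fseries K N) *:%R (formal_op A)
    (formal_op_is_linear A).

End FormalAction.

Section Index.
Variables (K : fieldType) (E : lmodType K).

(* For subspaces V and W of E: dim (V / (V `&` W)) = d, witnessed by a family
   of V whose classes modulo W form a basis. *)
Definition dim_mod (V W : set E) (d : nat) : Prop :=
  exists e : 'I_d -> E,
    [/\ forall i, V (e i),
        forall c : 'I_d -> K, W (\sum_i c i *: e i) -> forall i, c i = 0 &
        forall x, V x -> exists c : 'I_d -> K, W (x - \sum_i c i *: e i)].

(* u has an index, and it equals chi. *)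
Definition has_index (u : {linear E -> E}) (chi : int) : Prop :=
  exists k c : nat,
    [/\ dim_mod (u @^-1` [set 0]) [set 0] k,
        dim_mod setT (range u) c &
        chi = k%:Z - c%:Z].

End Index.

Section SingularRegular.
Variable R : realType.
Local Notation C := (Cplx R).

Definition sector (a : C) (rho alpha beta : R) : set C :=
  [set x : C | exists r t : R, [/\ 0 < r < rho, alpha < t < beta &
    x = a + ((r * cos t) +i* (r * sin t))%C]].

(* f = (f_1, ..., f_N) is holomorphic on the open set S and satisfies Pf = 0
   there.  Differentiability of f, f', ..., f^(m) is required so that each
   [derive1n] in the equation is a genuine iterated complex derivative; for
   holomorphic f it is automatic. *)
Definition holo_solution (N m : nat) (A : 'I_m.+1 -> 'M[{poly C}]_N)
    (S : set C) (f : 'I_N -> C -> C) : Prop :=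
  (forall (s : 'I_N) (i : 'I_m.+1) x, S x -> derivable (derive1n i (f s)) x 1)
  /\ (forall x, S x ->
        \sum_(i < m.+1) map_mx (fun p : {poly C} => p.[x]) (A i)
           *m (\col_s derive1n i (f s) x) = 0).

Definition moderate_growth (N : nat) (a : C) (S : set C) (f : 'I_N -> C -> C)
    : Prop :=
  exists b : nat, forall s : 'I_N,
    ((x - a) ^+ b * f s x) @[x --> within S (nbhs a)] --> (0 : C).

(* A sector of opening at most 2 pi is simply connected, and near a any
   holomorphic solution on it continues analytically along all paths in the
   punctured disc: the solutions on S are the branches on S of the multivalued
   solutions.  Wider sectors of the Riemann surface of the logarithm are finite
   unions of these. *)
Definition singular_regular (N m : nat) (A : 'I_m.+1 -> 'M[{poly C}]_N)
    (a : C) : Prop :=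
  forall rho alpha beta : R,
    0 < rho -> alpha < beta <= alpha + pi *+ 2 ->
    forall f : 'I_N -> C -> C,
      holo_solution A (sector a rho alpha beta) f ->
      moderate_growth a (sector a rho alpha beta) f.

End SingularRegular.

(* Main.v *)
(* (i) P maps x^k C[[x]]^N into x^(k-n) C[[x]]^N and acts on the graded pieces
   by L(k), which is invertible for large k.  Hence kernel and cokernel are those
   of a linear map K^(sN) -> K^(tN) with s = t + n, for t large.

   (ii) Multiplying by a power of x, one may write x^m P = x^nu sum_j C_j x^j (d/dx)^j
   with C_j polynomial; the condition on v(det A_m) says that C_m(0) is invertible.

   If it is, the vector Y = (x^i y^(i))_(i < m) of a solution satisfies
   x Y' = (bounded) Y, and Gronwall's inequality along segments in the coordinate
   log x gives moderate growth.

   Conversely, suppose every solution has moderate growth and C_m(0) w = 0 with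
   w <> 0.  Put the equation in companion form D Y' = B Y with D = det A_m, of
   order v at 0.  On a sector around a ray where the Wronskian does not decay
   faster than a power of x, the fundamental matrix, its inverse and, by Cauchy's
   estimates, its derivatives are polynomially bounded; so the matrices N_h of
   D^h Y^(h) = N_h Y have order at least v h - h - b at 0 with b independent of h.
   Hence finitely many of the functionals x^h (d/dx)^h satisfy a nontrivial linear
   relation, with constant coefficients, modulo the left module generated by P and
   terms of high order.  Applying it to x^k times a constant vector and comparing
   lowest-order terms gives a(k) w_s = q(k) L(k) w, with a polynomial row q and a
   scalar polynomial a <> 0.  When w_s <> 0 the degrees in k contradict C_m(0) w = 0. *)
Require Import Defs.
From HB Require Import structures.
From mathcomp Require Import all_boot all_order all_algebra.
From mathcomp Require Import perm cyclic separable cyclotomic.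
From mathcomp Require Import complex zify ring lra.
From mathcomp Require Import all_classical all_reals all_analysis.
Import Order.TTheory GRing.Theory Num.Theory.
Import numFieldNormedType.Exports.
Local Open Scope ring_scope.
Set Implicit Arguments.
Unset Strict Implicit.
Unset Printing Implicit Defensive.

(** * The index on formal power series *)

(** The converse in (ii) carries the hypothesis $l\not\equiv 0$ because it fails otherwise: for
    diag(1, x) d/dx all solutions are constant and 1 lies in J, yet det A_1 = x while ν(A_1) = 0. It
    enters once: a polynomial row q with q(k) L(k) = 0 for all large k must vanish, as L(k) is
    invertible there.

    No analytic continuation takes place. The solutions are power series centred at a = r0 u and
    convergent in the disc of radius r0. That disc has 0 on its boundary and contains the sector of
    half-opening π/4 around the ray of u, so one expansion serves the whole sector. A single ray is
    enough because N_h is a polynomial matrix, whose order at 0 can be read along any ray; only the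
    Wronskian restricts the choice of u.

    Cauchy's estimates are proved without integrals, by averaging polynomials over roots of unity
    and passing to the limit of partial sums.

    The uniform b matters through a count: D^(H-h) x^h N_h has order at least v H - b whatever h is,
    so each of its d entries misses the order v H + 1 by at most b + 1 coefficients, and d (b + 1)
    linear conditions cannot stop H + 1 unknowns once H = d (b + 1). *)

Section Truncation.
Variables (K : fieldType) (N : nat).
Local Notation E := (nat -> 'cV[K]_N).

Lemma fctDE (u v : E) q : (u + v) q = u q + v q. Proof. by []. Qed.
Lemma fctNE (u : E) q : (- u) q = - u q. Proof. by []. Qed.
Lemma fctZE (c : K) (u : E) q : (c *: u) q = c *: u q. Proof. by []. Qed.

(** Truncations are row vectors because kernels, ranks and complements of matrices are row notions;
    [pad] extends by 0 and is a section of [cut]. *)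
Definition pad s (w : 'rV[K]_(s * N)) : E :=
  fun q => if insub q is Some i then (row i (vec_mx w))^T else 0.

Definition cut s (u : E) : 'rV[K]_(s * N) := mxvec (\matrix_(i < s) (u i)^T).

Fact pad_is_linear s : linear (@pad s).
Proof.
move=> a u v; apply/funext => q; rewrite fctDE fctZE /pad.
by case: insubP => [i _ _|_]; rewrite ?scaler0 ?addr0 // !linearP.
Qed.
HB.instance Definition _ s := GRing.isLinear.Build K 'rV[K]_(s * N) E *:%R
  (@pad s) (@pad_is_linear s).

Fact cut_is_linear s : linear (@cut s).
Proof.
move=> a u v; rewrite /cut -linearP; congr mxvec.
by apply/matrixP => i j; rewrite !mxE.
Qed.
HB.instance Definition _ s := GRing.isLinear.Build K E 'rV[K]_(s * N) *:%R
  (@cut s) (@cut_is_linear s).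

Lemma padK s : cancel (@pad s) (@cut s).
Proof.
move=> w; rewrite /cut; apply: (canLR vec_mxK).
apply/row_matrixP => i; rewrite rowK /pad.
case: insubP => [j _ /ord_inj ->|]; first by rewrite trmxK.
by rewrite ltn_ord.
Qed.

Lemma pad_cut s u q : (q < s)%N -> pad (cut s u) q = u q.
Proof.
move=> ltqs; rewrite /pad /cut mxvecK.
case: insubP => [j _ <-|]; last by rewrite ltqs.
by rewrite rowK trmxK.
Qed.

Lemma cut_eq s u v : cut s u = cut s v -> forall q, (q < s)%N -> u q = v q.
Proof. by move=> e q lt; rewrite -(pad_cut u lt) e pad_cut. Qed.

Lemma eq_cut s u v : (forall q, (q < s)%N -> u q = v q) -> cut s u = cut s v.
Proof.
by move=> e; congr mxvec; apply/row_matrixP => i; rewrite !rowK e.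
Qed.

End Truncation.

Section TriangularIndex.
Variables (K : fieldType) (N : nat).
Local Notation E := (nat -> 'cV[K]_N).
Variables (P : {linear E -> E}) (s t : nat) (G : nat -> 'M[K]_N).
Hypothesis headP : forall u v p, (p < t)%N ->
  (forall q, (q < s)%N -> u q = v q) -> P u p = P v p.
Hypothesis tailP : forall u v p, (forall q, (q < s + p)%N -> u q = v q) ->
  P u (t + p)%N - P v (t + p)%N = G p *m (u (s + p)%N - v (s + p)%N).
Hypothesis unitG : forall p, G p \in unitmx.

Lemma triangular_inj u v : (forall q, (q < s)%N -> u q = v q) ->
  (forall p, P u (t + p)%N = P v (t + p)%N) -> u = v.
Proof.
move=> hd tl.
have H n : forall q, (q < s + n)%N -> u q = v q.
  elim: n => [|n IH] q; first by rewrite addn0; exact: hd.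
  rewrite addnS ltnS leq_eqVlt => /orP[/eqP ->|]; last exact: IH.
  have := tailP IH; rewrite tl subrr => /esym /(congr1 (mulmx (invmx (G n)))).
  by rewrite mulKmx // mulmx0 => /subr0_eq.
by apply/funext => q; apply: (H q.+1); rewrite addnS ltnS leq_addl.
Qed.

(** Stage n corrects coefficient s + n only; as G n is invertible, it can be chosen to give
    coefficient t + n of the image any prescribed value. *)
Lemma triangular_ext h g : exists u : E, (forall q, (q < s)%N -> u q = h q) /\
  forall p, P u (t + p)%N = g (t + p)%N.
Proof.
pose upd (U : E) n : E := fun q => if q == (s + n)%N then
  U (s + n)%N + invmx (G n) *m (g (t + n)%N - P U (t + n)%N) else U q.
pose U := fix U n : E := if n is n'.+1 then upd (U n') n' else h.
have US n q : (q < s + n)%N -> U n.+1 q = U n q.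
  by move=> lt /=; rewrite /upd ltn_eqF.
have UD n k q : (q < s + n)%N -> U (n + k)%N q = U n q.
  elim: k => [|k IH] lt; rewrite ?addn0 // addnS US ?IH //.
  by apply: leq_trans lt _; rewrite leq_add2l leq_addr.
(* Coefficient q is final from stage q.+1 on, so the diagonal sequence is the limit of the
   stages. *)
pose u : E := fun q => U q.+1 q.
have uU n q : (q < s + n)%N -> u q = U n q.
  move=> lt; rewrite /u; case: (leqP q.+1 n) => [le|/ltnW le].
    by rewrite -(subnKC le) UD // addnS ltnS leq_addl.
  by rewrite -(subnKC le) UD.
exists u; split=> [q lt|p]; first by rewrite (uU 0%N) // addn0.
have e q : (q < s + p)%N -> u q = U p q by exact: uU.
have := tailP e; rewrite (uU p.+1) ?addnS //= /upd eqxx addrAC subrr add0r.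
by rewrite mulKVmx // => /addIr.
Qed.

Let M : 'M[K]_(s * N, t * N) := lin1_mx (@cut K N t \o P \o @pad K N s).

Let ME x : cut s x *m M = cut t (P x).
Proof.
rewrite mul_rV_lin1 /=; apply: eq_cut => p lt; apply: headP => // q ltq.
exact: pad_cut.
Qed.

(** P is block triangular with an invertible tail. A kernel element is determined by its first s
    coefficients, which range over [kermx M]; a series lies in the range exactly when its first t
    coefficients lie in the row space of M. The rank of M cancels in the difference of the two
    dimensions. *)
Lemma triangular_has_index : has_index P ((s * N)%:Z - (t * N)%:Z).
Proof.
exists (\rank (kermx M)), (\rank (M^C)%MS); split.
- have /choice [e he] : forall i, exists u : E,
    (cut s u = row i (row_base (kermx M))) /\ P u = 0.
    move=> i; set w := row _ _.
    have [u [hd tl]] := triangular_ext (pad w) 0.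
    exists u; split; first by rewrite -[RHS]padK; apply: eq_cut.
    have wM : w *m M = 0.
      by apply/eqP; rewrite -sub_kermx /w (submx_trans (row_sub _ _)) ?eq_row_base.
    apply/funext => p; case: (ltnP p t) => ltp; last by rewrite -(subnKC ltp) tl.
    have : cut t (P u) = cut t 0.
      by rewrite -ME linear0 -wM -[w]padK; congr (_ *m _); apply: eq_cut.
    by move/cut_eq; apply.
  exists e; split.
  + by move=> i; rewrite /= (he i).2.
  + move=> c /= /(congr1 (cut s)); rewrite linear0 linear_sum /=.
    under eq_bigr do rewrite linearZ /= (he _).1.
    move=> H; have : (\row_i c i) *m row_base (kermx M) = 0.
      by rewrite mulmx_sum_row -[RHS]H; apply: eq_bigr => i _; rewrite mxE.
    move/eqP; rewrite mulmx_free_eq0 ?row_base_free // => /eqP/rowP H' i.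
    by have := H' i; rewrite !mxE.
  + move=> x /= Px.
    have : (cut s x <= row_base (kermx M))%MS.
      by rewrite eq_row_base; apply/sub_kermxP; rewrite ME Px linear0.
    case/submxP => c cE; exists (c 0); apply/eqP; rewrite subr_eq0; apply/eqP.
    apply: triangular_inj => [|p].
      apply: cut_eq; rewrite linear_sum /= cE mulmx_sum_row.
      by apply: eq_bigr => i _; rewrite linearZ /= (he _).1.
    rewrite Px linear_sum /= big1 // => i _.
    by rewrite linearZ /= (he _).2 scaler0.
- pose B := row_base (M^C)%MS.
  have cutB (b : 'I_(\rank (M^C)%MS) -> K) :
      cut t (\sum_i b i *: pad (row i B)) = (\row_i b i) *m B.
    rewrite linear_sum mulmx_sum_row; apply: eq_bigr => i _.
    by rewrite linearZ /= padK mxE.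
  exists (fun i => pad (row i B)); split=> //.
  + move=> c [x _ /(congr1 (cut t))]; rewrite cutB -ME => H.
    have : ((\row_i c i) *m B <= M :&: M^C)%MS.
      by rewrite sub_capmx -{1}H submxMl /= -(eq_row_base (M^C)%MS) submxMl.
    rewrite capmx_compl submx0 mulmx_free_eq0 ?row_base_free // => /eqP/rowP H' i.
    by have := H' i; rewrite !mxE.
  + move=> x _.
    have : (cut t x <= M + B)%MS.
      rewrite (submx_trans (submx1 _)) //.
      rewrite (adds_eqmx (eqmx_refl M) (eq_row_base _)).
      by rewrite sub1mx addsmx_compl_full.
    case/sub_addsmxP => -[a b] /= ab; exists (b 0).
    set r := (X in x - X).
    have cr : cut t r = b *m B.
      by rewrite cutB; congr (_ *m _); apply/rowP => i; rewrite mxE.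
    have [u [hd tl]] := triangular_ext (pad a) (x - r).
    exists u => //; apply/funext => p.
    case: (ltnP p t) => ltp; last by rewrite -(subnKC ltp) tl.
    apply: cut_eq ltp; rewrite -ME linearB /= cr ab addrK.
    by congr (_ *m _); rewrite -[RHS]padK; apply: eq_cut.
- by rewrite mxrank_ker mxrank_compl -!subzn ?rank_leq_row ?rank_leq_col // opprB addrA subrK.
Qed.

End TriangularIndex.

(** * Orders of vanishing, the indicial matrix and the index formula *)

Section Orders.
Variable K : fieldType.
Implicit Types (p : {poly K}).

Lemma val0_ge p k :
  ((k%:Z)%:E <= val0 p)%E <-> (forall j, (j < k)%N -> p`_j = 0).
Proof.
split=> [/bigmin_geP[_ H] j ltjk|H].
- have [//|nz] := eqVneq p`_j 0.
  have lts : (j < size p)%N.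
    by rewrite ltnNge; apply: contra nz => le; rewrite nth_default.
  by have := H (Ordinal lts) nz; rewrite lee_fin lez_nat leqNgt ltjk.
- apply/bigmin_geP; split=> [|j nz]; first by rewrite leey.
  by rewrite lee_fin lez_nat leqNgt; apply: contra nz => /H ->.
Qed.

Lemma val0_eq p k : p`_k != 0 -> (forall j, (j < k)%N -> p`_j = 0) ->
  val0 p = (k%:Z)%:E.
Proof.
move=> nz lo; apply/le_anti/andP; split; last exact/val0_ge.
have lts : (k < size p)%N.
  by rewrite ltnNge; apply: contra nz => le; rewrite nth_default.
exact: (bigmin_le_cond _ (fun j : 'I_(size p) => (j%:Z)%:E) (j := Ordinal lts)).
Qed.

Lemma val0_eqP p k : val0 p = (k%:Z)%:E ->
  p`_k != 0 /\ (forall j, (j < k)%N -> p`_j = 0).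
Proof.
move=> e; have lo : forall j, (j < k)%N -> p`_j = 0 by apply/val0_ge; rewrite e.
split=> //; apply/eqP => z.
suff : (((k.+1)%:Z)%:E <= val0 p)%E by rewrite e lee_fin lez_nat ltnn.
apply/val0_ge => j; rewrite ltnS leq_eqVlt => /orP[/eqP -> //|]; exact: lo.
Qed.

Variable N : nat.
Implicit Types (A : 'M[{poly K}]_N).

Lemma coef_mxE A j r s : coef_mx A j r s = (A r s)`_j.
Proof. by rewrite mxE. Qed.

Lemma mxval0_ge A k :
  ((k%:Z)%:E <= mxval0 A)%E <-> (forall j, (j < k)%N -> coef_mx A j = 0).
Proof.
split=> [/bigmin_geP[_ H] j ltjk|H].
- apply/matrixP => r s; rewrite coef_mxE mxE.
  have /bigmin_geP[_ H'] := H r isT.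
  exact: (proj1 (val0_ge (A r s) k) (H' s isT) j ltjk).
- apply/bigmin_geP; split=> [|r _]; first by rewrite leey.
  apply/bigmin_geP; split=> [|s _]; first by rewrite leey.
  by apply/val0_ge => j /H /matrixP /(_ r s); rewrite coef_mxE mxE.
Qed.

Lemma mxval0_finP A : A != 0 -> exists k, [/\ mxval0 A = (k%:Z)%:E,
  coef_mx A k != 0 & forall j, (j < k)%N -> coef_mx A j = 0].
Proof.
move=> nz.
have /ex_minnP[k ck mink] : exists k, coef_mx A k != 0.
  apply/not_existsP => H; case/negP: nz; apply/eqP/matrixP => r s; rewrite mxE.
  apply/polyP => j; rewrite coef0 -coef_mxE.
  by have /negP := H j; rewrite negbK => /eqP ->; rewrite mxE.
have lo j : (j < k)%N -> coef_mx A j = 0.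
  by move=> lt; apply/eqP/negPn; apply/negP => /mink; rewrite leqNgt lt.
exists k; split=> //; apply/le_anti/andP; split; last exact/mxval0_ge.
rewrite leNgt; apply/negP => lt.
have [r [s rs]] : exists r s, (A r s)`_k != 0.
  apply/not_existsP => H; case/negP: ck; apply/eqP/matrixP => r s.
  rewrite coef_mxE mxE; apply/eqP/negPn; apply/negP => c; apply: (H r).
  by exists s.
move: lt; apply/negP; rewrite -leNgt.
apply: (@le_trans _ _ (val0 (A r s))).
  rewrite /mxval0.
  apply: (@le_trans _ _ (\big[Order.min/+oo%E]_(s < N) val0 (A r s))).
    exact: (bigmin_le_cond _ (fun r => \big[Order.min/+oo%E]_(s < N) val0 (A r s)) (j := r)).
  exact: (bigmin_le_cond _ (fun s => val0 (A r s)) (j := s)).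
by rewrite (@val0_eq _ k) // => j /lo /matrixP /(_ r s); rewrite coef_mxE mxE.
Qed.

Lemma mxval0_0 : mxval0 (0 : 'M[{poly K}]_N) = +oo%E.
Proof.
apply/le_anti/andP; split; first exact: leey.
apply/bigmin_geP; split=> // r _; apply/bigmin_geP; split=> // s _.
apply/bigmin_geP; split=> //.
by case=> j lt /=; rewrite mxE coef0 eqxx.
Qed.

End Orders.

Section IndicialShape.
Variables (K : fieldType) (N m : nat) (A : 'I_m.+1 -> 'M[{poly K}]_N).
Hypothesis Am0 : A ord_max != 0.

(** The coefficient of x^(i-n) in A_i. For the maximal slope n it vanishes exactly when i is outside
    J, so sums over J may run over all i. *)
Definition diag_coef (n : int) (i : 'I_m.+1) : 'M[K]_N :=
  if (n <= i%:Z)%R then coef_mx (A i) `|(i%:Z - n)%R|%N else 0.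

(** As A_m is nonzero, the maximal slope is not -oo: it is an integer n attained by a nonzero
    A_i. *)
Lemma max_slopeP : exists n : int, [/\ max_slope A = n%:E,
   forall (i : 'I_m.+1) j, n < i%:Z - j%:Z -> coef_mx (A i) j = 0,
   forall i, (i \in Jset A) -> exists2 j, mxval0 (A i) = (j%:Z)%:E & i%:Z = n + j%:Z &
   forall i, (i \in Jset A) = (diag_coef n i != 0)].
Proof.
have slopeE i k : mxval0 (A i) = (k%:Z)%:E -> slope A i = (i%:Z - k%:Z)%:E.
  by move=> e; rewrite /slope e -EFinN -EFinD.
have slope0 i : A i = 0 -> slope A i = -oo%E.
  by move=> e; rewrite /slope e mxval0_0.
have [i0 i0max] : exists i0, max_slope A = slope A i0.
  have [|i0 _ e] := @eq_bigmax _ _ _ -oo%E ord0 xpredT (slope A) isT.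
    by move=> i _; rewrite leNye.
  by exists i0.
have Ai0 : A i0 != 0.
  apply/eqP => e; have [k [e2 _ _]] := mxval0_finP Am0.
  have : (slope A ord_max <= max_slope A)%E.
    exact: (le_bigmax_cond _ (slope A) (j := ord_max)).
  by rewrite i0max (slope0 _ e) (slopeE _ _ e2) leNgt ltNyr.
have [k [ek ck lok]] := mxval0_finP Ai0.
have sE := slopeE _ _ ek; exists (i0%:Z - k%:Z).
have zc (i : 'I_m.+1) j : i0%:Z - k%:Z < i%:Z - j%:Z -> coef_mx (A i) j = 0.
  move=> lt; have [->|nz] := eqVneq (A i) 0.
    by apply/matrixP => r s; rewrite coef_mxE !mxE coef0.
  have [k' [e' c' lo']] := mxval0_finP nz; apply: lo'.
  have : (slope A i <= max_slope A)%E.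
    exact: (le_bigmax_cond _ (slope A) (j := i)).
  by rewrite i0max sE (slopeE _ _ e') lee_fin; lia.
split=> //; first by rewrite i0max sE.
- move=> i; rewrite inE i0max sE => /eqP e.
  have [Az|nz] := eqVneq (A i) 0; first by rewrite (slope0 _ Az) in e.
  have [k' [e' c' lo']] := mxval0_finP nz; exists k' => //.
  by move: e; rewrite (slopeE _ _ e') => -[]; lia.
- move=> i; rewrite inE i0max sE /diag_coef.
  have [Az|nz] := eqVneq (A i) 0.
    rewrite (slope0 _ Az) Az; case: ifP => _; last by rewrite eqxx.
    set c := coef_mx _ _; suff -> : c = 0 by rewrite eqxx.
    by apply/matrixP => r s; rewrite coef_mxE !mxE coef0.
  have [k' [e' c' lo']] := mxval0_finP nz.
  rewrite (slopeE _ _ e') eqe.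
  case: ifP => le.
    apply/eqP/idP => [e|cn]; first by have -> : `|(i%:Z - (i0%:Z - k%:Z))%R|%N = k' by lia.
    have /negP k'le : ~ (`|(i%:Z - (i0%:Z - k%:Z))%R|%N < k')%N.
      by move=> /lo' z; rewrite z eqxx in cn.
    have /negP : ~ (i0%:Z - k%:Z < i%:Z - k'%:Z) by move=> /zc z; rewrite z eqxx in c'.
    lia.
  rewrite eqxx /=; apply/eqP; lia.
Qed.

Definition falling (i : nat) : {poly K} := \prod_(h < i) ('X - (h%:R)%:P).

Lemma falling_nat i k : (falling i).[k%:R] = (k ^_ i)%:R.
Proof.
elim: i => [|i IH]; first by rewrite /falling big_ord0 hornerC.
rewrite /falling big_ord_recr hornerM -/(falling i) IH ffactnSr natrM.
rewrite hornerXsubC; case: (leqP i k) => le; first by rewrite natrB.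
by rewrite (ffact_small le) !mul0r.
Qed.

Lemma indicial_mxE n : max_slope A = n%:E ->
  indicial_mx A = \sum_(i < m.+1) falling i *: map_mx polyC (diag_coef n i).
Proof.
move=> en; have [n' [e1 e2 e3 e4]] := max_slopeP.
have e : n' = n by move: e1; rewrite en => -[].
subst n'.
rewrite /indicial_mx big_mkcond /=; apply: eq_bigr => i _.
case: ifP => iJ; last first.
  by move: iJ; rewrite e4 => /negbT; rewrite negbK => /eqP ->; rewrite map_mx0 scaler0.
congr (_ *: map_mx _ _); have [j ej ij] := e3 _ iJ.
rewrite /diag_coef /mxval0_nat ej /=.
by case: ifP => h; [congr coef_mx|]; lia.
Qed.

End IndicialShape.

Section FormalIndex.
Variables (K : numFieldType) (N m : nat) (A : 'I_m.+1 -> 'M[{poly K}]_N).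

Lemma iter_fderivE i (u : nat -> 'cV[K]_N) k :
  iter i (@fderiv K N) u k = ((k + i) ^_ i)%:R *: u (k + i)%N.
Proof.
elim: i k => [|i IH] k; first by rewrite ffactn0 scale1r addn0.
rewrite iterS /fderiv IH scalerA -natrM addSnnS; congr (_%:R *: _).
by rewrite ffactnSr mulnC addnS -addSn addnK.
Qed.


(** One term of the convolution survives: A_i has no coefficient below i - n, and its coefficients
    above i - n meet only d_r with r < k. *)
Lemma diag_sumE (n : int) (i : 'I_m.+1) (d : nat -> 'cV[K]_N) (q k : nat) :
  (forall j, n < i%:Z - j%:Z -> coef_mx (A i) j = 0) ->
  k%:Z = q%:Z + n -> (forall r, (r < k)%N -> d r = 0) ->
  fmulmx (A i) (iter i (@fderiv K N) d) q = (k ^_ i)%:R *: (diag_coef A n i *m d k).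
Proof.
move=> zc kq d0; rewrite /fmulmx.
have z (j : 'I_q.+1) : (j%:Z != i%:Z - n) ->
    coef_mx (A i) j *m iter i (@fderiv K N) d (q - j)%N = 0.
  move=> ne; have lt := ltn_ord j.
  case: (ltrP n (i%:Z - j%:Z)) => h; first by rewrite zc // mul0mx.
  rewrite iter_fderivE d0 ?scaler0 ?mulmx0 //; lia.
rewrite /diag_coef; case: ifP => le; last first.
  rewrite mul0mx scaler0 big1 // => j _; apply: z; lia.
have [ltq|gtq] := ltnP `|(i%:Z - n)%R|%N q.+1.
  rewrite (bigD1 (Ordinal ltq)) //= big1 ?addr0 => [|j ne]; last first.
    apply: z; apply: contra ne => /eqP e; apply/eqP/val_inj => /=; lia.
  rewrite iter_fderivE -scalemxAr; congr ((_ ^_ _)%:R *: (_ *m d _)); lia.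
(* Here i - n > q, that is k < i, so the factor k ^_ i on the right is 0. *)
rewrite big1 => [|j _]; last by apply: z; have := ltn_ord j; lia.
by rewrite ffact_small ?scale0r //; lia.
Qed.

Lemma formal_opE u q : formal_op A u q =
  \sum_(i < m.+1) fmulmx (A i) (iter i (@fderiv K N) u) q.
Proof.
by rewrite /formal_op fct_sumE.
Qed.

Lemma indicial_nat n k : A ord_max != 0 -> max_slope A = n%:E ->
  map_mx (horner^~ k%:R) (indicial_mx A)
  = \sum_(i < m.+1) (k ^_ i)%:R *: diag_coef A n i.
Proof.
move=> Am0 en; rewrite (indicial_mxE Am0 en).
apply/matrixP => r s; rewrite mxE !summxE -horner_evalE raddf_sum /=.
apply: eq_bigr => i _; rewrite !mxE horner_evalE hornerM falling_nat.
by rewrite hornerC.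
Qed.

(** Otherwise p would vanish at infinitely many naturals, distinct in characteristic 0; [g] lists
    more of them than the degree allows. *)
Lemma poly_nat_neq0 (p : {poly K}) : p != 0 ->
  exists k0, forall k, (k0 <= k)%N -> p.[k%:R] != 0.
Proof.
move=> nz; apply/not_existsP => H.
have /choice[f hf] : forall k, exists j, (k <= j)%N /\ p.[j%:R] = 0.
  move=> k.
  have /existsNP[j /not_implyP[le /negP]] := H k.
  by rewrite negbK => /eqP; exists j.
pose g := fix g i := if i is i'.+1 then f (g i').+1 else f 0%N.
have gm i j : (i < j)%N -> (g i < g j)%N.
  elim: j => // j IH; rewrite ltnS leq_eqVlt => /orP[/eqP ->|/IH lt] /=;
    have := (hf (g j).+1).1 => //.
  by move=> lt2; apply: ltn_trans lt lt2.
have groot i : root p (g i)%:R by rewrite rootE; case: i => [|i] /=; rewrite (hf _).2.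
have := max_poly_roots nz (rs := [seq (g i)%:R | i <- iota 0 (size p)]).
rewrite size_map size_iota ltnn => H'; suff : false by [].
apply: H'; first by apply/allP => x /mapP[i _ ->].
rewrite map_inj_in_uniq ?iota_uniq // => i j _ _ /eqP.
rewrite eqr_nat => /eqP e; case: (ltngtP i j) => // /gm; rewrite e ltnn //.
Qed.

Lemma formal_index : A ord_max != 0 -> indicial_poly A != 0 ->
  exists2 n : int, max_slope A = n%:E & has_index (formal_op A) (n * N%:Z).
Proof.
move=> Am0 l0; have [n [en zc _ _]] := max_slopeP Am0; exists n => //.
have [k0 hk0] := poly_nat_neq0 l0.
(* From k0 on, L(k) is invertible, which makes every G p = L(s + p) a unit; s >= |n| makes t = s - n
   a natural number. *)
pose s := maxn k0 `|n|%N; pose t := `|(s%:Z - n)%R|%N.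
have st : s%:Z = t%:Z + n by rewrite /t /s; lia.
pose G p := \sum_(i < m.+1) ((s + p) ^_ i)%:R *: diag_coef A n i.
have -> : n * N%:Z = (s * N)%:Z - (t * N)%:Z by rewrite !PoszM st; ring.
apply: (@triangular_has_index _ _ _ s t G).
- move=> u v p ltp uv; rewrite /= !formal_opE; apply: eq_bigr => i _.
  rewrite /fmulmx; apply: eq_bigr => j _; have ltj := ltn_ord j.
  case: (ltrP n (i%:Z - j%:Z)) => h; first by rewrite zc // !mul0mx.
  rewrite !iter_fderivE uv //; lia.
- move=> u v p uv.
  rewrite -[_ - _]/((formal_op A u - formal_op A v) (t + p)%N).
  rewrite -(linearB (formal_op A)) /= formal_opE /G mulmx_suml; apply: eq_bigr => i _.
  rewrite -scalemxAl; apply: diag_sumE => [j|//|r lt]; first exact: zc.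
    by rewrite PoszD st PoszD; ring.
  by rewrite fctDE fctNE uv // subrr.
- move=> p; rewrite /G -indicial_nat // unitmxE unitfE.
  rewrite -[map_mx _ _]/(map_mx (horner_eval (s + p)%:R) _) det_map_mx.
  by apply: hk0; rewrite /s; lia.
Qed.

End FormalIndex.

(** * Companion systems with bounded poles *)

Section FirstOrderSystem.
Variables (K : fieldType) (d e : nat).
Variables (D : {poly K}) (B : 'M[{poly K}]_d) (F : 'M[{poly K}]_(d, e)).

(* Recursions obtained by differentiating
   D^h Y^(h) = N_h Y + sum_i Z_(h,i) G^(i) when D Y' = B Y + F G. *)
Fixpoint itN h : 'M[{poly K}]_d := if h is h'.+1 then
  D *: map_mx (@deriv K) (itN h') - (D^`() *+ h') *: itN h' + itN h' *m B
  else 1%:M.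

Fixpoint itZ h i : 'M[{poly K}]_(d, e) := if h is h'.+1 then
  D *: map_mx (@deriv K) (itZ h' i) - (D^`() *+ h') *: itZ h' i
  + (if i is i'.+1 then D *: itZ h' i' else itN h' *m F)
  else 0.

Lemma itZ_small h i : (h <= i)%N -> itZ h i = 0.
Proof.
elim: h i => [//|h IH] [//|i] /= le.
rewrite !IH ?(leqW le) // ?scaler0 ?subr0 ?addr0; last by rewrite (leq_trans _ le).
by apply/matrixP => p q; rewrite !mxE linear0 mulr0.
Qed.

Variables (V : lmodType {poly K}) (delta : {additive V -> V}).
Hypothesis deltaZ : forall p v, delta (p *: v) = p^`() *: v + p *: delta v.
Variables (Y : 'I_d -> V) (G : 'I_e -> V).
Hypothesis sysE : forall p, D *: delta (Y p) =
  \sum_q B p q *: Y q + \sum_r F p r *: G r.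

(** The derivation is abstract because there are two uses: polynomials, with the monomials x^k w as
    Y, and power series around a, with true solutions. Differentiating D^h Y^(h) produces h D'
    D^(h-1) Y^(h), which accounts for the subtracted term in both recursions. *)
Lemma iterated_system h p : D ^+ h *: iter h delta (Y p) =
  \sum_q itN h p q *: Y q
  + \sum_(i < h) \sum_r itZ h i p r *: iter i delta (G r).
Proof.
elim: h p => [|h IH] p.
  rewrite expr0 scale1r big_ord0 addr0 (bigD1 p) //= big1 => [|q ne].
    by rewrite addr0 mxE eqxx scale1r.
  by rewrite mxE eq_sym (negbTE ne) scale0r.
have e1 := congr1 (fun v => D *: delta v) (IH p).
have e2 : D *: delta (D ^+ h *: iter h delta (Y p)) =
    (D^`() *+ h) *: (D ^+ h *: iter h delta (Y p))
    + D ^+ h.+1 *: iter h.+1 delta (Y p).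
  rewrite deltaZ scalerDr !scalerA -exprS iterS; congr (_ *: _ + _).
  rewrite deriv_exp; case: (h) => [|h']; first by rewrite !mulr0n mulr0 mul0r.
  by rewrite /= exprS -!mulrnAl; ring.
move: e1; rewrite /= e2 => /(canRL (addKr _)) ->.
rewrite (IH p).
transitivity (\sum_q (D * (itN h p q)^`() - (D^`() *+ h) * itN h p q) *: Y q
   + \sum_q itN h p q *: (D *: delta (Y q))
   + (\sum_(i < h) \sum_r (D * (itZ h i p r)^`() - (D^`() *+ h) * itZ h i p r)
         *: iter i delta (G r)
   + \sum_(i < h) \sum_r (D * itZ h i p r) *: iter i.+1 delta (G r))).
  rewrite (raddfD delta) !scalerDr opprD !(raddf_sum delta) !scaler_sumr -!sumrN.
  rewrite addrACA -!big_split /=; congr (_ + _).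
    apply: eq_bigr => q _; rewrite deltaZ scalerDr addrA !scalerA.
    by rewrite [D * itN h p q]mulrC -scaleNr -scalerDl; congr (_ *: _ + _); rewrite addrC.
  apply: eq_bigr => i _; rewrite (raddf_sum delta) !scaler_sumr -sumrN -!big_split /=.
  apply: eq_bigr => r _; rewrite deltaZ scalerDr addrA !scalerA.
  by rewrite -scaleNr -scalerDl; congr (_ *: _ + _); rewrite addrC.
have -> : \sum_q itN h p q *: (D *: delta (Y q)) =
    \sum_q (itN h *m B) p q *: Y q + \sum_r (itN h *m F) p r *: G r.
  under eq_bigr do rewrite sysE scalerDr !scaler_sumr.
  rewrite big_split /= exchange_big /= [X in _ + X]exchange_big /=.
  by congr (_ + _); apply: eq_bigr => r _; rewrite mxE scaler_suml;
    apply: eq_bigr => s _; rewrite scalerA.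
rewrite [X in X + _]addrA -big_split /= -addrA; congr (_ + _).
  by apply: eq_bigr => q _; rewrite -scalerDl !mxE.
transitivity (\sum_(i < h.+1) \sum_r (D * (itZ h i p r)^`() - (D^`() *+ h) * itZ h i p r)
         *: iter i delta (G r) + \sum_(i < h.+1) \sum_r
    (if (i : nat) is i'.+1 then D *: itZ h i' else itN h *m F) p r *: iter i delta (G r)).
  rewrite [X in _ = X + _]big_ord_recr /= [X in _ = _ + X + _]big1 ?addr0; last first.
    by move=> r _; rewrite itZ_small // mxE linear0 !mulr0 subr0 scale0r.
  rewrite addrCA; congr (_ + _); rewrite big_ord_recl /=; congr (_ + _).
  by apply: eq_bigr => i _; apply: eq_bigr => r _; rewrite mxE.
rewrite -big_split /=; apply: eq_bigr => i _; rewrite -big_split /=.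
apply: eq_bigr => r _; rewrite -scalerDl; congr (_ *: _).
by case: i => [[|i] lt] /=; rewrite !mxE.
Qed.

End FirstOrderSystem.

Section Companion.
Variables (K : fieldType) (N m : nat) (A : 'I_m.+1 -> 'M[{poly K}]_N).
Local Notation D := (\det (A ord_max)).
Local Notation I := ('I_m * 'I_N)%type.

Definition widenS (i : 'I_m) : 'I_m.+1 := widen_ord (leqnSn m) i.

(** The pair (i, s) indexes the i-th derivative of component s. The last block of rows comes from
    multiplying the equation by the adjugate of A_m, which turns A_m into the scalar D without
    division. *)
Definition compB : 'M[{poly K}]_#|{: I}| := \matrix_(p < #|{: I}|, q < #|{: I}|)
  let: (i, s) := enum_val p in let: (j, t) := enum_val q in
  if (i.+1 < m)%N then D *+ ((j == i.+1 :> nat) && (t == s))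
  else - (\adj (A ord_max) *m A (widenS j)) s t.

(** The inhomogeneous term P y has to be kept, since the monomials tested later are not
    solutions. *)
Definition compF : 'M[{poly K}]_(#|{: I}|, N) := \matrix_(p < #|{: I}|, r < N)
  let: (i, s) := enum_val p in
  if (i.+1 < m)%N then 0 else \adj (A ord_max) s r.

Variables (V : lmodType {poly K}) (delta : {additive V -> V}).
Variables (y : nat -> 'I_N -> V).
Hypothesis yS : forall i s, delta (y i s) = y i.+1 s.

Definition compY (p : 'I_#|{: I}|) : V :=
  let: (i, s) := enum_val p in y i s.

Definition opG (r : 'I_N) : V := \sum_(i < m.+1) \sum_s A i r s *: y i s.

Lemma companion_system p : D *: delta (compY p) =
  \sum_q compB p q *: compY q + \sum_r compF p r *: opG r.
Proof.
rewrite {1}/compY; case ep: (enum_val p) => [i s].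
transitivity (\sum_(x : I) (if (i.+1 < m)%N then D *+ ((x.1 == i.+1 :> nat) && (x.2 == s))
  else - (\adj (A ord_max) *m A (widenS x.1)) s x.2) *: y x.1 x.2 +
  \sum_(j < N) (if (i.+1 < m)%N then 0 else \adj (A ord_max) s j) *: opG j); last first.
  congr (_ + _).
    rewrite [LHS](reindex (enum_val : 'I_#|{: I}| -> I)) /=; last first.
      by apply: onW_bij; apply: enum_val_bij.
    by apply: eq_bigr => q _; rewrite [compB p q]mxE ep /compY; case: (enum_val q).
  by apply: eq_bigr => j _; rewrite [compF p j]mxE ep.
case: (boolP (i.+1 < m)%N) => lt.
  rewrite [X in _ + X]big1 ?addr0 => [|j _]; last by rewrite scale0r.
  rewrite (bigD1 (Ordinal lt, s)) //= !eqxx mulr1n big1 ?addr0 ?yS // => x ne.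
  case: eqP => e1; case: eqP => e2; rewrite ?mulr0n ?scale0r //.
  by case/eqP: ne; case: x e1 e2 => x1 x2 /= e1 ->; congr (_, _); apply: val_inj.
have im : i.+1 = m by apply/eqP; rewrite eqn_leq ltn_ord leqNgt.
rewrite yS im.
under [X in _ = _ + X]eq_bigr do rewrite /opG scaler_sumr big_ord_recr /=.
rewrite big_split /= addrA.
have -> : \sum_r \adj (A ord_max) s r *: \sum_t A ord_max r t *: y m t = D *: y m s.
  under eq_bigr do rewrite scaler_sumr.
  rewrite exchange_big /=.
  transitivity (\sum_t (\adj (A ord_max) *m A ord_max) s t *: y m t).
    apply: eq_bigr => t _; rewrite mxE scaler_suml.
    by apply: eq_bigr => r _; rewrite scalerA.
  rewrite mul_adj_mx (bigD1 s) //= big1 ?addr0 => [|t ne]; first by rewrite !mxE eqxx mulr1n.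
  by rewrite !mxE eq_sym (negbTE ne) mulr0n scale0r.
suff -> : \sum_(r < N) \sum_(j < m) \adj (A ord_max) s r *:
     (\sum_t A (widenS j) r t *: y j t) =
   \sum_(x : I) (\adj (A ord_max) *m A (widenS x.1)) s x.2 *: y x.1 x.2.
  by rewrite -big_split /= big1 ?add0r // => x _; rewrite scaleNr addNr.
rewrite exchange_big /= -(pair_bigA _ (fun j t =>
  (\adj (A ord_max) *m A (widenS j)) s t *: y j t)) /=.
apply: eq_bigr => j _.
under eq_bigr do rewrite scaler_sumr.
rewrite exchange_big /=; apply: eq_bigr => t _; rewrite mxE scaler_suml.
by apply: eq_bigr => r _; rewrite scalerA.
Qed.

End Companion.

Section EulerOperator.
Variable K : fieldType.
Implicit Types (g : {poly K}).

Lemma coef_low_factor (p : {poly K}) e : (forall j, (j < e)%N -> p`_j = 0) ->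
  exists q, p = 'X^e * q.
Proof.
move=> lo; exists (\poly_(i < size p) p`_(i + e)).
apply/polyP => j; rewrite coefXnM; case: ltnP => [/lo //|le].
rewrite coef_poly subnK //; case: ltnP => // le'.
by rewrite nth_default // (leq_trans le') // leq_subr.
Qed.

Lemma mulX_derivXn n : 'X * ('X^n)^`() = 'X^n *+ n :> {poly K}.
Proof.
by rewrite derivXn; case: n => [|n]; rewrite ?mulr0n ?mulr0 // mulrnAr -exprS.
Qed.

(** With θ = x d/dx this is (θ + κ)(θ + κ - 1)...(θ + κ - i + 1) g, the conjugate of x^i (d/dx)^i by
    x^κ. *)
Fixpoint euler (kappa i : nat) g : {poly K} := if i is i'.+1 then
   'X * (euler kappa i' g)^`() + (kappa%:R - i'%:R) *: euler kappa i' g else g.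

Lemma eulerE kappa i g :
  'X^i * ('X^kappa * g)^`(i) = 'X^kappa * euler kappa i g.
Proof.
elim: i => [|i IH]; first by rewrite expr0 mul1r derivn0.
have := congr1 (fun p => 'X * p^`()) IH.
rewrite /= !derivM !mulrDr !mulrA !mulX_derivXn -exprS -derivnS.
move/(canRL (addKr _)) => ->.
rewrite mulrnAl IH -!mul_polyC rmorphB !rmorph_nat /=; ring.
Qed.

Lemma euler_coef0 kappa i g : (euler kappa i g)`_0 = (kappa ^_ i)%:R * g`_0.
Proof.
elim: i => [|i IH] /=; first by rewrite ffactn0 mul1r.
rewrite coefD coefXM /= add0r coefZ IH ffactnSr natrM mulrA; congr (_ * _).
rewrite mulrC; case: (leqP i kappa) => le; first by rewrite natrB.
by rewrite (ffact_small le) !mul0r.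
Qed.

End EulerOperator.

Section FallingFactorials.
Variable K : numFieldType.
Implicit Types (p q : {poly K}).

Lemma coefM_low (p q : {poly K}) f : (forall j, (j < f)%N -> p`_j = 0) ->
  (forall j, (j < f)%N -> (p * q)`_j = 0) /\ (p * q)`_f = p`_f * q`_0.
Proof.
case/coef_low_factor => r ->; rewrite -mulrA; split=> [j lt|].
  by rewrite coefXnM lt.
by rewrite !coefXnM ltnn subnn coef0M.
Qed.

Lemma poly_nat_ext (p q : {poly K}) : (forall k, p.[k%:R] = q.[k%:R]) -> p = q.
Proof.
move=> e; apply/eqP; rewrite -subr_eq0; apply/negPn/negP => /poly_nat_neq0[k0' H'].
by have := H' k0' (leqnn _); rewrite hornerD hornerN e subrr eqxx.
Qed.

Lemma size_falling i : size (falling K i) = i.+1.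
Proof. by rewrite /falling size_prod_XsubC /index_enum -enumT size_enum_ord. Qed.

Lemma size_falling_comb off n (c : nat -> K) :
  (size (\sum_(i < n) c i *: falling K (off + i))%R <= off + n)%N.
Proof.
apply: (leq_trans (size_sum _ _ _)); apply/bigmax_leqP => i _.
by apply: (leq_trans (size_scale_leq _ _)); rewrite size_falling ltn_add2l.
Qed.

Lemma size_falling_comb_eq off n (c : nat -> K) : c n != 0 ->
  size (\sum_(i < n.+1) c i *: falling K (off + i) : {poly K}) = (off + n).+1.
Proof.
move=> nz; rewrite big_ord_recr /= addrC size_polyDl size_scale // size_falling //.
by rewrite ltnS size_falling_comb.
Qed.

Lemma falling_free n (c : nat -> K) : \sum_(i < n) c i *: falling K i = 0 :> {poly K} ->
  forall i, (i < n)%N -> c i = 0.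
Proof.
elim: n => [//|n IH] e i; have [cn|cn] := eqVneq (c n) 0.
  rewrite ltnS leq_eqVlt => /orP[/eqP -> //|]; apply: IH.
  by move: e; rewrite big_ord_recr /= cn scale0r addr0.
by have := @size_falling_comb_eq 0 n c cn; rewrite e size_poly0.
Qed.

End FallingFactorials.

(** This is L(k), written with the normal form x^m A_j = x^(nu+j) C_j; [euler_normal_form]
    identifies the two. *)
Definition euler_mx (K : fieldType) (N m : nat) (C : 'I_m.+1 -> 'M[{poly K}]_N)
  (k : nat) : 'M[K]_N := \sum_(j < m.+1) (k ^_ j)%:R *: coef_mx (C j) 0.

(** * A linear relation between Euler functionals and its contradiction *)

Section LeadingCoefficient.
Variables (K : numFieldType) (N m' : nat).
Local Notation m := m'.+1.
Local Notation I := ('I_m * 'I_N)%type.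
Variables (A C : 'I_m.+1 -> 'M[{poly K}]_N) (nu b v k0 : nat) (D1 : {poly K}).
Local Notation D := (\det (A ord_max)).
Local Notation NN h := (itN D (compB A) h).
Local Notation ZZ h i := (itZ D (compB A) (compF A) h i).
Hypothesis ACE : forall j, 'X^m *: A j = 'X^(nu + j) *: C j.
Hypothesis DE : D = 'X^v * D1.
Hypothesis D10 : D1`_0 != 0.
Local Notation Lnat := (euler_mx C).
Hypothesis detL : forall k, (k0 <= k)%N -> \det (Lnat k) != 0.
Hypothesis poles : forall h p q j, (j + h + b < v * h)%N -> (NN h p q)`_j = 0.
Variables (w : 'cV[K]_N) (s : 'I_N).
Hypothesis Cw : coef_mx (C ord_max) 0 *m w = 0.
Hypothesis ws : w s 0 != 0.

Let d := #|{: I}|.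
Let H := (d * b.+1)%N.
Let p0 : 'I_d := enum_rank ((ord_max, s) : I).

(** Row p0 belongs to the derivative of order m' of component s, so this is the coefficient of Y_q
    in D^H x^(m'+h) y_s^(m'+h), up to terms in P y. The factor D^(H-h) gives all h the common
    denominator D^H. *)
Let base h q : {poly K} := D ^+ (H - h) * 'X^(m' + h) * NN h p0 q.

(** The orders v (H - h), m' + h and v h - h - b of the three factors add up to v H + m' - b, in
    which h has cancelled. *)
Lemma base_low (h : 'I_H.+1) q j : (j + b < v * H + m')%N -> (base h q)`_j = 0.
Proof.
have [N' eN'] : exists N', NN h p0 q = 'X^(v * h - h - b) * N'.
  by apply: coef_low_factor => i lt; apply: poles; lia.
move=> lt; rewrite /base eN' DE exprMn -exprM.
rewrite (_ : _ * _ = 'X^(v * (H - h) + (m' + h) + (v * h - h - b)) *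
   (D1 ^+ (H - h) * N')); last by rewrite !exprD; ring.
rewrite coefXnM; case: ltnP => // le.
have leh := ltn_ord h; have : (v * (H - h) + v * h = v * H)%N by rewrite -mulnDr subnK.
lia.
Qed.

(** By [base_low] only the b + 1 coefficients in degrees v H + m' - b to v H + m' can obstruct, for
    each of the d values of q: there are H conditions on H + 1 unknowns. *)
Lemma exists_combination : exists2 a : 'I_H.+1 -> K, exists h, a h != 0 &
  forall q j, (j < v * H + m)%N -> (\sum_h a h *: base h q)`_j = 0.
Proof.
pose X := ('I_d * 'I_b.+1)%type.
pose M : 'M[K]_(H.+1, #|{: X}|) := \matrix_(h < H.+1, x < #|{: X}|)
  (base h (enum_val x : X).1)`_(v * H + m' - (enum_val x : X).2).
have rk : (\rank (kermx M) > 0)%N.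
  rewrite mxrank_ker subn_gt0 ltnS (leq_trans (rank_leq_col _)) //.
  by rewrite card_prod !card_ord.
have nz : kermx M != 0 by rewrite -mxrank_eq0 -lt0n.
have [r rnz] : exists r, row r (kermx M) != 0.
  apply/not_existsP => z; case/negP: nz; apply/eqP/row_matrixP => r.
  by rewrite row0; apply/eqP/negPn/negP/z.
exists (row r (kermx M) 0).
  apply/not_existsP => z; case/negP: rnz; apply/eqP/rowP => h.
  by rewrite [RHS]mxE; apply/eqP/negPn/negP/z.
have aM : row r (kermx M) *m M = 0 by rewrite -row_mul mulmx_ker row0.
move=> q j lt; rewrite coef_sum.
case: (ltnP (j + b) (v * H + m')) => [lo|hi].
  by rewrite big1 // => h _; rewrite coefZ base_low ?mulr0.
have lb : (v * H + m' - j < b.+1)%N by lia.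
move/rowP: aM => /(_ (enum_rank ((q, Ordinal lb) : X))); rewrite !mxE => aM.
rewrite -[RHS]aM; apply: eq_bigr => h _; rewrite coefZ [M _ _]mxE enum_rankK /=.
by congr (_ * _`_ _); lia.
Qed.


Definition test (w' : 'cV[K]_N) k (i : nat) (t : 'I_N) : {poly K} :=
  (w' t 0 *: 'X^k)^`(i).

Lemma mulXn_test w' k i t :
  'X^i * test w' k i t = ((k ^_ i)%:R * w' t 0)%:P * 'X^k.
Proof.
rewrite /test derivnZ derivnXn -scaler_nat scalerA mul_polyC -scalerAr -exprD.
rewrite [w' t 0 * _]mulrC; case: (leqP i k) => le; first by rewrite subnKC.
by rewrite ffact_small // !mul0r !scale0r.
Qed.

(** P (x^k w') = x^(nu+k-m) [gg k w'], with constant term L(k) w'. Below, k is written k' + m to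
    keep the exponent natural. *)
Definition gg k (w' : 'cV[K]_N) r : {poly K} :=
  \sum_(j < m.+1) \sum_t (k ^_ j)%:R *: (C j r t * (w' t 0)%:P).

Lemma gg_coef0 k w' r : (gg k w' r)`_0 = (Lnat k *m w') r 0.
Proof.
rewrite /gg /euler_mx coef_sum mulmx_suml summxE; apply: eq_bigr => j _.
rewrite -scalemxAl !mxE coef_sum mulr_sumr; apply: eq_bigr => t _.
by rewrite coefZ coefMC mxE.
Qed.

Lemma opG_test k' w' r :
  @opG K N m A {poly K}^o (test w' (k' + m)) r = 'X^(nu + k') * gg (k' + m) w' r.
Proof.
apply: (@mulfI _ ('X^m)); first by rewrite monic_neq0 // monicXn.
rewrite /opG /gg mulrA -exprD !mulr_sumr; apply: eq_bigr => j _.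
rewrite !mulr_sumr; apply: eq_bigr => t _.
have /matrixP/(_ r t) := ACE j; rewrite !mxE => ACt.
rewrite -[_ *: _]/(A j r t * test w' (k' + m) j t) mulrA ACt.
transitivity ('X^nu * C j r t * ('X^j * test w' (k' + m) j t)).
  by rewrite exprD; ring.
by rewrite mulXn_test -!mul_polyC rmorphM /= !exprD; ring.
Qed.

Section Identity.
Variables (a : 'I_H.+1 -> K).

Let aa k := \sum_h a h * (k ^_ (m' + h))%:R.
Let rho q : {poly K} := \sum_h a h *: base h q.
Let zeta i r : {poly K} := \sum_(h < H.+1) a h *: (D ^+ (H - h) * 'X^(m' + h) * ZZ h i p0 r).
Let xi i r : {poly K} := 'X^(H - i) * zeta i r.

(** The combination with weights a of [iterated_system] for y = x^k w'. Since x^h (d/dx)^h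
    multiplies x^k by k ^_ h, the left side collects [aa]; the factor x^H supplies the x^i that
    turns the i-th derivative of P y into [euler]. *)
Lemma test_identity k' (w' : 'cV[K]_N) :
  'X^H * (D ^+ H * ((aa (k' + m) * w' s 0)%:P * 'X^(k' + m))
          - \sum_q rho q * @compY K N m {poly K}^o (test w' (k' + m)) q)
  = 'X^(nu + k') * \sum_(i < H) \sum_r xi i r * euler (nu + k') i (gg (k' + m) w' r).
Proof.
set k := (k' + m)%N; set Y := compY _; set G := fun r => 'X^(nu + k') * gg k w' r.
have key (h : 'I_H.+1) : D ^+ h * test w' k (m' + h) s =
    \sum_q NN h p0 q * Y q + \sum_(i < H) \sum_r ZZ h i p0 r * (G r)^`(i).
  have /= := @iterated_system K #|{: I}| N D (compB A) (compF A) {poly K}^o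
    (@deriv K) (fun p v => derivM p v) Y _
    (@companion_system K N m A {poly K}^o (@deriv K) (test w' k) (fun _ _ => erefl _)) h p0.
  have -> : iter h (@deriv K) (Y p0) = test w' k (m' + h) s.
    by rewrite /Y /compY /p0 enum_rankK /= /test addnC /derivn iterD.
  rewrite -[_ *: _]/(_ * _) => ->; congr (_ + _).
  transitivity (\sum_(i < h) \sum_r ZZ h i p0 r * (G r)^`(i)).
    by apply: eq_bigr => i _; apply: eq_bigr => r _; rewrite /G -opG_test.
  have leh : (h <= H)%N by rewrite -ltnS.
  rewrite (big_ord_widen H (fun i => \sum_r ZZ h i p0 r * (G r)^`(i)) leh).
  rewrite big_mkcond /=; apply: eq_bigr => i _; case: ltnP => // le.
  by rewrite big1 // => r _; rewrite itZ_small // mxE mul0r.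
transitivity ('X^H * \sum_(i < H) \sum_r zeta i r * (G r)^`(i)); last first.
  rewrite !mulr_sumr; apply: eq_bigr => i _; rewrite !mulr_sumr.
  apply: eq_bigr => r _; rewrite /xi mulrCA -!mulrA mulrCA [RHS]mulrCA.
  have e : 'X^H * (G r)^`(i) = 'X^(H - i) * ('X^(nu + k') * euler (nu + k') i (gg k w' r)).
    by rewrite -eulerE mulrA -exprD subnK // ltnW.
  by rewrite mulrCA e; ring.
congr (_ * _); apply/eqP; rewrite subr_eq addrC; apply/eqP.
have -> : D ^+ H * ((aa k * w' s 0)%:P * 'X^k) =
    \sum_h a h *: (D ^+ (H - h) * 'X^(m' + h) * (D ^+ h * test w' k (m' + h) s)).
  rewrite /aa mulr_suml rmorph_sum !mulr_suml mulr_sumr; apply: eq_bigr => h _.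
  have leh : (h <= H)%N by rewrite -ltnS.
  transitivity (a h *: (D ^+ (H - h) * D ^+ h * ('X^(m' + h) * test w' k (m' + h) s))).
    rewrite -exprD subnK // mulXn_test -mul_polyC !rmorphM /=; ring.
  by congr (_ *: _); ring.
transitivity (\sum_h (\sum_q a h *: base h q * Y q + \sum_(i < H) \sum_r
   a h *: (D ^+ (H - h) * 'X^(m' + h) * ZZ h i p0 r) * (G r)^`(i))).
  apply: eq_bigr => h _; rewrite key mulrDr scalerDr; congr (_ + _).
    rewrite mulr_sumr scaler_sumr; apply: eq_bigr => q _.
    by rewrite /base -scalerAl mulrA.
  rewrite mulr_sumr scaler_sumr; apply: eq_bigr => i _.
  rewrite mulr_sumr scaler_sumr; apply: eq_bigr => r _.
  by rewrite -scalerAl mulrA.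
rewrite big_split /=; congr (_ + _).
  by rewrite exchange_big; apply: eq_bigr => q _; rewrite mulr_suml.
rewrite exchange_big; apply: eq_bigr => i _.
rewrite exchange_big; apply: eq_bigr => r _; by rewrite mulr_suml.
Qed.

Hypothesis a_neq0 : exists h, a h != 0.
Hypothesis rho_low : forall q j, (j < v * H + m)%N -> (rho q)`_j = 0.

(** Entries of Y have order at least k - m' and [rho] has order at least v H + m, so their products
    start at v H + k + 1, one beyond D^H x^k. Hence they only contribute to a multiple of 'X after
    the common power is removed. *)
Lemma test_identity_reduced k' (w' : 'cV[K]_N) : exists sigma : {poly K},
  'X^(H + (v * H + m)) * (D1 ^+ H * (aa (k' + m) * w' s 0)%:P - 'X * sigma)
  = 'X^nu * \sum_(i < H) \sum_r xi i r * euler (nu + k') i (gg (k' + m) w' r).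
Proof.
have /choice[rho' hrho] : forall q, exists r, rho q = 'X^(v * H + m) * r.
  by move=> q; apply: coef_low_factor => j; apply: rho_low.
pose Y := @compY K N m {poly K}^o (test w' (k' + m)).
have /choice[Y' hY] : forall q, exists y : {poly K}, 'X^m * (Y q : {poly K}) = 'X^((k' + m).+1) * y.
  move=> q; rewrite /Y /compY /=; case: (enum_val q) => i t.
  exists ((((k' + m) ^_ i)%:R * w' t 0)%:P * 'X^(m' - i)).
  have im : (m = m' - i + i.+1)%N by rewrite addnS subnK // -ltnS.
  rewrite {1}im exprD exprS -!mulrA mulXn_test exprS; ring.
exists (\sum_q rho' q * Y' q); apply: (@mulfI _ 'X^k').
  by rewrite monic_neq0 // monicXn.
rewrite mulrA [X in _ = X](mulrA _ 'X^nu) -exprD [(k' + nu)%N]addnC -test_identity.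
have -> : \sum_q rho q * Y q = 'X^(v * H) * 'X^((k' + m).+1) * \sum_q rho' q * Y' q.
  rewrite mulr_sumr; apply: eq_bigr => q _.
  transitivity ('X^(v * H) * rho' q * ('X^m * Y q)); last by rewrite hY; ring.
  by rewrite hrho exprD; ring.
rewrite DE exprMn -exprM (exprS _ (k' + m)) !exprD; ring.
Qed.

(** Let f be the least order among all [xi]. In the reduced identity the right side starts at nu + f
    or later, and the left side at H + v H + m as soon as aa(k) w_s is nonzero; each of the three
    ways to compare these numbers is absurd. *)
Lemma bounded_poles_absurd_aux : False.
Proof.
have [h0 ah0] := a_neq0.
(* The largest index hs with a nonzero weight fixes the degree m' + hs of [pa], the polynomial in k
   with values aa(k). *)
case: (@arg_maxnP _ h0 (fun h => a h != 0) (fun h => h : nat) ah0) => hs ahs hmax {h0 ah0}.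
pose pa : {poly K} := \sum_(h < hs.+1) a (inord h) *: falling K (m' + h).
have size_pa : size pa = (m' + hs).+1.
  by apply: (@size_falling_comb_eq K m' hs (fun h => a (inord h))); rewrite inord_val.
have paE k : pa.[k%:R] = aa k.
  rewrite /pa /aa horner_sum.
  have leh : (hs.+1 <= H.+1)%N by exact: ltn_ord.
  rewrite (big_ord_widen H.+1 (fun h => (a (inord h) *: falling K (m' + h)).[k%:R]) leh).
  rewrite big_mkcond; apply: eq_bigr => h _; case: ltnP => lt.
    by rewrite hornerZ falling_nat inord_val.
  suff -> : a h = 0 by rewrite mul0r.
  by apply/eqP/negPn/negP => /hmax /=; rewrite leqNgt lt.
have pa0 : pa != 0 by rewrite -size_poly_eq0 size_pa.
have aa0 : ~ forall k', aa (k' + m) = 0.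
  have [k1 hk1] := poly_nat_neq0 pa0 => z.
  by have := hk1 (k1 + m)%N (leq_addr _ _); rewrite paE z eqxx.
have D1H : (D1 ^+ H)`_0 != 0.
  by rewrite -horner_coef0 horner_exp horner_coef0 expf_neq0.
have alphaE c sigma : (D1 ^+ H * c%:P - 'X * sigma)`_0 = (D1 ^+ H)`_0 * c.
  by rewrite coefB coefMC coefXM subr0.
have xi_small i r : (hs <= i)%N -> xi i r = 0.
  move=> le; rewrite /xi /zeta big1 ?mulr0 // => h _.
  case: (ltnP hs h) => lt; last by rewrite itZ_small ?mxE ?mulr0 ?scaler0 // (leq_trans lt).
  suff -> : a h = 0 by rewrite scale0r.
  by apply/eqP/negPn/negP => /hmax /=; rewrite leqNgt lt.
have [exf|nxf] := pselect (exists f, [exists i : 'I_H, [exists r, (xi i r)`_f != 0]]); last first.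
  (* If all [xi] vanish, the right side is 0 and the identity forces aa(k) = 0. *)
  apply: aa0 => k'; have [sigma] := test_identity_reduced k' w.
  rewrite [X in 'X^nu * X]big1 => [|i _]; last first.
    rewrite big1 // => r _; suff -> : xi i r = 0 by rewrite mul0r.
    apply/polyP => f; rewrite coef0; apply/eqP/negPn/negP => nz; apply: nxf; exists f.
    by apply/existsP; exists i; apply/existsP; exists r.
  move/(congr1 (fun p : {poly K} => p`_(H + (v * H + m)))).
  rewrite mulr0 coef0 coefXnM ltnn subnn alphaE => /eqP.
  by rewrite !mulf_eq0 (negbTE D1H) (negbTE ws) orbF => /eqP.
case: (ex_minnP exf) => f /existsP[i0 /existsP[r0 xif0]] fmin {exf}.
have xi_low (i : 'I_H) r j : (j < f)%N -> (xi i r)`_j = 0.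
  move=> lt; apply/eqP/negPn/negP => nz; suff : (f <= j)%N by rewrite leqNgt lt.
  by apply: fmin; apply/existsP; exists i; apply/existsP; exists r.
pose c i r := if insub i is Some i' then (xi (i' : 'I_H) r)`_f else 0.
have cE (i : 'I_H) r : c i r = (xi i r)`_f by rewrite /c valK.
(* The polynomial row of the final relation. The shift by nu is due to the constant term of [euler],
   which carries (nu + k') ^_ i. *)
pose P r : {poly K} := (\sum_(i < H) c i r *: falling K i) \Po ('X + nu%:R%:P).
have PE r k' : (P r).[k'%:R] = \sum_(i < H) (xi i r)`_f * ((nu + k') ^_ i)%:R.
  rewrite /P horner_comp !hornerE -natrD addnC horner_sum; apply: eq_bigr => i _.
  by rewrite hornerZ falling_nat cE.
pose S k' (w' : 'cV[K]_N) : {poly K} :=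
  \sum_(i < H) \sum_r xi i r * euler (nu + k') i (gg (k' + m) w' r).
have S_low k' w' j : (j < f)%N -> (S k' w')`_j = 0.
  move=> lt; rewrite coef_sum big1 // => i _; rewrite coef_sum big1 // => r _.
  by apply: (coefM_low _ (xi_low i r)).1.
have S_f k' w' : (S k' w')`_f = \sum_r (P r).[k'%:R] * (Lnat (k' + m) *m w') r 0.
  rewrite coef_sum; under [RHS]eq_bigr do rewrite PE mulr_suml.
  rewrite exchange_big /=; apply: eq_bigr => i _; rewrite coef_sum; apply: eq_bigr => r _.
  by rewrite (coefM_low _ (xi_low i r)).2 euler_coef0 gg_coef0 mulrA.
case: (ltngtP (nu + f) (H + (v * H + m))) => cmp.
(* The right side would start first, so its leading coefficient, the row P(k') times L(k), kills
   every vector. Invertibility of L(k) and the independence of falling factorials then contradict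
   the choice of f. *)
- have beta0 k' (w' : 'cV[K]_N) : \sum_r (P r).[k'%:R] * (Lnat (k' + m) *m w') r 0 = 0.
    have [sigma] := test_identity_reduced k' w'.
    move/(congr1 (fun p : {poly K} => p`_(nu + f))).
    by rewrite !coefXnM cmp ltnNge leq_addr /= addKn S_f => <-.
  have Pz k' : (k0 <= k')%N -> forall r, (P r).[k'%:R] = 0.
    move=> le; pose row := \row_r (P r).[k'%:R].
    have : row *m Lnat (k' + m) = 0.
      apply/rowP => t; rewrite [RHS]mxE -[RHS](beta0 k' (delta_mx t 0)) mxE.
      by apply: eq_bigr => r _; rewrite -colE !mxE.
    move/(congr1 (mulmx^~ (invmx (Lnat (k' + m))))); rewrite mulmxK; last first.
      by rewrite unitmxE unitfE detL // (leq_trans le) // leq_addr.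
    by rewrite mul0mx => /rowP H' r; have := H' r; rewrite !mxE.
  have P0 r : P r = 0.
    apply/eqP/negPn/negP => /poly_nat_neq0[k1 hk1].
    by have := hk1 (maxn k0 k1) (leq_maxr _ _); rewrite Pz ?leq_maxl ?eqxx.
  have := P0 r0; rewrite /P => /eqP; rewrite comp_poly_eq0; last by rewrite size_XaddC.
  move=> /eqP e; have := @falling_free K H (c^~ r0) e i0 (ltn_ord i0); rewrite cE => z.
  by rewrite z eqxx in xif0.
(* The left side would start first, so aa(k) w_s = 0 for all k. *)
- apply: aa0 => k'; have [sigma] := test_identity_reduced k' w.
  move/(congr1 (fun p : {poly K} => p`_(H + (v * H + m)))).
  rewrite !coefXnM ltnn subnn alphaE.
  have -> : (if (H + (v * H + m) < nu)%N then 0 else (S k' w)`_(H + (v * H + m) - nu)) = 0.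
    by case: ltnP => // le; apply: S_low; rewrite ltn_subLR.
  move/eqP; by rewrite !mulf_eq0 (negbTE D1H) (negbTE ws) orbF => /eqP.
(* Equality of the orders gives an identity of polynomials in k'. On its right, P r has degree below
   hs, because Z_(h,i) = 0 for i >= h, and the entries of L(k) w have degree below m, because C_m(0)
   w = 0. The left side has degree m' + hs, which is out of reach. *)
- pose cL r j := (coef_mx (C (inord j)) 0 *m w) r 0.
  pose Lw r : {poly K} := (\sum_(j < m) cL r j *: falling K j) \Po ('X + m%:R%:P).
  have LwE r k' : (Lw r).[k'%:R] = (Lnat (k' + m) *m w) r 0.
    rewrite /Lw horner_comp !hornerE -natrD horner_sum /euler_mx mulmx_suml summxE.
    rewrite [RHS]big_ord_recr /= -scalemxAl [X in _ = _ + X]mxE Cw mxE mulr0 addr0.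
    apply: eq_bigr => j _; rewrite hornerZ falling_nat -scalemxAl mxE mulrC /cL.
    congr (_ * (coef_mx (C _) _ *m _) _ _); apply: val_inj => /=.
    by rewrite inordK // ltnW // ltnS.
  have e : ((D1 ^+ H)`_0 * w s 0) *: (pa \Po ('X + m%:R%:P)) = \sum_r P r * Lw r.
    apply: poly_nat_ext => k'; rewrite hornerZ horner_comp !hornerE -natrD paE.
    rewrite horner_sum; under eq_bigr do rewrite hornerM LwE.
    rewrite -S_f; have [sigma] := test_identity_reduced k' w.
    move/(congr1 (fun p : {poly K} => p`_(H + (v * H + m)))).
    rewrite !coefXnM ltnn subnn alphaE -cmp ltnNge leq_addr /= addKn => <-.
    by rewrite mulrAC mulrA.
  have := congr1 (fun p : {poly K} => size p) e.
  rewrite size_scale ?mulf_neq0 // size_comp_poly2 ?size_XaddC // size_pa => sz.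
  have : (size (\sum_r P r * Lw r)%R <= (m' + hs))%N.
    apply: (leq_trans (size_sum _ _ _)); apply/bigmax_leqP => r _.
    apply: (leq_trans (size_polyMleq _ _)).
    rewrite /P /Lw !size_comp_poly2 ?size_XaddC //.
    have s1 : (size (\sum_(i < H) c i r *: falling K i)%R <= hs)%N.
      apply: (leq_trans (size_sum _ _ _)); apply/bigmax_leqP => i _.
      case: (ltnP i hs) => lt; last by rewrite cE xi_small // coef0 scale0r size_poly0.
      by apply: (leq_trans (size_scale_leq _ _)); rewrite size_falling.
    have s2 := @size_falling_comb K 0 m (cL r).
    rewrite -ltnS; apply: (@leq_ltn_trans (hs + m).-1); last by rewrite addnS addnC.
    by rewrite -!subn1 leq_sub2r // leq_add.
  by rewrite -sz ltnn.
Qed.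

End Identity.

Lemma bounded_poles_absurd : False.
Proof.
by have [a a0 lo] := exists_combination; apply: (bounded_poles_absurd_aux a0 lo).
Qed.

End LeadingCoefficient.

(** * Convergent power series *)

Section Modulus.
Variable R : realType.
Local Notation C := (Cplx R).
Implicit Types z w : C.

(** The norm of [Cplx R] takes values in the complex field; a real-valued modulus gives access to
    real orders, limits and derivatives. *)
Definition cabs z : R := complex.Re (`|z| : R[i]%C).
Definition rc (x : R) : C := x%:C%C.

Lemma normE z : `|z| = rc (cabs z).
Proof. by rewrite /rc /cabs RRe_real // normr_real. Qed.
Lemma cabsE z : cabs z = Num.sqrt (complex.Re z ^+ 2 + complex.Im z ^+ 2).
Proof. by rewrite /cabs normc_def. Qed.
Lemma rcD x y : rc (x + y) = rc x + rc y. Proof. exact: rmorphD. Qed.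
Lemma rcM x y : rc (x * y) = rc x * rc y. Proof. exact: rmorphM. Qed.
Lemma rcN x : rc (- x) = - rc x. Proof. exact: rmorphN. Qed.
Lemma rc_nat n : rc n%:R = n%:R. Proof. exact: rmorph_nat. Qed.
Lemma rc0 : rc 0 = 0. Proof. by []. Qed.
Lemma rc1 : rc 1 = 1. Proof. by []. Qed.
Lemma rcX x n : rc (x ^+ n) = rc x ^+ n. Proof. exact: rmorphXn. Qed.
Lemma rcV x : rc x^-1 = (rc x)^-1. Proof. exact: fmorphV. Qed.
Lemma rc_le x y : (rc x <= rc y) = (x <= y). Proof. exact: lecR. Qed.
Lemma rc_lt x y : (rc x < rc y) = (x < y). Proof. exact: ltcR. Qed.
Lemma rc_inj : injective rc. Proof. exact: complexI. Qed.

Lemma cabs_ge0 z : 0 <= cabs z.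
Proof. by rewrite -rc_le -normE normr_ge0. Qed.
Lemma cabsM z w : cabs (z * w) = cabs z * cabs w.
Proof. by apply: rc_inj; rewrite rcM -!normE normrM. Qed.
Lemma cabsD z w : cabs (z + w) <= cabs z + cabs w.
Proof. by rewrite -rc_le rcD -!normE ler_normD. Qed.
Lemma cabsN z : cabs (- z) = cabs z.
Proof. by apply: rc_inj; rewrite -!normE normrN. Qed.
Lemma cabsB z w : cabs (z - w) <= cabs z + cabs w.
Proof. by rewrite -(cabsN w) cabsD. Qed.
Lemma cabsC z w : cabs (z - w) = cabs (w - z).
Proof. by rewrite -cabsN opprB. Qed.
Lemma cabsX z n : cabs (z ^+ n) = cabs z ^+ n.
Proof. by apply: rc_inj; rewrite rcX -!normE normrX. Qed.
Lemma cabsV z : cabs z^-1 = (cabs z)^-1.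
Proof. by apply: rc_inj; rewrite rcV -!normE normfV. Qed.
Lemma cabs0 : cabs 0 = 0. Proof. by apply: rc_inj; rewrite -normE normr0. Qed.
Lemma cabs1 : cabs 1 = 1. Proof. by apply: rc_inj; rewrite -normE normr1. Qed.
Lemma cabs_eq0 z : (cabs z == 0) = (z == 0).
Proof. by rewrite -(inj_eq rc_inj) -normE normr_eq0. Qed.
Lemma cabs_gt0 z : (0 < cabs z) = (z != 0).
Proof. by rewrite lt0r cabs_eq0 cabs_ge0 andbT. Qed.
Lemma cabs_rc x : cabs (rc x) = `|x|.
Proof. by rewrite cabsE /rc /= expr0n addr0 sqrtr_sqr. Qed.
Lemma cabs_nat n : cabs n%:R = n%:R.
Proof. by rewrite -rc_nat cabs_rc normr_nat. Qed.
Lemma cabs_sum (I : Type) (r : seq I) (P : pred I) (F : I -> C) :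
  cabs (\sum_(i <- r | P i) F i) <= \sum_(i <- r | P i) cabs (F i).
Proof.
elim/big_rec2: _ => [|i x y _ h]; first by rewrite cabs0.
by apply: le_trans (cabsD _ _) _; rewrite lerD2l.
Qed.
Lemma cabs_prod (I : Type) (r : seq I) (P : pred I) (F : I -> C) :
  cabs (\prod_(i <- r | P i) F i) = \prod_(i <- r | P i) cabs (F i).
Proof. by apply: (big_morph cabs cabsM cabs1). Qed.
Lemma cabs_distl z w : cabs z - cabs w <= cabs (z - w).
Proof. by have := cabsD (z - w) w; rewrite subrK; lra. Qed.

Lemma cabs_sqr z : cabs z ^+ 2 = complex.Re z ^+ 2 + complex.Im z ^+ 2.
Proof.
by case: z => a b; rewrite cabsE /= sqr_sqrtr // addr_ge0 ?sqr_ge0.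
Qed.

Lemma Re_le_cabs z : `|complex.Re z| <= cabs z.
Proof. by rewrite -rc_le -normE; apply: normc_ge_Re. Qed.

Lemma Im_le_cabs z : `|complex.Im z| <= cabs z.
Proof.
rewrite -(ler_pXn2r (n := 2)) ?nnegrE ?cabs_ge0 // cabs_sqr -normrX.
by rewrite ger0_norm ?sqr_ge0 // lerDr sqr_ge0.
Qed.

Lemma cabs_le_ReIm z : cabs z <= `|complex.Re z| + `|complex.Im z|.
Proof.
rewrite -(ler_pXn2r (n := 2)) ?nnegrE ?cabs_ge0 ?addr_ge0 // cabs_sqr.
rewrite sqrrD !real_normK ?num_real // addrAC lerDl.
by rewrite mulrn_wge0 // mulr_ge0.
Qed.

Lemma cabs_small_eq0 z : (forall e, 0 < e -> cabs z <= e) -> z = 0.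
Proof.
move=> H; apply/eqP; rewrite -cabs_eq0 eq_le cabs_ge0 andbT leNgt.
apply/negP => lt; have := H (cabs z / 2); rewrite divr_gt0 // => /(_ isT); lra.
Qed.

Definition clim (u : nat -> C) (l : C) := forall e : R, 0 < e ->
  exists n0, forall n, (n0 <= n)%N -> cabs (u n - l) <= e.

Lemma clim_unique u l l' : clim u l -> clim u l' -> l = l'.
Proof.
move=> h h'; apply/eqP; rewrite -subr_eq0; apply/eqP.
apply: cabs_small_eq0 => e e0.
have e20 : 0 < e / 2 by lra.
have [n0 hn] := h _ e20; have [n1 hn'] := h' _ e20.
have a := hn (maxn n0 n1) (leq_maxl _ _); have b := hn' (maxn n0 n1) (leq_maxr _ _).
rewrite -(subrKA (u (maxn n0 n1))); apply: le_trans (cabsD _ _) _.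
by rewrite cabsC; lra.
Qed.

Lemma clim_ext u v l : u =1 v -> clim u l -> clim v l.
Proof.
by move=> uv h e /h[n0 H]; exists n0 => n /H; rewrite uv.
Qed.

Lemma clim_cst l : clim (fun _ => l) l.
Proof. by move=> e e0; exists 0%N => n _; rewrite subrr cabs0 ltW. Qed.

Lemma climD u v l k : clim u l -> clim v k -> clim (fun n => u n + v n) (l + k).
Proof.
move=> hu hv e e0; have e20 : 0 < e / 2 by lra.
have [n0 hn] := hu _ e20; have [n1 hn'] := hv _ e20.
exists (maxn n0 n1) => n; rewrite geq_max => /andP[/hn a /hn' b].
rewrite opprD addrACA; apply: le_trans (cabsD _ _) _; lra.
Qed.

Lemma climZ a u l : clim u l -> clim (fun n => a * u n) (a * l).
Proof.
move=> hu e e0; have k0 : 0 < cabs a + 1 by have := cabs_ge0 a; lra.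
have [|n0 hn] := hu (e / (cabs a + 1)); first by rewrite divr_gt0.
exists n0 => n /hn. rewrite ler_pdivlMr // -mulrBr cabsM => h.
apply: le_trans h; rewrite mulrC ler_wpM2l ?cabs_ge0 //; lra.
Qed.

Lemma clim_le u l K : clim u l -> (forall n, cabs (u n) <= K) -> cabs l <= K.
Proof.
move=> h hK; apply/ler_addgt0Pr => e e0; have [n0 hn] := h _ e0.
have := hn n0 (leqnn _); have := hK n0.
by have := cabs_distl l (u n0); rewrite [cabs (l - _)]cabsC; lra.
Qed.

Lemma clim_shift u l : clim u l -> clim (fun n => u n.+1) l.
Proof. by move=> h e /h[n0 H]; exists n0 => n le; apply: H; apply: leqW. Qed.

End Modulus.

Section PowerSeries.
Variable R : realType.
Local Notation C := (Cplx R).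
Implicit Types (c : nat -> C) (z : C) (r : R).

(** Boundedness of the weighted coefficients for every r < r0 is equivalent to convergence in the
    open disc of radius r0, and is easy to propagate through recursions. *)
Definition radius_ge c r0 := forall r, 0 < r < r0 ->
  exists M, forall j, cabs (c j) * r ^+ j <= M.

Definition psum c n : {poly C} := \poly_(j < n) c j.

(** A total function: its value is meaningful only where the partial sums converge. *)
Definition csum c z : C :=
  ((limn (fun n => complex.Re (psum c n).[z])) +i*
   (limn (fun n => complex.Im (psum c n).[z])))%C.

Lemma psumE c n z : (psum c n).[z] = \sum_(j < n) c j * z ^+ j.
Proof. by rewrite horner_poly. Qed.

Lemma geo_tail (q : R) n m : 0 <= q < 1 ->
  \sum_(n <= j < n + m) q ^+ j <= q ^+ n / (1 - q).
Proof.
move=> /andP[q0 q1]; rewrite -{1}[n]add0n big_addn addnC addnK.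
under eq_bigr do rewrite exprD.
rewrite -mulr_suml [leRHS]mulrC ler_wpM2r ?exprn_ge0 // -[leRHS]mul1r.
rewrite ler_pdivlMr ?subr_gt0 // big_mkord mulrC -opprB mulNr -subrX1 opprB.
by rewrite lerBlDr lerDl exprn_ge0.
Qed.

Lemma psum_tail c M r rho n m z : 0 < r -> 0 <= rho < r ->
  (forall j, cabs (c j) * r ^+ j <= M) -> cabs z <= rho ->
  cabs ((psum c (n + m)).[z] - (psum c n).[z]) <= M * ((rho / r) ^+ n / (1 - rho / r)).
Proof.
move=> r0 /andP[rho0 rhor] hM zr.
have M0 : 0 <= M by apply: le_trans (hM 0%N); rewrite mulr_ge0 ?cabs_ge0 // ltW.
rewrite !psumE -!(big_mkord xpredT (fun j => c j * z ^+ j)).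
rewrite (@big_cat_nat _ _ _ n 0 (n + m)) ?leq_addr //= addrAC subrr add0r.
apply: le_trans (cabs_sum _ _ _) _.
apply: (@le_trans _ _ (M * \sum_(n <= j < n + m) (rho / r) ^+ j)); last first.
  by rewrite ler_wpM2l // geo_tail // divr_ge0 ?(ltW r0) // ltr_pdivrMr // mul1r.
rewrite mulr_sumr; apply: ler_sum => j _.
rewrite cabsM cabsX expr_div_n mulrA ler_pdivlMr ?exprn_gt0 // mulrAC.
rewrite ler_pM ?mulr_ge0 ?cabs_ge0 ?exprn_ge0 ?cabs_ge0 ?(ltW r0) //.
by rewrite lerXn2r ?nnegrE ?cabs_ge0.
Qed.

Lemma geo_small (q M e : R) : 0 <= q < 1 -> 0 < e -> exists n0, forall n, (n0 <= n)%N ->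
  M * (q ^+ n / (1 - q)) <= e.
Proof.
move=> /andP[q0 q1] e0.
have : ((fun n => M / (1 - q) * q ^+ n) @ \oo --> (M / (1 - q) * 0 : R))%classic.
  apply: cvgM; first exact: cvg_cst.
  by apply: cvg_expr; rewrite ger0_norm.
rewrite mulr0 => /cvgrPdist_le /(_ e e0) [n0 _ H]; exists n0 => n le.
have := H n le; rewrite /= sub0r normrN => h.
by apply: le_trans h; rewrite mulrA mulrAC ler_norm.
Qed.

Lemma between (x y : R) : x < y -> exists2 t, x < t & t < y.
Proof. by move=> h; exists ((x + y) / 2); lra. Qed.

(** Uniformity on discs is needed in [csum_cauchy], where one partial sum has to be close to the
    series on a whole circle. *)
Lemma csum_unif c r0 rho e : radius_ge c r0 -> 0 <= rho < r0 -> 0 < e ->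
  exists n0, forall n z, (n0 <= n)%N -> cabs z <= rho ->
    cabs ((psum c n).[z] - csum c z) <= e.
Proof.
move=> hc /andP[rho0 rhor] e0; have [r rr rr0] := between rhor.
have r_gt0 : 0 < r by apply: le_lt_trans rr.
have [|M hM] := hc r; first by rewrite r_gt0.
have q01 : 0 <= rho / r < 1 by rewrite divr_ge0 ?(ltW r_gt0) //= ltr_pdivrMr // mul1r.
have tail e1 : 0 < e1 -> exists n0, forall n m z, (n0 <= n)%N -> cabs z <= rho ->
    cabs ((psum c (n + m)).[z] - (psum c n).[z]) <= e1.
  move=> e10; have [n0 H] := geo_small M q01 e10; exists n0 => n m z le zr.
  apply: le_trans (H n le); apply: psum_tail => //; by rewrite rho0.
(* Completeness is used for real sequences only; f is the real or the imaginary part. *)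
have cau (f : C -> R) z : (forall u, `|f u| <= cabs u) -> (forall u v, f (u - v) = f u - f v) ->
    cabs z <= rho -> cvgn (fun n => f (psum c n).[z]).
  move=> f1 fB zr; apply/cauchy_cvgP; apply: cauchy_exP => e1 /= e10.
  have e20 : 0 < e1 / 2 by lra.
  have [n0 H] := tail _ e20; exists (f (psum c n0).[z]); exists n0 => // n /= le.
  rewrite -ball_normE /= distrC -fB; apply: le_lt_trans (f1 _) _.
  by rewrite -(subnKC le); apply: le_lt_trans (H n0 _ z (leqnn _) zr) _; lra.
have lim z : cabs z <= rho -> clim (fun n => (psum c n).[z]) (csum c z).
  move=> zr e1 e10.
  have c1 := cau (@complex.Re R) z (@Re_le_cabs R) (fun u v => raddfB _ u v) zr.
  have c2 := cau (@complex.Im R) z (@Im_le_cabs R) (fun u v => raddfB _ u v) zr.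
  have e20 : 0 < e1 / 2 by lra.
  have /cvgrPdist_le /(_ _ e20) [n1 _ H1] := c1.
  have /cvgrPdist_le /(_ _ e20) [n2 _ H2] := c2.
  exists (maxn n1 n2) => n; rewrite geq_max => /andP[l1 l2].
  apply: le_trans (cabs_le_ReIm _) _.
  have := H1 n l1; have := H2 n l2; rewrite /= !raddfB /csum /=.
  rewrite distrC => a; rewrite distrC => b; lra.
have [n0 H] := tail (e / 2) (divr_gt0 e0 (ltr0n _ 2)).
exists n0 => n z le zr.
have e20 : 0 < e / 2 by lra.
have [n1 H1] := lim z zr _ e20.
have a := H1 (n + n1)%N (leq_addl _ _); have b := H n n1 z le zr.
rewrite -(subrKA (psum c (n + n1)).[z]); apply: le_trans (cabsD _ _) _.
by rewrite cabsC; lra.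
Qed.

Lemma csum_lim c r0 z : radius_ge c r0 -> cabs z < r0 ->
  clim (fun n => (psum c n).[z]) (csum c z).
Proof.
move=> hc zr e e0; have [|n0 H] := csum_unif hc (rho := cabs z) _ e0.
  by rewrite cabs_ge0.
by exists n0 => n le; apply: H.
Qed.

End PowerSeries.

Section ComplexDerivative.
Variable R : realType.
Local Notation C := (Cplx R).
Implicit Types (F G : C -> C) (z l : C).

Definition cdiff F z l := forall e : R, 0 < e -> exists2 d : R, 0 < d &
  forall h : C, cabs h < d -> cabs (F (z + h) - F z - h * l) <= e * cabs h.

Lemma pos_rc (e : C) : 0 < e -> e = rc (complex.Re e) /\ 0 < complex.Re e.
Proof.
case: e => a b; rewrite ltcE /= => /andP[/eqP -> a0]; by split.
Qed.

Lemma cdiffP F z l : cdiff F z l <-> is_derive z (1 : C) F l.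
Proof.
have key : cdiff F z l <->
  ((fun h : C => h^-1 *: ((F \o shift z) (h *: (1 : C)) - F z)) @ 0^' --> l)%classic.
  split=> [H|/cvgrPdist_le H].
    apply/cvgrPdist_le => e /pos_rc[-> e0]; have [d d0 hd] := H _ e0.
    apply/nbhs_ballP; exists (rc d); first by rewrite /= -rc0 rc_lt.
    move=> h; rewrite -ball_normE /= sub0r normrN normE rc_lt => /hd hh h0.
    have h0' : 0 < cabs h by rewrite cabs_gt0.
    rewrite normE rc_le -(ler_pM2r h0'); apply: le_trans hh.
    rewrite -cabsM mulrBl; rewrite -[h^-1 *: _]/(h^-1 * _) mulrAC mulVf // mul1r.
    by rewrite cabsC -[h *: 1]/(h * 1) mulr1 [l * h]mulrC [h + z]addrC.
  move=> e e0; have e0' : 0 < rc e by rewrite -rc0 rc_lt.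
  have /nbhs_ballP[d /pos_rc[de d0] hd] := H _ e0'.
  exists (complex.Re d) => // h hlt; have [->|h0] := eqVneq h 0.
    by rewrite mul0r addr0 subrr subr0 cabs0 mulr0.
  have := hd h; rewrite -ball_normE /= sub0r normrN normE de rc_lt => /(_ hlt h0).
  have h0' : 0 < cabs h by rewrite cabs_gt0.
  rewrite normE rc_le -(ler_pM2r h0'); apply: le_trans.
  rewrite -cabsM mulrBl; rewrite -[h^-1 *: _]/(h^-1 * _) mulrAC mulVf // mul1r.
  by rewrite cabsC -[h *: 1]/(h * 1) mulr1 [l * h]mulrC [h + z]addrC.
rewrite key; split=> [H|[ex df]].
  by split; [apply/cvg_ex; exists l | apply: cvg_lim].
by rewrite -df; exact: ex.
Qed.

Lemma cdiff_local F G z l (d : R) : 0 < d ->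
  (forall x, cabs (x - z) < d -> F x = G x) -> cdiff F z l -> cdiff G z l.
Proof.
move=> d0 FG H e e0; have [d1 d10 hd] := H e e0.
exists (Num.min d d1); first by rewrite lt_min d0.
move=> h; rewrite lt_min => /andP[h1 h2].
rewrite -!FG ?subrr ?cabs0 //; first exact: hd.
by rewrite addrAC subrr add0r.
Qed.

Lemma cdiff_quad F z l (d K : R) : 0 < d ->
  (forall h, cabs h < d -> cabs (F (z + h) - F z - h * l) <= K * cabs h ^+ 2) ->
  cdiff F z l.
Proof.
move=> d0 H e e0; have K0 : 0 < `|K| + 1 by rewrite ltr_wpDl.
exists (Num.min d (e / (`|K| + 1))); first by rewrite lt_min d0 divr_gt0.
move=> h; rewrite lt_min => /andP[h1 h2]; apply: le_trans (H h h1) _.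
rewrite expr2 mulrA ler_wpM2r ?cabs_ge0 //; move: h2; rewrite ltr_pdivlMr // => h2.
have := ler_norm K; have := cabs_ge0 h; nra.
Qed.

End ComplexDerivative.

Section SequenceModule.
Variable R : realType.
Local Notation C := (Cplx R).
Implicit Types (c : nat -> C) (p q : {poly C}).

Definition cder c : nat -> C := fun j => j.+1%:R * c j.+1.
Definition cshift c : nat -> C := fun j => if j is j'.+1 then c j' else 0.
Definition pact p c : nat -> C := fun j => \sum_(i < j.+1) p`_i * c (j - i)%N.

Lemma psum_cder c n : (psum c n.+1)^`() = psum (cder c) n.
Proof.
apply/polyP => j; rewrite coef_deriv !coef_poly ltnS; case: ltnP => // _.
  by rewrite /cder mulr_natl.
by rewrite mul0rn.
Qed.

Lemma coef_psum c n j : (j < n)%N -> (psum c n)`_j = c j.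
Proof. by move=> lt; rewrite coef_poly lt. Qed.

(** A coefficient of the product sees finitely many coefficients of c, so the module laws and the
    Leibniz rule reduce to identities between polynomials. *)
Lemma pact_trunc p c n j : (j < n)%N -> pact p c j = (p * psum c n)`_j.
Proof.
move=> lt; rewrite coefM; apply: eq_bigr => i _; rewrite coef_psum //.
by rewrite (leq_ltn_trans _ lt) // leq_subr.
Qed.

Lemma pactM p q c : pact (p * q) c = pact p (pact q c).
Proof.
apply/funext => j; rewrite (@pact_trunc _ _ j.+1) // -mulrA coefM.
apply: eq_bigr => i _; rewrite (@pact_trunc _ _ j.+1) //.
by rewrite ltnS leq_subr.
Qed.

Lemma pact1 c : pact 1 c = c.
Proof.
by apply/funext => j; rewrite (@pact_trunc _ _ j.+1) // mul1r coef_psum.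
Qed.

Lemma pactDl p q c : pact (p + q) c = (fun j => pact p c j + pact q c j).
Proof.
apply/funext => j; rewrite /pact -big_split; apply: eq_bigr => i _.
by rewrite coefD mulrDl.
Qed.

Lemma pactDr p c c' : pact p (fun j => c j + c' j) = (fun j => pact p c j + pact p c' j).
Proof.
by apply/funext => j; rewrite /pact -big_split; apply: eq_bigr => i _; rewrite mulrDr.
Qed.

Lemma pactC a c : pact a%:P c = (fun j => a * c j).
Proof.
by apply/funext => j; rewrite (@pact_trunc _ _ j.+1) // coefCM coef_psum.
Qed.

Lemma pactX c : pact 'X c = cshift c.
Proof.
apply/funext => j; rewrite (@pact_trunc _ _ j.+1) // coefXM.
by case: j => //= j; rewrite coef_psum.
Qed.

Lemma cder_pact p c :
  cder (pact p c) = (fun j => pact p^`() c j + pact p (cder c) j).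
Proof.
apply/funext => j; rewrite /cder (@pact_trunc _ _ j.+2) // mulr_natl -coef_deriv derivM.
by rewrite psum_cder coefD (@pact_trunc _ c j.+2) ?(@pact_trunc _ (cder c) j.+1).
Qed.

(* The index is the centre of expansion: polynomials act on [rseq a] through
   their Taylor expansion at [a]. *)
Definition rseq (a : C) : Type := nat -> C.

Variable a : C.
HB.instance Definition _ := GRing.Zmodule.on (rseq a).

Let T p := p \Po ('X + a%:P).
Definition rscale p (c : rseq a) : rseq a := pact (T p) c.

Fact rscaleA p q c : rscale p (rscale q c) = rscale (p * q) c.
Proof. by rewrite /rscale -pactM /T comp_polyM. Qed.
Fact rscale1 : left_id 1 rscale.
Proof. by move=> c; rewrite /rscale /T comp_polyC pact1. Qed.
Fact rscaleDr : right_distributive rscale +%R.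
Proof. by move=> p c c'; rewrite /rscale; exact: pactDr. Qed.
Fact rscaleDl c : {morph rscale^~ c : p q / p + q}.
Proof. by move=> p q; rewrite /rscale /T comp_polyD pactDl. Qed.

HB.instance Definition _ :=
  GRing.Zmodule_isLmodule.Build {poly C} (rseq a) rscaleA rscale1 rscaleDr rscaleDl.

Definition rder (c : rseq a) : rseq a := cder c.

Fact rder_additive : zmod_morphism rder.
Proof. by move=> c c'; apply/funext => j; rewrite /rder /cder mulrBr. Qed.
HB.instance Definition _ := GRing.isZmodMorphism.Build (rseq a) (rseq a) rder rder_additive.

Lemma rderZ p (c : rseq a) : rder (p *: c) = p^`() *: c + p *: rder c.
Proof.
rewrite /rder -[p *: c]/(pact (T p) c) cder_pact /T deriv_comp.
by rewrite derivD derivX derivC addr0 mulr1.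
Qed.

End SequenceModule.

(** * Cauchy estimates and term-by-term differentiation *)

Section CauchyEstimate.
Variable R : realType.
Local Notation C := (Cplx R).

Lemma exists_prim_root n : (0 < n)%N -> exists w : C, n.-primitive_root w.
Proof.
move=> n0; pose p : {poly C} := 'X^n - 1.
have [r Dp] := closed_field_poly_normal p.
have mp : lead_coef p = 1 by rewrite lead_coefXnsubC.
rewrite mp scale1r in Dp.
have sr : size r = n by have := congr1 (fun q : {poly C} => size q) Dp;
  rewrite size_XnsubC // size_prod_XsubC => -[].
have /hasP[w _ hw] : has n.-primitive_root r; last by exists w.
apply: has_prim_root => //; last by rewrite sr.
  by apply/allP => x xr; have : root p x by rewrite Dp root_prod_XsubC.
by rewrite -separable_prod_XsubC -Dp separable_Xn_sub_1 // pnatr_eq0 -lt0n.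
Qed.

(** A discrete Cauchy formula: for n larger than h and than the degree, averaging p(z0 + r ω) ω^(-h)
    over the n-th roots of unity ω isolates the Taylor coefficient of order h. *)
Lemma poly_cauchy (p : {poly C}) z0 (r K : R) h : 0 < r ->
  (forall w : C, cabs w = r -> cabs p.[z0 + w] <= K) ->
  cabs p^`(h).[z0] <= h`!%:R * (K / r ^+ h).
Proof.
move=> r0 hK; pose n := (maxn (size p) h).+1; pose e i := p^`N(i).[z0].
have n0 : (0 < n)%N by [].
have [w pw] := exists_prim_root n0.
have aw : cabs w = 1.
  have := congr1 (@cabs R) (prim_expr_order pw); rewrite cabsX cabs1 => /eqP.
  by rewrite pexpr_eq1 ?cabs_ge0 // => /eqP.
have taylor u : p.[z0 + u] = \sum_(i < n) e i * u ^+ i.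
  by apply: nderiv_taylor_wide; [exact: mulrC | rewrite ltnW // ltnS leq_maxl].
have hn : (h < n)%N by rewrite ltnS leq_maxr.
have avg : \sum_(i < n) p.[z0 + rc r * w ^+ i] * w ^+ (i * (n - h)) =
    n%:R * (e h * rc r ^+ h).
  under eq_bigr do rewrite taylor mulr_suml.
  rewrite exchange_big /= (bigD1 (Ordinal hn)) //= [X in _ + X]big1 ?addr0 => [|j jh].
    rewrite -[n in RHS]card_ord -sumr_const mulr_suml; apply: eq_bigr => i _.
    rewrite exprMn -exprM mul1r -!mulrA -exprD -mulnDr subnKC ?(ltnW hn) // mulnC.
    by rewrite exprM (prim_expr_order pw) expr1n mulr1.
  transitivity (e j * rc r ^+ j * \sum_(i < n) (w ^+ (j + (n - h))) ^+ i).
    rewrite mulr_sumr; apply: eq_bigr => i _.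
    by rewrite exprMn -!mulrA -!exprM -exprD mulnDl; congr (_ * (_ * w ^+ (_ + _))); rewrite mulnC.
  (* Both j and h are below n, so j - h is a multiple of n only if j = h; otherwise x is a
     nontrivial n-th root of unity and its powers sum to 0. *)
  set x := w ^+ _; have x1 : x != 1.
    rewrite /x -(prim_order_dvd pw); apply: contra jh => /dvdnP[k ek]; apply/eqP/val_inj => /=.
    have jn := ltn_ord j; have : (j + n = k * n + h)%N by lia.
    by case: k ek => [|[|k]] ek; lia.
  have := subrX1 x n; rewrite /x -exprM mulnC exprM (prim_expr_order pw) expr1n subrr.
  by move/esym/eqP; rewrite mulf_eq0 subr_eq0 (negbTE x1) /= => /eqP ->; rewrite mulr0.
have le : n%:R * (cabs (e h) * r ^+ h) <= n%:R * K.
  have <- : cabs (n%:R * (e h * rc r ^+ h)) = n%:R * (cabs (e h) * r ^+ h).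
    by rewrite !cabsM cabs_nat cabsX cabs_rc gtr0_norm.
  rewrite -avg; apply: le_trans (cabs_sum _ _ _) _.
  rewrite -[n in leRHS]card_ord -sumr_const mulr_suml; apply: ler_sum => i _.
  rewrite cabsM [cabs (w ^+ (_ * _))]cabsX aw expr1n mulr1 mul1r; apply: hK.
  by rewrite cabsM cabsX aw expr1n mulr1 cabs_rc gtr0_norm.
rewrite nderivn_def hornerMn -mulr_natl cabsM cabs_nat ler_wpM2l // ler_pdivlMr ?exprn_gt0 //.
by rewrite -(ler_pM2l (x := n%:R)) // ltr0n.
Qed.

End CauchyEstimate.

Section PowerSeriesCalculus.
Variable R : realType.
Local Notation C := (Cplx R).
Implicit Types (c : nat -> C) (p q : {poly C}).

Lemma radD c c' r0 : radius_ge c r0 -> radius_ge c' r0 -> radius_ge (fun j => c j + c' j) r0.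
Proof.
move=> h h' r rr; have [M hM] := h r rr; have [M' hM'] := h' r rr.
exists (M + M') => j; apply: le_trans (lerD (hM j) (hM' j)).
rewrite -mulrDl ler_wpM2r ?cabsD // exprn_ge0 //.
by case/andP: rr => /ltW.
Qed.

Lemma radZ a c r0 : radius_ge c r0 -> radius_ge (fun j => a * c j) r0.
Proof.
move=> h r rr; have [M hM] := h r rr; exists (cabs a * M) => j.
by rewrite cabsM -mulrA ler_wpM2l ?cabs_ge0.
Qed.

Lemma rad_shift c r0 : radius_ge c r0 -> radius_ge (cshift c) r0.
Proof.
move=> h r rr; have [M hM] := h r rr; have r_gt0 : 0 < r by case/andP: rr.
have M0 : 0 <= M by apply: le_trans (hM 0%N); rewrite mulr_ge0 ?cabs_ge0 // exprn_ge0 // ltW.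
exists (M * r) => -[|j]; first by rewrite cabs0 mul0r mulr_ge0 // ltW.
by rewrite exprSr mulrA ler_wpM2r ?(ltW r_gt0) ?(hM j).
Qed.

Lemma rad_pact p c r0 : radius_ge c r0 -> radius_ge (pact p c) r0.
Proof.
move=> h; elim/poly_ind: p => [|p k IH].
  move=> r rr; exists 0 => j.
  by rewrite /pact big1 ?cabs0 ?mul0r // => i _; rewrite coef0 mul0r.
rewrite pactDl pactM pactX pactC; apply: radD; last exact: radZ.
suff -> : pact p (cshift c) = cshift (pact p c) by apply: rad_shift.
by rewrite -!pactX -!pactM mulrC.
Qed.

(** Absorbs the factor j + 1 produced by differentiation when the radius shrinks from r' to r, with
    t = r / r'. *)
Lemma bernoulli_bound (t : R) j : 0 < t < 1 -> j.+1%:R * t ^+ j <= (1 - t)^-1.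
Proof.
move=> /andP[t0 t1]; have d0 : 0 < 1 - t by lra.
rewrite -[leRHS]mul1r ler_pdivlMr //.
elim: j => [|j IH]; first by rewrite expr0; lra.
have tj : 0 <= t ^+ j by rewrite exprn_ge0 // ltW.
have tj1 : t ^+ j * (1 + j%:R * (1 - t)) <= 1.
  elim: (j) => [|i IHi]; first by rewrite expr0; lra.
  have ti : 0 <= t ^+ i by rewrite exprn_ge0 // ltW.
  rewrite exprS -natr1; apply: le_trans IHi.
  have i0 : 0 <= i%:R :> R by rewrite ler0n.
  rewrite [leLHS](_ : _ = t ^+ i * (t * (1 + (i%:R + 1) * (1 - t)))); last by ring.
  rewrite ler_wpM2l // -subr_ge0.
  rewrite (_ : _ - _ = (1 - t) ^+ 2 * (1 + i%:R)); last by ring.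
  by rewrite mulr_ge0 ?sqr_ge0 // addr_ge0.
rewrite exprS -2!natr1; apply: le_trans tj1.
have j0 : 0 <= j%:R :> R by rewrite ler0n.
rewrite [leLHS](_ : _ = t ^+ j * (t * (j%:R + 1 + 1) * (1 - t))); last by ring.
rewrite ler_wpM2l // -subr_ge0.
rewrite (_ : _ - _ = t ^+ 2 + (j%:R + 1) * (1 - t) ^+ 2); last by ring.
by rewrite addr_ge0 ?sqr_ge0 // mulr_ge0 ?sqr_ge0 ?addr_ge0.
Qed.

Lemma rad_cder c r0 : radius_ge c r0 -> radius_ge (cder c) r0.
Proof.
move=> h r /andP[r_gt0 rr0]; have [r' rr' r'r0] := between rr0.
have r'0 : 0 < r' by apply: lt_trans rr'.
have [|M hM] := h r'; first by rewrite r'0.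
have t01 : 0 < r / r' < 1 by rewrite divr_gt0 //= ltr_pdivrMr // mul1r.
exists ((1 - r / r')^-1 * (M / r')) => j.
rewrite /cder cabsM cabs_nat.
have -> : j.+1%:R * cabs (c j.+1) * r ^+ j =
    (j.+1%:R * (r / r') ^+ j) * (cabs (c j.+1) * r' ^+ j.+1 / r').
  have ne : r' ^+ j != 0 by rewrite expf_neq0 // gt_eqF.
  rewrite expr_div_n exprS; field; by rewrite gt_eqF.
rewrite ler_pM ?bernoulli_bound ?mulr_ge0 ?cabs_ge0 ?invr_ge0 ?exprn_ge0 ?divr_ge0 ?(ltW r'0) ?(ltW r_gt0) //.
by rewrite ler_wpM2r ?invr_ge0 ?(ltW r'0).
Qed.

Lemma rad_iter_cder c r0 h : radius_ge c r0 -> radius_ge (iter h (@cder R) c) r0.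
Proof. by move=> hc; elim: h => //= h; apply: rad_cder. Qed.

Lemma abs_sum_bound c r0 (rho : R) : radius_ge c r0 -> 0 <= rho < r0 ->
  exists K, forall n, \sum_(j < n) cabs (c j) * rho ^+ j <= K.
Proof.
move=> h /andP[rho0 rhor]; have [r rr rr0] := between rhor.
have r_gt0 : 0 < r by apply: le_lt_trans rr.
have [|M hM] := h r; first by rewrite r_gt0.
have M0 : 0 <= M by apply: le_trans (hM 0%N); rewrite mulr_ge0 ?cabs_ge0 // exprn_ge0 // ltW.
have q01 : 0 <= rho / r < 1 by rewrite divr_ge0 ?(ltW r_gt0) //= ltr_pdivrMr // mul1r.
exists (M * (1 - rho / r)^-1) => n.
apply: (@le_trans _ _ (M * \sum_(j < n) (rho / r) ^+ j)); last first.
  rewrite ler_wpM2l //; have := geo_tail 0 n q01.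
  by rewrite add0n expr0 div1r big_mkord.
rewrite mulr_sumr; apply: ler_sum => j _; rewrite expr_div_n mulrA ler_pdivlMr ?exprn_gt0 //.
by rewrite mulrAC ler_wpM2r ?exprn_ge0.
Qed.

Lemma csum_shift c r0 z : radius_ge c r0 -> cabs z < r0 -> csum (cshift c) z = z * csum c z.
Proof.
move=> h hz; apply: clim_unique (climZ z (csum_lim h hz)).
apply: clim_ext (clim_shift (csum_lim (rad_shift h) hz)) => n.
rewrite !psumE big_ord_recl /= mul0r add0r mulr_sumr; apply: eq_bigr => j _.
by rewrite exprS; ring.
Qed.

Lemma csumD c c' r0 z : radius_ge c r0 -> radius_ge c' r0 -> cabs z < r0 ->
  csum (fun j => c j + c' j) z = csum c z + csum c' z.
Proof.
move=> h h' hz; apply: clim_unique (climD (csum_lim h hz) (csum_lim h' hz)).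
apply: clim_ext (csum_lim (radD h h') hz) => n.
by rewrite !psumE -big_split; apply: eq_bigr => j _; rewrite mulrDl.
Qed.

Lemma csumZ a c r0 z : radius_ge c r0 -> cabs z < r0 ->
  csum (fun j => a * c j) z = a * csum c z.
Proof.
move=> h hz; apply: clim_unique (climZ a (csum_lim h hz)).
apply: clim_ext (csum_lim (radZ a h) hz) => n.
by rewrite !psumE mulr_sumr; apply: eq_bigr => j _; rewrite mulrA.
Qed.

Lemma csum0 z : csum (fun _ => 0 : C) z = 0.
Proof.
have h : radius_ge (fun _ => 0 : C) (cabs z + 1).
  by move=> r _; exists 0 => j; rewrite cabs0 mul0r.
have hz : cabs z < cabs z + 1 by lra.
apply: clim_unique (csum_lim h hz) _; apply: clim_ext (clim_cst 0) => n.
by rewrite psumE big1 // => j _; rewrite mul0r.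
Qed.

Lemma csum_pact p c r0 z : radius_ge c r0 -> cabs z < r0 ->
  csum (pact p c) z = p.[z] * csum c z.
Proof.
move=> h hz; elim/poly_ind: p => [|p k IH].
  rewrite horner0 mul0r -[RHS](csum0 z); congr csum; apply/funext => j.
  by rewrite /pact big1 // => i _; rewrite coef0 mul0r.
rewrite pactDl pactM pactX pactC.
have -> : pact p (cshift c) = cshift (pact p c) by rewrite -!pactX -!pactM mulrC.
rewrite (@csumD _ _ r0) //; last by [exact: radZ | apply: rad_shift; exact: rad_pact].
- rewrite (@csum_shift _ r0) //; last exact: rad_pact.
  by rewrite (@csumZ _ _ r0) // IH hornerMXaddC mulrDl mulrA [z * _]mulrC.
- by apply: rad_shift; exact: rad_pact.
Qed.

(** The second-order remainder of x^j is at most |h|^2 j^2 ρ^(j-2); multiplying by ρ^2 avoids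
    negative exponents for j < 2. *)
Lemma taylor_pow (z h : C) (rho : R) j : cabs z <= rho -> cabs (z + h) <= rho ->
  cabs ((z + h) ^+ j - z ^+ j - h * (j%:R * z ^+ j.-1)) * rho ^+ 2
    <= cabs h ^+ 2 * (j%:R ^+ 2 * rho ^+ j).
Proof.
move=> hz hzh; have rho0 : 0 <= rho by apply: le_trans hz; apply: cabs_ge0.
elim: j => [|j IH].
  by rewrite !expr0 subrr mul0r mulr0 subr0 cabs0 mul0r expr0n /= !mul0r mulr0.
set E := (X in cabs X * _ <= _) in IH.
have -> : (z + h) ^+ j.+1 - z ^+ j.+1 - h * (j.+1%:R * z ^+ j.+1.-1) =
    (z + h) * E + j%:R * h ^+ 2 * z ^+ j.-1.
  rewrite /E -natr1 /= !exprS; case: (j) => [|i]; first by rewrite !expr0; ring.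
  by rewrite /= !exprS; ring.
have hj : cabs (j%:R * h ^+ 2 * z ^+ j.-1) * rho ^+ 2 <= j%:R * (cabs h ^+ 2 * rho ^+ j.+1).
  rewrite cabsM cabsM cabs_nat !cabsX; move: (cabs h ^+ 2) (sqr_ge0 (cabs h)) => u u0.
  rewrite -!mulrA; case: (j) => [|i] /=; first by rewrite !mul0r.
  rewrite ler_wpM2l // ler_wpM2l //.
  rewrite [leRHS](_ : _ = rho ^+ i * rho ^+ 2); last by rewrite -exprD addn2.
  by rewrite ler_wpM2r ?exprn_ge0 // lerXn2r ?nnegrE ?cabs_ge0.
apply: le_trans (ler_wpM2r (exprn_ge0 _ rho0) (cabsD _ _)) _.
rewrite mulrDl cabsM.
have h1 : cabs (z + h) * cabs E * rho ^+ 2 <= rho * (cabs h ^+ 2 * (j%:R ^+ 2 * rho ^+ j)).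
  by rewrite -mulrA ler_pM ?cabs_ge0 // mulr_ge0 ?cabs_ge0 // exprn_ge0.
apply: le_trans (lerD h1 hj) _.
rewrite [leLHS](_ : _ = cabs h ^+ 2 * rho ^+ j.+1 * (j%:R ^+ 2 + j%:R)); last by rewrite (exprS rho j); ring.
rewrite [leRHS](_ : _ = cabs h ^+ 2 * rho ^+ j.+1 * j.+1%:R ^+ 2); last by ring.
rewrite ler_wpM2l ?mulr_ge0 ?exprn_ge0 ?cabs_ge0 // -natr1.
have : 0 <= j%:R :> R by rewrite ler0n.
nra.
Qed.

Lemma csum_cdiff c r0 z : radius_ge c r0 -> cabs z < r0 -> cdiff (csum c) z (csum (cder c) z).
Proof.
move=> hc hz; have [rho zr rr0] := between hz.
have rho0 : 0 < rho by apply: le_lt_trans zr; apply: cabs_ge0.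
(* The coefficients of (x d/dx)^2 applied to the series: same radius, so the remainders of
   [taylor_pow] sum up to a constant times |h|^2. *)
pose e j := j%:R * (j%:R * c j).
have he : radius_ge e r0.
  have -> : e = cshift (cder (cshift (cder c))).
    by apply/funext => -[|j] /=; rewrite /e ?mul0r.
  by do ! [apply: rad_shift | apply: rad_cder].
have [|K hK] := abs_sum_bound (rho := rho) he; first by rewrite (ltW rho0).
apply: (@cdiff_quad R _ _ _ (rho - cabs z) (K / rho ^+ 2)); first by lra.
move=> h hh; have zh : cabs (z + h) <= rho by have := cabsD z h; lra.
have l1 := csum_lim hc (le_lt_trans zh rr0).
have l2 := csum_lim hc hz.
have l3 := csum_lim (rad_cder hc) hz.
have L : clim (fun n => (psum c n.+1).[z + h] + (-1 * (psum c n.+1).[z] +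
    - h * (psum (cder c) n).[z])) (csum c (z + h) - csum c z - h * csum (cder c) z).
  rewrite -addrA -mulNr -[- csum c z]mulN1r.
  apply: climD; first exact: clim_shift l1.
  apply: climD; first exact: climZ (clim_shift l2).
  exact: climZ.
apply: clim_le L _ => n; rewrite mulrAC ler_pdivlMr ?exprn_gt0 //.
have -> : (psum c n.+1).[z + h] + (-1 * (psum c n.+1).[z] + - h * (psum (cder c) n).[z]) =
    \sum_(j < n.+1) c j * ((z + h) ^+ j - z ^+ j - h * (j%:R * z ^+ j.-1)).
  rewrite !psumE mulN1r mulNr addrA.
  have -> : h * \sum_(j < n) cder c j * z ^+ j = \sum_(j < n.+1) c j * (h * (j%:R * z ^+ j.-1)).
    rewrite [RHS]big_ord_recl /= mul0r !mulr0 add0r mulr_sumr; apply: eq_bigr => j _.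
    by rewrite /cder /= /bump leq0n add1n add0n; ring.
  by rewrite -!sumrB; apply: eq_bigr => j _; rewrite -!mulrBr.
apply: le_trans (ler_wpM2r (exprn_ge0 _ (ltW rho0)) (cabs_sum _ _ _)) _.
rewrite mulr_suml; apply: (@le_trans _ _ (cabs h ^+ 2 * \sum_(j < n.+1) cabs (e j) * rho ^+ j)).
  rewrite mulr_sumr; apply: ler_sum => j _.
  rewrite cabsM -mulrA; apply: le_trans (ler_wpM2l (cabs_ge0 _) (taylor_pow _ (ltW zr) zh)) _.
  by rewrite le_eqVlt; apply/orP; left; apply/eqP; rewrite /e !cabsM cabs_nat; ring.
by rewrite mulrC ler_wpM2r ?exprn_ge0 ?cabs_ge0.
Qed.

(** [poly_cauchy] for a partial sum uniformly close to the series on the circle; the closeness is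
    scaled by r^h / h! so that it costs at most e / 2 in the conclusion. *)
Lemma csum_cauchy c r0 z (r K : R) h : radius_ge c r0 -> 0 < r -> cabs z + r < r0 ->
  (forall w, cabs w = r -> cabs (csum c (z + w)) <= K) ->
  cabs (csum (iter h (@cder R) c) z) <= h`!%:R * (K / r ^+ h).
Proof.
move=> hc r_gt0 zr hK.
have zr0 : cabs z < r0 by lra.
have l := csum_lim (rad_iter_cder h hc) zr0.
have pd n : (psum (iter h (@cder R) c) n).[z] = (psum c (n + h))^`(h).[z].
  congr (_.[_]); elim: h {l} n => [|h IH] n; first by rewrite addn0 derivn0.
  by rewrite iterS -psum_cder IH derivnS addSnnS.
apply/ler_addgt0Pr => e e0.
have c0 : 0 < h`!%:R / r ^+ h :> R by rewrite divr_gt0 ?exprn_gt0 // ltr0n fact_gt0.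
have [||n0 H] := csum_unif (rho := cabs z + r) (e := e / (2 * (h`!%:R / r ^+ h))) hc.
- by rewrite zr addr_ge0 ?cabs_ge0 ?(ltW r_gt0).
- by rewrite divr_gt0 // mulr_gt0.
have [n1 H1] := l (e / 2) (divr_gt0 e0 (ltr0n _ 2)).
pose n := maxn n0 n1.
have a := H1 n (leq_maxr _ _).
have b : cabs (psum c (n + h))^`(h).[z] <=
    h`!%:R * ((K + e / (2 * (h`!%:R / r ^+ h))) / r ^+ h).
  apply: poly_cauchy => // w wr.
  have le : (n0 <= n + h)%N by rewrite (leq_trans (leq_maxl n0 n1)) // leq_addr.
  have zw : cabs (z + w) <= cabs z + r by rewrite -wr cabsD.
  have := H _ _ le zw; have := hK w wr.
  have := cabs_distl (psum c (n + h)).[z + w] (csum c (z + w)); lra.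
have e1 : h`!%:R * ((K + e / (2 * (h`!%:R / r ^+ h))) / r ^+ h) =
    h`!%:R * (K / r ^+ h) + e / 2.
  have f0 : h`!%:R != 0 :> R by rewrite pnatr_eq0 -lt0n fact_gt0.
  by field; rewrite f0 expf_neq0 // gt_eqF.
have d := cabs_distl (csum (iter h (@cder R) c) z) (psum (iter h (@cder R) c) n).[z].
rewrite cabsC in d; rewrite e1 -pd in b; lra.
Qed.

End PowerSeriesCalculus.

(** * Existence and convergence of formal solutions at an ordinary point *)

Section FormalSolution.
Variable R : realType.
Local Notation C := (Cplx R).

(** The recursion z F_i = F_(i-1) - ((x - z) F)_i with |z| >= r0 contracts the weighted coefficients
    by r / r0, whence the geometric constant. *)
Lemma divide_linear (z : C) (r0 r T : R) (F : nat -> C) J : 0 < r < r0 -> r0 <= cabs z ->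
  (forall i, (i <= J)%N -> cabs (pact ('X - z%:P) F i) * r ^+ i <= T) ->
  forall i, (i <= J)%N -> cabs (F i) * r ^+ i <= (r0 - r)^-1 * T.
Proof.
move=> /andP[rp rr0] zr0 h.
have r00 : 0 < r0 by apply: lt_trans rr0.
have T0 : 0 <= T by apply: le_trans (h 0%N isT); rewrite mulr_ge0 ?cabs_ge0.
have d0 : 0 < r0 - r by lra.
have pE i : z * F i = cshift F i - pact ('X - z%:P) F i.
  by rewrite pactDl pactX -polyCN pactC; ring.
suff H i : (i <= J)%N -> r0 * (cabs (F i) * r ^+ i) <= T * r0 / (r0 - r).
  move=> i le; rewrite -(ler_pM2l r00); apply: le_trans (H i le) _.
  by rewrite le_eqVlt; apply/orP; left; apply/eqP; ring.
elim: i => [|i IH] le.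
  have := h 0%N le; rewrite !expr0 !mulr1 => h0.
  apply: (@le_trans _ _ (cabs z * cabs (F 0%N))); first by rewrite ler_wpM2r ?cabs_ge0.
  rewrite -cabsM pE /= sub0r cabsN; apply: le_trans h0 _.
  by rewrite ler_pdivlMr // ler_wpM2l //; lra.
apply: (@le_trans _ _ (cabs z * (cabs (F i.+1) * r ^+ i.+1))).
  by rewrite ler_wpM2r // mulr_ge0 ?cabs_ge0 ?exprn_ge0 // ltW.
rewrite mulrA -cabsM pE /=; apply: le_trans (ler_wpM2r _ (cabsB _ _)) _.
  by rewrite exprn_ge0 // ltW.
rewrite mulrDl; apply: (@le_trans _ _ (r * (cabs (F i) * r ^+ i) + T)).
  by rewrite lerD ?h // exprS mulrCA.
have IHi := IH (ltnW le).
have e : r * (T / (r0 - r)) + T = T * r0 / (r0 - r) by field; rewrite gt_eqF.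
rewrite -e lerD2r ler_wpM2l ?(ltW rp) // -(ler_pM2l r00); apply: le_trans IHi _.
by rewrite le_eqVlt; apply/orP; left; apply/eqP; ring.
Qed.

(** Linear factors are divided out one at a time. The constant does not depend on the cut-off J, so
    in [radius_solution] the estimate applies when bounds are known up to J only. *)
Lemma divide_poly (P : {poly C}) (r0 r : R) : 0 < r < r0 -> P != 0 ->
  (forall z, root P z -> r0 <= cabs z) ->
  exists2 k : R, 0 <= k & forall F T J,
  (forall i, (i <= J)%N -> cabs (pact P F i) * r ^+ i <= T) ->
  forall i, (i <= J)%N -> cabs (F i) * r ^+ i <= k * T.
Proof.
move=> rr P0 hP; have [s Ps] := closed_field_poly_normal P.
have lP : lead_coef P != 0 by rewrite lead_coef_eq0.
have hs z : z \in s -> r0 <= cabs z.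
  by move=> zs; apply: hP; rewrite Ps rootZ // root_prod_XsubC.
have d0 : 0 <= (r0 - r)^-1 by rewrite invr_ge0; lra.
have [k k0 hk] : exists2 k : R, 0 <= k & forall F T J,
  (forall i, (i <= J)%N -> cabs (pact (\prod_(z <- s) ('X - z%:P)) F i) * r ^+ i <= T) ->
  forall i, (i <= J)%N -> cabs (F i) * r ^+ i <= k * T.
  elim: s hs {Ps} => [|z s IH] hs.
    exists 1 => // F T J; rewrite big_nil pact1 => h i le; rewrite mul1r; exact: h.
  have [|k k0 hk] := IH; first by move=> y ys; apply: hs; rewrite inE ys orbT.
  exists (k * (r0 - r)^-1); first by rewrite mulr_ge0.
  move=> F T J; rewrite big_cons pactM => h i le; rewrite -mulrA.
  apply: (hk F _ J) => // {i le}; apply: divide_linear h => //.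
  by apply: hs; rewrite mem_head.
exists (k * (cabs (lead_coef P))^-1); first by rewrite mulr_ge0 ?invr_ge0 ?cabs_ge0.
move=> F T J h i le; rewrite -mulrA; apply: (hk F _ J) => // {le}i le.
have := h i le; rewrite {1}Ps -mul_polyC pactM pactC cabsM -mulrA.
by rewrite [_^-1 * T]mulrC ler_pdivlMr ?cabs_gt0 // mulrC.
Qed.

Lemma pact_bound (p : {poly C}) (r : R) : 0 < r ->
  exists2 k : R, 0 <= k & forall F T J,
  (forall i, (i <= J)%N -> cabs (F i) * r ^+ i <= T) ->
  forall i, (i <= J)%N -> cabs (pact p F i) * r ^+ i <= k * T.
Proof.
move=> rp; exists (\sum_(l < size p) cabs p`_l * r ^+ l).
  by apply: sumr_ge0 => l _; rewrite mulr_ge0 ?cabs_ge0 ?exprn_ge0 // ltW.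
move=> F T J h i le.
have T0 : 0 <= T by apply: le_trans (h i le); rewrite mulr_ge0 ?cabs_ge0 ?exprn_ge0 // ltW.
pose g l := cabs p`_l * r ^+ l.
have g0 l : 0 <= g l by rewrite mulr_ge0 ?cabs_ge0 ?exprn_ge0 // ltW.
apply: (@le_trans _ _ ((\sum_(l < i.+1) g l) * T)).
  apply: le_trans (ler_wpM2r _ (cabs_sum _ _ _)) _; first by rewrite exprn_ge0 // ltW.
  rewrite !mulr_suml; apply: ler_sum => l _; rewrite cabsM.
  have li : (l <= i)%N by rewrite -ltnS.
  have -> : r ^+ i = r ^+ l * r ^+ (i - l) by rewrite -exprD subnKC.
  rewrite mulrACA ler_wpM2l ?g0 // h // (leq_trans (leq_subr _ _)) //.
rewrite ler_wpM2r //; case: (leqP (size p) i.+1) => sz.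
  rewrite -!(big_mkord xpredT g) (@big_cat_nat _ _ _ (size p) 0 i.+1) //=.
  rewrite [X in _ + X]big1_seq ?addr0 // => l; rewrite mem_index_iota => /andP[_ /andP[sl _]].
  by rewrite /g nth_default // cabs0 mul0r.
rewrite -!(big_mkord xpredT g) [leRHS](@big_cat_nat _ _ _ i.+1 0 (size p)) ?(ltnW sz) //=.
by rewrite lerDl sumr_ge0.
Qed.

Variables (d : nat) (D : {poly C}) (B : 'M[{poly C}]_d) (a : C) (r0 : R).
Hypothesis r0_gt0 : 0 < r0.
Hypothesis D0 : D != 0.
Hypothesis rootD : forall z, root D z -> r0 <= cabs (z - a).

Local Notation tr p := (p \Po ('X + a%:P)).

Let Da0 : (tr D)`_0 != 0.
Proof.
rewrite -horner_coef0 horner_comp !hornerE; apply/eqP => z.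
have := rootD (introT rootP z); rewrite ?add0r subrr cabs0 => /le_lt_trans /(_ r0_gt0).
by rewrite ltxx.
Qed.

(** The recursion bounds (j + 1) times the next weighted coefficient by a constant times the
    previous bound; once j + 1 exceeds that constant, the bound M can no longer grow. *)
Lemma radius_solution (Y : 'I_d -> nat -> C) :
  (forall p, pact (tr D) (cder (Y p)) = (fun j => \sum_k pact (tr (B p k)) (Y k) j)) ->
  forall p, radius_ge (Y p) r0.
Proof.
move=> sol p r rr; have rp : 0 < r by case/andP: rr.
have [|z|k k0 hk] := divide_poly (P := tr D) rr.
- by rewrite comp_poly_eq0 ?size_XaddC.
- rewrite rootE horner_comp !hornerE => z0.
  by have := rootD z0; rewrite addrK.
have /choice[kb hkb] : forall pq : 'I_d * 'I_d, exists k : R, 0 <= k /\ forall F T J,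
  (forall i, (i <= J)%N -> cabs (F i) * r ^+ i <= T) ->
  forall i, (i <= J)%N -> cabs (pact (tr (B pq.1 pq.2)) F i) * r ^+ i <= k * T.
  by move=> pq; have [k1 k10 h1] := pact_bound (tr (B pq.1 pq.2)) rp; exists k1.
pose KB := \sum_pq kb pq.
have kbK q : \sum_l kb (q, l) <= KB.
  have -> : KB = \sum_i \sum_j kb (i, j).
    by rewrite pair_bigA; apply: eq_bigr => -[].
  rewrite [leRHS](bigD1 q) //= lerDl.
  by apply: sumr_ge0 => i _; apply: sumr_ge0 => j _; apply: (hkb _).1.
have KB0 : 0 <= KB by apply: sumr_ge0 => i _; apply: (hkb _).1.
(* From index J0 on, the factor J + 1 beats the constant of the recursion; M covers all earlier
   coefficients. *)
have [J0 hJ0] : exists J0 : nat, r * (k * KB) <= J0%:R.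
  exists (Num.bound (r * (k * KB))); apply/ltW/archi_boundP.
  by rewrite !mulr_ge0 // ltW.
pose t q j := cabs (Y q j) * r ^+ j.
have t0 q j : 0 <= t q j by rewrite mulr_ge0 ?cabs_ge0 ?exprn_ge0 // ltW.
pose M := \sum_(j < J0.+1) \sum_q t q j.
have M0 : 0 <= M by apply: sumr_ge0 => j _; apply: sumr_ge0.
suff H J : forall i, (i <= J)%N -> forall q, t q i <= M by exists M => j; apply: (H j j).
elim: J => [|J IH] i le q; last first.
  move: le; rewrite leq_eqVlt ltnS => /orP[/eqP -> {i}|le]; last exact: IH.
  case: (leqP J.+1 J0) => leJ.
    rewrite /M (bigD1 (Ordinal (leJ : (J.+1 < J0.+1)%N))) //= (bigD1 q) //= -addrA lerDl.
    by rewrite addr_ge0 ?sumr_ge0 // => j _; apply: sumr_ge0.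
  have h1 : forall i, (i <= J)%N -> cabs (pact (tr D) (cder (Y q)) i) * r ^+ i <= KB * M.
    move=> i le; rewrite sol.
    apply: le_trans (ler_wpM2r (exprn_ge0 _ (ltW rp)) (cabs_sum _ _ _)) _.
    rewrite mulr_suml; apply: (@le_trans _ _ (\sum_l kb (q, l) * M)).
      by apply: ler_sum => l _; apply: ((hkb (q, l)).2 _ _ J) => // j lej; apply: IH.
    by rewrite -mulr_suml ler_wpM2r.
  have := hk _ _ _ h1 J (leqnn _); rewrite /cder cabsM cabs_nat => h2.
  have J1 : 0 < J.+1%:R :> R by rewrite ltr0n.
  rewrite -(ler_pM2l J1) /t exprS.
  apply: (@le_trans _ _ (r * (k * (KB * M)))).
    by rewrite [leLHS](_ : _ = r * (J.+1%:R * cabs (Y q J.+1) * r ^+ J)) ?ler_wpM2l ?(ltW rp) //; ring.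
  have : r * (k * KB) <= J.+1%:R by apply: le_trans hJ0 _; rewrite ler_nat ltnW.
  by move/(ler_wpM2r M0); rewrite -!mulrA.
move: le; rewrite leqn0 => /eqP ->.
rewrite /M (bigD1 ord0) //= (bigD1 q) //= -addrA lerDl.
by rewrite addr_ge0 ?sumr_ge0 // => j _; apply: sumr_ge0.
Qed.

(** The system as the operator D d/dx - B of order 1, so that [triangular_ext] solves it with s = 1,
    t = 0; the diagonal matrices are (p + 1) D(a). *)
Let AA (i : 'I_2) : 'M[{poly C}]_d :=
  if (i : nat) is 0%N then - map_mx (fun p => tr p) B else (tr D)%:M.

Lemma fmulmx_pact (M : 'M[{poly C}]_d) (u : nat -> 'cV[C]_d) q p :
  fmulmx M u q p 0 = \sum_k pact (M p k) (fun j => u j k 0) q.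
Proof.
rewrite /fmulmx summxE exchange_big; apply: eq_bigr => j _.
by rewrite !mxE; apply: eq_bigr => k _; rewrite mxE.
Qed.

Lemma exists_formal_solution (y0 : 'I_d -> C) : exists Y : 'I_d -> nat -> C,
  (forall p, Y p 0%N = y0 p) /\
  (forall p, pact (tr D) (cder (Y p)) = (fun j => \sum_k pact (tr (B p k)) (Y k) j)).
Proof.
pose G p := \sum_(i < 2) ((1 + p) ^_ i)%:R *: diag_coef AA 1 i.
have tailP (u v : nat -> 'cV[C]_d) p : (forall q, (q < 1 + p)%N -> u q = v q) ->
  formal_op AA u (0 + p)%N - formal_op AA v (0 + p)%N =
  G p *m (u (1 + p)%N - v (1 + p)%N).
  move=> uv; rewrite -[_ - _]/((formal_op AA u - formal_op AA v) (0 + p)%N).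
  rewrite -(linearB (formal_op AA)) /= formal_opE /G mulmx_suml; apply: eq_bigr => i _.
  rewrite -scalemxAl; apply: diag_sumE => [j|//|r lt].
  - by have := ltn_ord i; lia.
  - by rewrite add0n addrC.
  - by rewrite fctDE fctNE uv // subrr.
have unitG p : G p \in unitmx.
  rewrite /G big_ord_recl big_ord_recl big_ord0 addr0 /diag_coef /= scaler0 add0r.
  rewrite unitmxE unitfE detZ mulf_neq0 ?expf_neq0 //.
    by rewrite pnatr_eq0 ffactn1.
  have -> : coef_mx (AA (lift ord0 ord0)) 0 = ((tr D)`_0)%:M.
    by apply/matrixP => i j; rewrite [LHS]mxE /AA /= !mxE coefMn.
  by rewrite det_scalar expf_neq0.
have [u [u0 hu]] := triangular_ext tailP unitG (fun _ => \col_p y0 p) 0.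
exists (fun p j => u j p 0); split=> [p|p]; first by rewrite u0 // mxE.
apply/funext => q; have /matrixP/(_ p 0) := hu q; rewrite add0n /= formal_opE.
rewrite big_ord_recl big_ord_recl big_ord0 addr0 !mxE /= !fmulmx_pact => /eqP.
rewrite addrC addr_eq0 => /eqP e.
have e1 : \sum_k pact ((AA (lift ord0 ord0)) p k) (fun j => fderiv u j k 0) q =
   pact (tr D) (cder (fun j => u j p 0)) q.
  rewrite (bigD1 p) //= big1 ?addr0 => [|k kp]; last first.
    rewrite mxE eq_sym (negbTE kp) mulr0n /pact big1 // => i _.
    by rewrite coef0 mul0r.
  rewrite mxE eqxx mulr1n; congr (pact _ _ q); apply/funext => j.
  by rewrite /fderiv mxE.
rewrite -e1 e -sumrN; apply: eq_bigr => k _; rewrite !mxE /pact -sumrN.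
by apply: eq_bigr => i _; rewrite coefN mulNr opprK.
Qed.

End FormalSolution.

(** * Growth along rays and Liouville's formula *)

Section Curves.
Variable R : realType.
Local Notation C := (Cplx R).
Implicit Types (F : C -> C) (z l m : C) (s : R).

Definition rdiff (f : R -> R) s (l : R) := forall e : R, 0 < e -> exists2 d : R, 0 < d &
  forall h : R, `|h| < d -> `|f (s + h) - f s - h * l| <= e * `|h|.

Lemma rdiffP (f : R -> R) s (l : R) : rdiff f s l <-> is_derive s (1 : R) f l.
Proof.
have key : rdiff f s l <->
  ((fun h : R => h^-1 *: ((f \o shift s) (h *: (1 : R)) - f s)) @ 0^' --> l)%classic.
  split=> [H|/cvgrPdist_le H].
    apply/cvgrPdist_le => e e0; have [d d0 hd] := H _ e0.
    apply/nbhs_ballP; exists d => //= h.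
    rewrite -ball_normE /= sub0r normrN => /hd hh h0.
    have h0' : 0 < `|h| by rewrite normr_gt0.
    rewrite -(ler_pM2r h0'); apply: le_trans hh.
    rewrite -normrM mulrBl; rewrite -[h^-1 *: _]/(h^-1 * _) mulrAC mulVf // mul1r.
    by rewrite distrC -[h *: 1]/(h * 1) mulr1 [l * h]mulrC [h + s]addrC.
  move=> e e0; have /nbhs_ballP[d /= d0 hd] := H _ e0.
  exists d => // h hlt; have [->|h0] := eqVneq h 0.
    by rewrite mul0r addr0 subrr subr0 normr0 mulr0.
  have := hd h; rewrite -ball_normE /= sub0r normrN => /(_ hlt h0).
  have h0' : 0 < `|h| by rewrite normr_gt0.
  rewrite -(ler_pM2r h0'); apply: le_trans.
  rewrite -normrM mulrBl; rewrite -[h^-1 *: _]/(h^-1 * _) mulrAC mulVf // mul1r.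
  by rewrite distrC -[h *: 1]/(h * 1) mulr1 [l * h]mulrC [h + s]addrC.
rewrite key; split=> [H|[ex df]].
  by split; [apply/cvg_ex; exists l | apply: cvg_lim].
by rewrite -df; exact: ex.
Qed.

Definition curve_diff (f : R -> C) s (l : C) := forall e : R, 0 < e -> exists2 d : R, 0 < d &
  forall h : R, `|h| < d -> cabs (f (s + h) - f s - rc h * l) <= e * `|h|.

Lemma Re_rcM (h : R) z : complex.Re (rc h * z) = h * complex.Re z.
Proof. by case: z => a b /=; rewrite mul0r subr0. Qed.
Lemma Im_rcM (h : R) z : complex.Im (rc h * z) = h * complex.Im z.
Proof. by case: z => a b /=; rewrite mul0r addr0. Qed.

Lemma curve_diff_parts (f : R -> C) s l : curve_diff f s l ->
  is_derive s (1 : R) (fun x => complex.Re (f x)) (complex.Re l) /\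
  is_derive s (1 : R) (fun x => complex.Im (f x)) (complex.Im l).
Proof.
move=> H; split; apply/rdiffP => e e0; have [d d0 hd] := H _ e0; exists d => // h /hd;
  apply: le_trans.
  by apply: le_trans (Re_le_cabs _); rewrite !raddfB /= Re_rcM.
by apply: le_trans (Im_le_cabs _); rewrite !raddfB /= Im_rcM.
Qed.

Lemma parts_curve_diff (f : R -> C) s l :
  is_derive s (1 : R) (fun x => complex.Re (f x)) (complex.Re l) ->
  is_derive s (1 : R) (fun x => complex.Im (f x)) (complex.Im l) -> curve_diff f s l.
Proof.
move=> /rdiffP H1 /rdiffP H2 e e0; have e20 : 0 < e / 2 by lra.
have [d1 d10 h1] := H1 _ e20; have [d2 d20 h2] := H2 _ e20.
exists (Num.min d1 d2); first by rewrite lt_min d10.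
move=> h; rewrite lt_min => /andP[/h1 a /h2 b].
apply: le_trans (cabs_le_ReIm _) _; rewrite !raddfB /= Re_rcM Im_rcM; lra.
Qed.

Lemma curve_diff_comp F (g : R -> C) s l m : cdiff F (g s) l -> curve_diff g s m ->
  curve_diff (fun x => F (g x)) s (m * l).
Proof.
move=> HF Hg e e0; set K := cabs m + 1.
have K0 : 0 < K by have := cabs_ge0 m; rewrite /K; lra.
have L0 : 0 < cabs l + 1 by have := cabs_ge0 l; lra.
have [|d1 d10 h1] := HF (e / 2 / K); first by rewrite !divr_gt0.
have [|d2 d20 h2] := Hg (Num.min 1 (e / 2 / (cabs l + 1))).
  by rewrite lt_min ltr01 !divr_gt0.
exists (Num.min d2 (d1 / K)); first by rewrite lt_min d20 divr_gt0.
move=> h; rewrite lt_min => /andP[/h2 b hK].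
have b1 : cabs (g (s + h) - g s - rc h * m) <= `|h|.
  apply: le_trans b _; rewrite -[leRHS]mul1r ler_wpM2r // ge_min lexx //.
have b2 : cabs (g (s + h) - g s - rc h * m) * (cabs l + 1) <= e / 2 * `|h|.
  rewrite -ler_pdivlMr // mulrAC; apply: le_trans b _; rewrite ler_wpM2r // ge_min lexx orbT //.
set k := g (s + h) - g s.
have kb : cabs k <= K * `|h|.
  have := cabs_distl k (rc h * m); rewrite cabsM cabs_rc /K mulrDl mul1r [cabs m * _]mulrC.
  by move: b1; rewrite -/k; lra.
have kd : cabs k < d1.
  by apply: le_lt_trans kb _; rewrite mulrC -ltr_pdivlMr.
have := h1 _ kd; rewrite /k [g s + _]addrC subrK -/k => c1.
have c2 : e / 2 / K * cabs k <= e / 2 * `|h|.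
  have e20 : 0 <= e / 2 by lra.
  by rewrite -mulrA ler_wpM2l // mulrC ler_pdivrMr // mulrC.
have -> : F (g (s + h)) - F (g s) - rc h * (m * l) =
  (F (g (s + h)) - F (g s) - k * l) + (k - rc h * m) * l by ring.
apply: le_trans (cabsD _ _) _; rewrite [cabs (_ * l)]cabsM.
have := cabs_ge0 l; have := cabs_ge0 (k - rc h * m); move: b2; rewrite -/k; nra.
Qed.

Definition inner z l : R := complex.Re z * complex.Re l + complex.Im z * complex.Im l.

Lemma inner_le z l : `|inner z l| <= cabs z * cabs l.
Proof.
rewrite -(ler_pXn2r (n := 2)) ?nnegrE ?mulr_ge0 ?cabs_ge0 // exprMn !cabs_sqr.
rewrite real_normK ?num_real // /inner.
have := sqr_ge0 (complex.Re z * complex.Im l - complex.Im z * complex.Re l); lra.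
Qed.

Lemma inner_mul z l : inner z (l * z) = complex.Re l * cabs z ^+ 2.
Proof. by rewrite cabs_sqr /inner; case: z => a b; case: l => c d /=; ring. Qed.

(** The square of the modulus is used since it stays differentiable where F vanishes. *)
Lemma is_derive_cabs2 F (g : R -> C) s l m : cdiff F (g s) l -> curve_diff g s m ->
  is_derive s (1 : R) (fun x => cabs (F (g x)) ^+ 2) (2 * inner (F (g s)) (m * l)).
Proof.
move=> HF Hg; have [h1 h2] := curve_diff_parts (curve_diff_comp HF Hg).
have -> : (fun x => cabs (F (g x)) ^+ 2) =
  (fun x => complex.Re (F (g x))) ^+ 2 + (fun x => complex.Im (F (g x))) ^+ 2.
  by apply/funext => x; rewrite cabs_sqr.
apply: is_derive_eq; rewrite /inner /= !expr1 -![_ *: _]/(_ * _); ring.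
Qed.

(* A straight segment in the coordinate log. *)
Definition spiral (z : C) (p q s : R) : C :=
  z * (rc (expR (p * s)) * (cos (q * s) +i* sin (q * s))%C).

Lemma spiral_diff z p q s :
  curve_diff (spiral z p q) s ((p +i* q)%C * spiral z p q s).
Proof.
have dp (c : R) : is_derive s (1 : R) (fun x => c * x) c.
  by have := @is_deriveZ _ _ _ (@id R) c s 1 1 _; rewrite /= -[c *: 1]/(c * 1) mulr1; apply.
have d1 : is_derive s (1 : R) (fun x => expR (p * x)) (expR (p * s) * p).
  exact: is_derive1_comp.
have d2 : is_derive s (1 : R) (fun x => cos (q * x)) (- sin (q * s) * q).
  exact: is_derive1_comp.
have d3 : is_derive s (1 : R) (fun x => sin (q * x)) (cos (q * s) * q).
  exact: is_derive1_comp.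
have H : curve_diff (fun x => rc (expR (p * x)) * (cos (q * x) +i* sin (q * x))%C : C) s
   ((p +i* q)%C * (rc (expR (p * s)) * (cos (q * s) +i* sin (q * s))%C)).
  apply: parts_curve_diff; under eq_fun do rewrite ?Re_rcM ?Im_rcM /=.
    refine (is_derive_eq (is_deriveM d1 d2) _).
    by rewrite /= -![_ *: _]/(_ * _); ring.
  refine (is_derive_eq (is_deriveM d1 d3) _).
  by rewrite /= -![_ *: _]/(_ * _); ring.
have Hz : cdiff (fun x => z * x) (rc (expR (p * s)) * (cos (q * s) +i* sin (q * s))%C : C) z.
  move=> e e0; exists 1 => // h _.
  by rewrite [X in cabs X](_ : _ = 0) ?cabs0 ?mulr_ge0 ?cabs_ge0 ?(ltW e0) //; ring.
have -> : (p +i* q)%C * spiral z p q s =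
  (p +i* q)%C * (rc (expR (p * s)) * (cos (q * s) +i* sin (q * s))%C) * z :> C.
  by rewrite /spiral -mulrA [z * _]mulrC.
exact: (curve_diff_comp Hz H).
Qed.

Lemma spiral0 z p q : spiral z p q 0 = z.
Proof.
by rewrite /spiral !mulr0 expR0 cos0 sin0 mul1r; apply: mulr1.
Qed.

Lemma cabs_cis (t : R) : cabs (cos t +i* sin t)%C = 1.
Proof. by rewrite cabsE /= cos2Dsin2 sqrtr1. Qed.

(** g(s) exp(-K s) does not increase. No sign is imposed on g or K: [wronskian_lower] takes g to be
    minus a square. *)
Lemma gronwall (g g' : R -> R) (K : R) :
  (forall s, 0 <= s <= 1 -> is_derive s (1 : R) g (g' s)) ->
  (forall s, 0 <= s <= 1 -> g' s <= K * g s) -> g 1 <= expR K * g 0.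
Proof.
move=> dg hg; pose f s := g s * expR (- K * s).
have df s : 0 <= s <= 1 -> is_derive s (1 : R) f ((g' s - K * g s) * expR (- K * s)).
  move=> hs; have d0 := dg s hs.
  have dp : is_derive s (1 : R) (fun x => - K * x) (- K).
    by have := @is_deriveZ _ _ _ (@id R) (- K) s 1 1 _; rewrite /= -[- K *: 1]/(- K * 1) mulr1; apply.
  have d1 : is_derive s (1 : R) (fun x => expR (- K * x)) (expR (- K * s) * - K).
    exact: is_derive1_comp.
  refine (is_derive_eq (is_deriveM d0 d1) _).
  by rewrite /= -![_ *: _]/(_ * _); ring.
have [x||c cI] := @MVT R f (fun s => (g' s - K * g s) * expR (- K * s)) 0 1 ltr01.
- by rewrite in_itv /= => /andP[/ltW a /ltW b]; apply: df; rewrite a b.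
- apply: derivable_within_continuous => x; rewrite in_itv /= => hx.
  by case: (df x hx).
move: cI; rewrite in_itv /= => /andP[/ltW a /ltW b].
rewrite subr0 mulr1 /f mulr1 mulr0 expR0 mulr1 => e.
have : (g' c - K * g c) * expR (- K * c) <= 0.
  by rewrite pmulr_lle0 ?expR_gt0 // subr_le0 hg // a b.
rewrite -e subr_le0 expRN ler_pdivrMr ?expR_gt0 // mulrC; exact.
Qed.

End Curves.

Section PolynomialsNearZero.
Variable R : realType.
Local Notation C := (Cplx R).
Implicit Types (p : {poly C}) (x u z : C) (r : R).

Lemma poly_bounded p : exists2 K : R, 0 <= K & forall x, cabs x <= 1 -> cabs p.[x] <= K.
Proof.
elim/poly_ind: p => [|p c [K K0 hK]].
  by exists 0 => // x _; rewrite horner0 cabs0.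
exists (K + cabs c); first by rewrite addr_ge0 ?cabs_ge0.
move=> x hx; rewrite hornerMXaddC; apply: le_trans (cabsD _ _) _.
rewrite lerD2r cabsM -[leRHS]mulr1 ler_pM ?cabs_ge0 ?hK //.
Qed.

Lemma poly_near0 p : exists2 K : R, 0 <= K &
  forall x, cabs x <= 1 -> cabs (p.[x] - p`_0) <= K * cabs x.
Proof.
elim/poly_ind: p => [|p c _].
  by exists 0 => // x _; rewrite horner0 coef0 subrr cabs0 mul0r.
have [K K0 hK] := poly_bounded p; exists K => // x hx.
rewrite hornerMXaddC coefD coefMX coefC /= add0r addrK cabsM.
by rewrite ler_wpM2r ?cabs_ge0 ?hK.
Qed.

Lemma poly_order p : p != 0 -> exists v (p1 : {poly C}), p = 'X^v * p1 /\ p1`_0 != 0.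
Proof.
move=> p0; have ex : exists v, p`_v != 0.
  by exists (size p).-1; rewrite -lead_coefE lead_coef_eq0.
case: (ex_minnP ex) => v pv vmin.
have [|q e] := @coef_low_factor _ p v.
  by move=> j lt; apply/eqP/negPn/negP => /vmin; rewrite leqNgt lt.
exists v, q; split=> //.
by move: pv; rewrite {1}e coefXnM ltnn subnn.
Qed.

Lemma poly_nonzero_near0 p : p`_0 != 0 -> exists2 rho : R, 0 < rho <= 1 &
  forall x, cabs x <= rho -> cabs p`_0 / 2 <= cabs p.[x].
Proof.
move=> p0; have [K K0 hK] := poly_near0 p; have c0 : 0 < cabs p`_0 by rewrite cabs_gt0.
have K1 : 0 < 2 * (K + 1) by lra.
exists (Num.min 1 (cabs p`_0 / (2 * (K + 1)))).
  by rewrite lt_min ltr01 divr_gt0 // ge_min lexx.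
move=> x; rewrite le_min => /andP[x1]; rewrite ler_pdivlMr // => x2.
have := hK x x1; have := cabs_distl p`_0 (p`_0 - p.[x]); rewrite subKr.
have := cabs_ge0 x; rewrite cabsC; nra.
Qed.

(** With p = x^f q and q(0) nonzero, |p| is comparable to r^f on the ray, so f + s < e contradicts
    the bound for small r. *)
Lemma ray_order p u (s e : nat) (K r1 : R) : cabs u = 1 -> 0 < r1 ->
  (forall r, 0 < r <= r1 -> cabs p.[rc r * u] * r ^+ s <= K * r ^+ e) ->
  forall j, (j + s < e)%N -> p`_j = 0.
Proof.
move=> u1 r10 H j lt; have [->|p0] := eqVneq p 0; first by rewrite coef0.
have [f [q [pE q0]]] := poly_order p0.
case: (ltnP j f) => [jf|fj]; first by rewrite pE coefXnM jf.
have [K2 K20 hK2] := poly_near0 q; have c0 : 0 < cabs q`_0 by rewrite cabs_gt0.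
pose L : R := `|K| + K2 + 1; have L0 : 0 < L by rewrite /L; have := normr_ge0 K; lra.
(* So small that both the assumed bound |K| r and the variation K2 r of q add up to less than
   |q(0)|. *)
pose r := Num.min (Num.min 1 r1) (cabs q`_0 / (2 * L)).
have r0 : 0 < r by rewrite !lt_min ltr01 r10 divr_gt0 // mulr_gt0.
have rle : r <= 1 by rewrite !ge_min lexx.
have rle1 : r <= r1 by rewrite !ge_min lexx orbT.
have rL : r * (2 * L) <= cabs q`_0 by rewrite -ler_pdivlMr ?mulr_gt0 // !ge_min lexx orbT.
have xr : cabs (rc r * u) = r by rewrite cabsM u1 mulr1 cabs_rc gtr0_norm.
have := H r; rewrite r0 rle1 pE hornerM hornerXn cabsM cabsX xr => /(_ isT) h.
have e2 : (e = f + s + (e - f - s))%N by lia.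
have h2 : cabs q.[rc r * u] <= K * r ^+ (e - f - s).
  rewrite -(ler_pM2l (x := r ^+ (f + s))) ?exprn_gt0 //.
  rewrite [leRHS]mulrCA -exprD -e2; apply: le_trans h.
  by rewrite le_eqVlt; apply/orP; left; apply/eqP; rewrite exprD; ring.
have h3 : cabs q.[rc r * u] <= `|K| * r.
  apply: le_trans h2 _; apply: (@le_trans _ _ (`|K| * r ^+ (e - f - s))).
    by rewrite ler_wpM2r ?exprn_ge0 ?ler_norm // ltW.
  rewrite ler_wpM2l // -[leRHS]expr1 ler_wiXn2l ?(ltW r0) //; lia.
have h4 := hK2 (rc r * u); rewrite xr in h4; have {}h4 := h4 rle.
have h5 := cabs_distl q`_0 (q`_0 - q.[rc r * u]); rewrite subKr cabsC in h5.
have h6 : r * (2 * L) = 2 * (`|K| * r) + 2 * (K2 * r) + 2 * r by rewrite /L; ring.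
have h7 : 0 <= `|K| * r by rewrite mulr_ge0 // ltW.
have h8 : 0 <= K2 * r by rewrite mulr_ge0 // ltW.
have : False; last by [].
move: h4 h5 rL; rewrite h6; clear -h3 h7 h8 r0; lra.
Qed.

(* Along u the polar part of x T / D, if any, has negative real part. *)
Lemma growth_direction (T D : {poly C}) : D != 0 -> exists u (rho K : R),
  [/\ cabs u = 1, 0 < rho, 0 <= K &
   forall r, 0 < r <= rho -> complex.Re (rc r * u * (T.[rc r * u] / D.[rc r * u])) <= K].
Proof.
move=> D0; have [->|T0] := eqVneq T 0.
  exists 1, 1, 0; split=> //; first by rewrite cabs1.
  by move=> r _; rewrite horner0 mul0r mulr0.
have [t [T1 [TE T10]]] := poly_order T0; have [v [D1 [DE D10]]] := poly_order D0.
have [rho /andP[rho0 rho1] hD] := poly_nonzero_near0 D10.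
have d0 : 0 < cabs D1`_0 by rewrite cabs_gt0.
have [KT KT0 hT] := poly_bounded T1.
case: (leqP v t.+1) => cmp.
  (* Here x T / D has no pole at 0, and any direction serves. *)
  exists 1, rho, (KT / (cabs D1`_0 / 2)); split; rewrite ?cabs1 //.
    by rewrite divr_ge0 //; lra.
  move=> r /andP[r0 rr]; have xr : cabs (rc r * 1) = r by rewrite mulr1 cabs_rc gtr0_norm.
  apply: le_trans (ler_norm _) _; apply: le_trans (Re_le_cabs _) _.
  set x := rc r * 1 in xr *; have x0 : x != 0 by rewrite -cabs_gt0 xr.
  have D1x : D1.[x] != 0.
    by rewrite -cabs_gt0; apply: lt_le_trans (hD x _); [lra | rewrite xr].
  rewrite TE DE !hornerM !hornerXn.
  have -> : x * (x ^+ t * T1.[x] / (x ^+ v * D1.[x])) = x ^+ (t.+1 - v) * (T1.[x] / D1.[x]).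
    have e : x ^+ t.+1 = x ^+ v * x ^+ (t.+1 - v) by rewrite -exprD subnKC.
    have xv : x ^+ v != 0 by rewrite expf_neq0.
    transitivity (x ^+ t.+1 * T1.[x] / (x ^+ v * D1.[x])); first by rewrite exprS !mulrA.
    by rewrite e; field; rewrite D1x xv.
  rewrite !cabsM cabsX cabsV xr -[leRHS]mul1r ler_pM ?mulr_ge0 ?invr_ge0 ?cabs_ge0 ?exprn_ge0 ?(ltW r0) //.
    by rewrite exprn_ile1 ?(ltW r0) //; lra.
  rewrite ler_pM ?invr_ge0 ?cabs_ge0 //; first by apply: hT; rewrite xr; lra.
  have hDx : cabs D1`_0 / 2 <= cabs D1.[x] by apply: hD; rewrite xr.
  by rewrite lef_pV2 // posrE ?cabs_gt0 //; lra.
pose e := (v - t.+1)%N; have e0 : (0 < e)%N by rewrite subn_gt0.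
pose c := T1`_0 / D1`_0; have c0 : c != 0 by rewrite mulf_neq0 // invr_eq0.
have ca : 0 < cabs c by rewrite cabs_gt0.
have rca : rc (cabs c) != 0 by rewrite -cabs_gt0 cabs_rc normr_gt0 gt_eqF.
(* Near 0, x T / D behaves like c / x^e. As u^e = -c / |c|, on the ray this is -|c| / r^e. *)
pose u : C := e.-root (- (c / rc (cabs c))).
have ue : u ^+ e = - (c / rc (cabs c)) by rewrite rootCK.
have ua : cabs u = 1.
  have := congr1 (@cabs R) ue; rewrite cabsX cabsN cabsM cabsV cabs_rc ger0_norm ?cabs_ge0 //.
  rewrite divff ?gt_eqF // => /eqP; rewrite pexpr_eq1 ?cabs_ge0 //; first by move/eqP.
pose Q := T1 * (D1`_0)%:P - D1 * (T1`_0)%:P.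
have [KQ KQ0 hQ] := poly_near0 Q.
have Q0 : Q`_0 = 0 by rewrite /Q coefB !coefMC mulrC subrr.
pose k := KQ / (cabs D1`_0 * (cabs D1`_0 / 2)).
have k0 : 0 <= k by rewrite divr_ge0 // mulr_ge0 //; lra.
(* Within this radius the error k r of the leading coefficient is at most |c|, so the real part is
   not positive. *)
exists u, (Num.min rho (cabs c / (k + 1))), 0; split=> //.
  by rewrite lt_min rho0 divr_gt0 //; lra.
move=> r /andP[r0]; rewrite le_min => /andP[rr rk].
have xr : cabs (rc r * u) = r by rewrite cabsM ua mulr1 cabs_rc gtr0_norm.
set x := rc r * u in xr *; have x0 : x != 0 by rewrite -cabs_gt0 xr.
have D1a : cabs D1`_0 / 2 <= cabs D1.[x] by apply: hD; rewrite xr.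
have D1x : D1.[x] != 0 by rewrite -cabs_gt0; apply: lt_le_trans D1a; lra.
have close : cabs (T1.[x] / D1.[x] - c) <= k * r.
  have -> : T1.[x] / D1.[x] - c = Q.[x] / (D1`_0 * D1.[x]).
    by rewrite /c /Q hornerD hornerN !hornerM !hornerC; field; rewrite D1x D10.
  rewrite cabsM cabsV cabsM /k mulrAC ler_pM ?invr_ge0 ?mulr_ge0 ?cabs_ge0 //.
    by rewrite -[Q.[x]]subr0 -Q0 -[X in _ * X]xr; apply: hQ; rewrite xr; lra.
  have h1 : 0 < cabs D1`_0 * (cabs D1`_0 / 2) by rewrite mulr_gt0 //; lra.
  have h2 : 0 < cabs D1`_0 * cabs D1.[x] by rewrite mulr_gt0 // cabs_gt0.
  by rewrite lef_pV2 ?posrE // ler_pM2l.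
have ue0 : u ^+ e != 0 by rewrite expf_neq0 // -cabs_gt0 ua.
have re0 : rc (r ^+ e) != 0 by rewrite -cabs_gt0 cabs_rc normr_gt0 expf_neq0 // gt_eqF.
have -> : x * (T.[x] / D.[x]) = rc (r ^- e) * (- rc (cabs c) + (T1.[x] / D1.[x] - c) / u ^+ e).
  have xv : x ^+ v = x ^+ t.+1 * (rc (r ^+ e) * u ^+ e).
    by rewrite rcX -exprMn -/x -exprD subnKC // ltnW.
  have xt : x ^+ t.+1 != 0 by rewrite expf_neq0.
  transitivity (x ^+ t.+1 * T1.[x] / (x ^+ v * D1.[x])).
    by rewrite TE DE !hornerM !hornerXn exprS !mulrA.
  have -> : - rc (cabs c) = c / u ^+ e.
    by rewrite ue invrN mulrN invf_div mulrCA divff // mulr1.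
  by rewrite rcV xv; field; rewrite D1x xt ue0 re0.
rewrite -[rc (r ^- e) * _]/(rc (r ^- e) * _).
have -> : forall (h : R) (z : C), complex.Re (rc h * z) = h * complex.Re z.
  by move=> h [a b] /=; rewrite mul0r subr0.
rewrite pmulr_rle0 ?invr_gt0 ?exprn_gt0 // raddfD /=.
have : complex.Re ((T1.[x] / D1.[x] - c) / u ^+ e) <= k * r.
  apply: le_trans (ler_norm _) _; apply: le_trans (Re_le_cabs _) _.
  by rewrite cabsM cabsV cabsX ua expr1n invr1 mulr1.
have : k * r <= cabs c.
  move: rk; rewrite ler_pdivlMr //; last by lra.
  by have := k0; nra.
lra.
Qed.

Lemma polar z : `|complex.Im z| < complex.Re z -> exists2 t : R, `|t| < pi / 4 &
  z = rc (cabs z) * (cos t +i* sin t)%C.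
Proof.
case: z => x y /= yx; have x0 : 0 < x by apply: le_lt_trans yx.
exists (atan (y / x)).
  have b : `|y / x| < 1 by rewrite normrM normfV (gtr0_norm x0) ltr_pdivrMr // mul1r.
  by move: b; rewrite !ltr_norml -atan1 -atanN => /andP[/lt_atan -> /lt_atan ->].
have s0 : 0 < 1 + (y / x) ^+ 2 by rewrite ltr_pwDl ?sqr_ge0.
have cE : cos (atan (y / x)) = (Num.sqrt (1 + (y / x) ^+ 2))^-1 by rewrite cos_atan.
have c0 : cos (atan (y / x)) != 0 by rewrite cE invr_eq0 gt_eqF // sqrtr_gt0.
have sE : sin (atan (y / x)) = y / x * cos (atan (y / x)).
  by rewrite -{2}[y / x]atanK /tan divfK.
have aE : cabs (x +i* y)%C = x * Num.sqrt (1 + (y / x) ^+ 2).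
  transitivity (Num.sqrt (x ^+ 2) * Num.sqrt (1 + (y / x) ^+ 2)).
    by rewrite cabsE /= -sqrtrM ?sqr_ge0 //; congr Num.sqrt; field; rewrite gt_eqF.
  by rewrite sqrtr_sqr gtr0_norm.
have q0 : Num.sqrt (1 + (y / x) ^+ 2) != 0 by rewrite gt_eqF // sqrtr_gt0.
have xx : x != 0 by rewrite gt_eqF.
apply/eqP; rewrite eq_complex /= !mul0r subr0 addr0 sE aE cE; apply/andP; split; apply/eqP.
  by field.
by field; rewrite q0 xx.
Qed.

Lemma unit_cis u : cabs u = 1 -> exists t : R, u = (cos t +i* sin t)%C.
Proof.
move=> u1; have := cabs_sqr u; rewrite u1 expr1n; case: u {u1} => x y /= /esym e.
have x1 : -1 <= x <= 1 by have y20 := sqr_ge0 y; apply/andP; split; nra.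
have sa : sin (acos x) = Num.sqrt (1 - x ^+ 2) by apply: sin_acos.
have ca : cos (acos x) = x by apply: acosK; rewrite in_itv /=.
have y2 : 1 - x ^+ 2 = y ^+ 2 by rewrite -e; ring.
case: (lerP 0 y) => y0.
  by exists (acos x); rewrite ca sa y2 sqrtr_sqr ger0_norm.
by exists (- acos x); rewrite cosN sinN ca sa y2 sqrtr_sqr ltr0_norm // opprK.
Qed.

Lemma cisD (s t : R) :
  (cos s +i* sin s)%C * (cos t +i* sin t)%C = (cos (s + t) +i* sin (s + t))%C :> C.
Proof.
apply/eqP; rewrite eq_complex /= cosD sinD; apply/andP; split; apply/eqP; ring.
Qed.

End PolynomialsNearZero.

Section Liouville.
Variable R : realType.
Local Notation C := (Cplx R).
Implicit Types (F G : C -> C) (z l : C).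

Lemma cdiff_cst (k : C) z : cdiff (fun _ => k) z 0.
Proof.
by move=> e e0; exists 1 => // h _; rewrite subrr mulr0 subr0 cabs0 mulr_ge0 ?cabs_ge0 ?(ltW e0).
Qed.

Lemma cdiffD F G z l l' : cdiff F z l -> cdiff G z l' ->
  cdiff (fun x => F x + G x) z (l + l').
Proof. by move=> /cdiffP h /cdiffP h'; apply/cdiffP; exact: is_deriveD. Qed.

Lemma cdiffM F G z l l' : cdiff F z l -> cdiff G z l' ->
  cdiff (fun x => F x * G x) z (l * G z + F z * l').
Proof.
move=> /cdiffP h /cdiffP h'; apply/cdiffP; refine (is_derive_eq (is_deriveM h h') _).
by rewrite -![_ *: _]/(_ * _) addrC [l * _]mulrC.
Qed.

Lemma cdiff_sum (I : Type) (r : seq I) (F : I -> C -> C) z (l : I -> C) :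
  (forall i, cdiff (F i) z (l i)) ->
  cdiff (fun x => \sum_(i <- r) F i x) z (\sum_(i <- r) l i).
Proof.
move=> h; elim: r => [|i r IH].
  rewrite big_nil; have -> : (fun x => \sum_(i <- [::]) F i x) = (fun _ => 0).
    by apply/funext => x; rewrite big_nil.
  exact: cdiff_cst.
rewrite big_cons; have -> : (fun x => \sum_(j <- i :: r) F j x) =
   (fun x => F i x + \sum_(j <- r) F j x) by apply/funext => x; rewrite big_cons.
exact: cdiffD.
Qed.

Lemma cdiff_prod n (F : 'I_n -> C -> C) z (l : 'I_n -> C) :
  (forall i, cdiff (F i) z (l i)) ->
  cdiff (fun x => \prod_i F i x) z (\sum_i \prod_j (if j == i then l j else F j z)).
Proof.
elim: n F l => [|n IH] F l h.
  rewrite big_ord0; have -> : (fun x => \prod_(i < 0) F i x) = (fun _ => 1).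
    by apply/funext => x; rewrite big_ord0.
  exact: cdiff_cst.
have -> : (fun x => \prod_i F i x) = (fun x => F ord0 x * \prod_i F (lift ord0 i) x).
  by apply/funext => x; rewrite big_ord_recl.
rewrite big_ord_recl big_ord_recl eqxx.
have -> : \sum_(i < n) \prod_j (if j == lift ord0 i then l j else F j z) =
  F ord0 z * \sum_(i < n) \prod_j (if j == i then l (lift ord0 j) else F (lift ord0 j) z).
  rewrite mulr_sumr; apply: eq_bigr => i _; rewrite big_ord_recl (negbTE (neq_lift _ _)).
  by congr (_ * _); apply: eq_bigr => j _; rewrite (inj_eq lift_inj).
by apply: cdiffM => //; apply: (IH (fun i => F (lift ord0 i)) (fun i => l (lift ord0 i))).
Qed.

(** Jacobi's formula. The product rule in the Leibniz expansion replaces one row i by its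
    derivative, and expanding along that row yields the adjugate. *)
Lemma cdiff_det n (F : C -> 'M[C]_n) z (F' : 'M[C]_n) :
  (forall i j, cdiff (fun x => F x i j) z (F' i j)) ->
  cdiff (fun x => \det (F x)) z (\tr (F' *m \adj (F z))).
Proof.
move=> h; rewrite /determinant.
have -> : \tr (F' *m \adj (F z)) = \sum_(s : {perm 'I_n}) ((-1) ^+ s *
    \sum_i \prod_j (if j == i then F' j (s j) else F z j (s j))).
  rewrite /mxtrace; under [RHS]eq_bigr do rewrite mulr_sumr.
  rewrite exchange_big; apply: eq_bigr => i _; rewrite mxE.
  pose G := \matrix_(j, k) if j == i then F' j k else F z j k.
  transitivity (\det G); last first.
    by apply: eq_bigr => s _; congr (_ * _); apply: eq_bigr => j _; rewrite mxE.
  rewrite (expand_det_row G i); apply: eq_bigr => k _; rewrite !mxE eqxx; congr (_ * _).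
  rewrite /cofactor; congr (_ * \det _); apply/matrixP => p q; rewrite !mxE.
  by rewrite eq_sym (negbTE (neq_lift _ _)).
apply: cdiff_sum => s.
have := cdiffM (cdiff_cst ((-1) ^+ s) z) (cdiff_prod (fun i => h i (s i))).
by rewrite mul0r add0r.
Qed.

Lemma cdiff_det_linear n (F : C -> 'M[C]_n) z (M : 'M[C]_n) :
  (forall i j, cdiff (fun x => F x i j) z ((M *m F z) i j)) ->
  cdiff (fun x => \det (F x)) z (\tr M * \det (F z)).
Proof.
move/cdiff_det; rewrite -mulmxA mul_mx_adj -scalemx1 -scalemxAr mulmx1 mxtraceZ.
by rewrite mulrC.
Qed.

End Liouville.

Section Evaluation.
Variables (R : realType) (a : Cplx R) (r0 : R).
Local Notation C := (Cplx R).
Implicit Types (c : rseq a) (x : C).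

Definition ceval c x : C := csum c (x - a).

Lemma ceval_lincomb (I : Type) (r : seq I) (p : I -> {poly C}) (c : I -> rseq a) x :
  (forall i, radius_ge (c i) r0) -> cabs (x - a) < r0 ->
  radius_ge (\sum_(i <- r) p i *: c i) r0 /\
  ceval (\sum_(i <- r) p i *: c i) x = \sum_(i <- r) (p i).[x] * ceval (c i) x.
Proof.
move=> hc hx; elim: r => [|i r [IH1 IH2]].
  rewrite !big_nil; split; last by rewrite /ceval; exact: csum0.
  by move=> r _; exists 0 => j; rewrite cabs0 mul0r.
rewrite !big_cons.
have h1 : radius_ge (p i *: c i) r0 by apply: rad_pact.
split; first exact: radD.
rewrite -IH2 /ceval -[LHS]/(csum (fun j => (p i *: c i) j + (\sum_(i <- r) p i *: c i) j) _).
rewrite (csumD h1 IH1 hx); congr (_ + _).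
rewrite -[p i *: c i]/(pact _ (c i)) (csum_pact _ (hc i) hx).
by rewrite horner_comp !hornerE subrK.
Qed.

Lemma ceval_scale (p : {poly C}) c x : radius_ge c r0 -> cabs (x - a) < r0 ->
  ceval (p *: c) x = p.[x] * ceval c x.
Proof.
move=> hc hx; have := (@ceval_lincomb unit [:: tt] (fun _ => p) (fun _ => c) x (fun _ => hc) hx).2.
by rewrite !big_seq1.
Qed.

Lemma ceval_cdiff c x : radius_ge c r0 -> cabs (x - a) < r0 ->
  cdiff (ceval c) x (ceval (rder c) x).
Proof.
move=> hc hx e e0; have [d d0 hd] := csum_cdiff hc hx e0; exists d => // h /hd.
by rewrite /ceval [x - a + h]addrAC.
Qed.

(** [divide_poly] with T = 0 annihilates every coefficient. This allows cancelling D in the module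
    of series. *)
Lemma scale_inj (D : {poly C}) c : D != 0 -> 0 < r0 -> (forall z, root D z -> r0 <= cabs (z - a)) ->
  D *: c = 0 -> c = 0.
Proof.
move=> D0 r00 rootD Dc.
have [||z|k k0 hk] := @divide_poly R (D \Po ('X + a%:P)) r0 (r0 / 2).
- lra.
- by rewrite comp_poly_eq0 ?size_XaddC.
- rewrite rootE horner_comp !hornerE => z0.
  by have := rootD _ z0; rewrite addrK.
apply/funext => j; have := hk c 0 j _ j (leqnn _); rewrite mulr0 => H.
have : cabs (c j) * (r0 / 2) ^+ j <= 0.
  apply: H => i _; rewrite -[pact _ _ i]/((D *: c) i) Dc.
  by rewrite -[(0 : rseq a) i]/(0 : C) cabs0 mul0r.
rewrite pmulr_lle0 ?exprn_gt0 //; last by lra.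
by move=> h; apply/eqP; rewrite -cabs_eq0 eq_le h cabs_ge0.
Qed.

End Evaluation.

Section FundamentalMatrix.
Variables (R : realType) (d : nat).
Local Notation C := (Cplx R).
Variables (D : {poly C}) (B : 'M[{poly C}]_d) (a : C) (r0 : R).
Hypothesis r0_gt0 : 0 < r0.
Hypothesis D0 : D != 0.
Hypothesis rootD : forall z, root D z -> r0 <= cabs (z - a).

Lemma exists_fundamental : exists Y : 'I_d -> 'I_d -> rseq a,
  [/\ forall p q, radius_ge (Y p q) r0,
      forall p q, Y p q 0%N = (p == q)%:R &
      forall p q, D *: rder (Y p q) = \sum_k B p k *: Y k q].
Proof.
have /choice[Z hZ] : forall q, exists Z : 'I_d -> nat -> C,
   (forall p, Z p 0%N = (p == q)%:R) /\ (forall p, pact (D \Po ('X + a%:P)) (cder (Z p)) =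
     (fun j => \sum_k pact (B p k \Po ('X + a%:P)) (Z k) j)).
  move=> q; have [Z [h1 h2]] := @exists_formal_solution _ _ D B a r0 r0_gt0 D0 rootD (fun p => (p == q)%:R).
  by exists Z.
exists (fun p q => Z q p : rseq a); split=> p q.
- exact: (radius_solution D0 rootD (hZ q).2).
- exact: (hZ q).1.
- apply/funext => j; rewrite -[LHS]/(pact (D \Po ('X + a%:P)) (cder (Z q p)) j).
  by rewrite (hZ q).2 fct_sumE.
Qed.

Variable Y : 'I_d -> 'I_d -> rseq a.
Hypothesis Yrad : forall p q, radius_ge (Y p q) r0.
Hypothesis Y0 : forall p q, Y p q 0%N = (p == q)%:R.
Hypothesis Ysys : forall p q, D *: rder (Y p q) = \sum_k B p k *: Y k q.

Definition fund x : 'M[C]_d := \matrix_(p, q) ceval (Y p q) x.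
Definition fund_der h x : 'M[C]_d := \matrix_(p, q) ceval (iter h (@rder R a) (Y p q)) x.

Lemma rad_iter_rder h (c : rseq a) : radius_ge c r0 -> radius_ge (iter h (@rder R a) c) r0.
Proof. exact: rad_iter_cder. Qed.

Lemma D_neq0 x : cabs (x - a) < r0 -> D.[x] != 0.
Proof. by move=> hx; apply/negP => /rootD; rewrite leNgt hx. Qed.

Lemma fund_iter h x : cabs (x - a) < r0 ->
  D.[x] ^+ h *: fund_der h x = map_mx (horner^~ x) (itN D B h) *m fund x.
Proof.
move=> hx; apply/matrixP => p q; rewrite !mxE.
(* No columns: for true solutions the inhomogeneous part is empty. *)
pose F : 'M[{poly C}]_(d, 0) := 0.
have sysE p' : D *: rder (Y p' q) = \sum_k B p' k *: Y k q + \sum_(r < 0) F p' r *: (0 : rseq a).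
  by rewrite big_ord0 addr0.
have := @iterated_system C d 0 D B F (rseq a) (@rder R a) (@rderZ R a) (fun p => Y p q)
  (fun _ => 0) sysE h p.
rewrite [X in _ + X]big1 ?addr0 => [|i _]; last by rewrite big_ord0.
move/(congr1 (fun c => ceval c x)); rewrite /= (ceval_scale _ (rad_iter_rder h (Yrad p q)) hx).
rewrite horner_exp => ->.
rewrite (ceval_lincomb _ _ (fun k => Yrad k q) hx).2; apply: eq_bigr => k _.
by rewrite !mxE.
Qed.

Lemma fund_a : \det (fund a) = 1.
Proof.
suff -> : fund a = 1%:M by rewrite det1.
apply/matrixP => p q; rewrite !mxE -Y0 /ceval subrr.
have c0 : cabs (0 : C) < r0 by rewrite cabs0.
apply: clim_unique (clim_shift (csum_lim (Yrad p q) c0)) _.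
apply: clim_ext (clim_cst _) => n; rewrite psumE big_ord_recl expr0 mulr1.
by rewrite big1 ?addr0 // => i _; rewrite expr0n mulr0.
Qed.

Lemma fund_liouville x : cabs (x - a) < r0 ->
  cdiff (fun y => \det (fund y)) x ((\tr B).[x] / D.[x] * \det (fund x)).
Proof.
move=> hx; have -> : (\tr B).[x] / D.[x] = \tr (D.[x]^-1 *: map_mx (horner^~ x) B).
  rewrite mxtraceZ mulrC; congr (_ * _).
  by rewrite /mxtrace horner_sum; apply: eq_bigr => i _; rewrite mxE.
apply: cdiff_det_linear => i j.
have -> : (fun y => fund y i j) = ceval (Y i j) by apply/funext => y; rewrite mxE.
have -> : ((D.[x]^-1 *: map_mx (horner^~ x) B) *m fund x) i j = ceval (rder (Y i j)) x.
  have := congr1 (fun c => ceval c x) (Ysys i j).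
  rewrite /= (ceval_scale _ (rad_iter_rder 1 (Yrad i j)) hx).
  rewrite (ceval_lincomb _ _ (fun k => Yrad k j) hx).2 => e.
  rewrite -scalemxAl mxE [(_ *m _) i j]mxE.
  apply: (mulfI (D_neq0 hx)); rewrite e mulrA mulfV ?D_neq0 // mul1r.
  by apply: eq_bigr => k _; rewrite !mxE.
exact: ceval_cdiff (Yrad i j) hx.
Qed.

End FundamentalMatrix.

(** * The Wronskian on a ray, and a sector inside the disc of convergence *)

Section Rays.
Variable R : realType.
Local Notation C := (Cplx R).
Variables (u : C) (r0 : R).
Hypothesis u1 : cabs u = 1.
Hypothesis r0_gt0 : 0 < r0.
Let a : C := rc r0 * u.

Lemma cabs_ray r : 0 < r -> cabs (rc r * u) = r.
Proof. by move=> r1; rewrite cabsM u1 mulr1 cabs_rc gtr0_norm. Qed.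

Lemma ray_dist r : r <= r0 -> cabs (rc r * u - a) = r0 - r.
Proof.
move=> h; rewrite /a -mulrBl cabsM u1 mulr1 -rcN -rcD cabs_rc ler0_norm; lra.
Qed.

Lemma ray_in_disc r : 0 < r <= r0 -> cabs (rc r * u - a) < r0.
Proof. by move=> /andP[h1 h2]; rewrite ray_dist //; lra. Qed.

(** In the coordinate log x the derivative of |W|^2 is 2 Re(x t) |W|^2. Moving inwards from a, the
    factor p = log(r / r0) is negative, so an upper bound on Re(x t) bounds |W| from below by (r /
    r0)^K. *)
Lemma wronskian_lower (W t : C -> C) (K : R) (k : nat) : 0 <= K <= k%:R ->
  W a = 1 -> (forall x, cabs (x - a) < r0 -> cdiff W x (t x * W x)) ->
  (forall r : R, 0 < r <= r0 -> complex.Re (rc r * u * t (rc r * u)) <= K) ->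
  forall r : R, 0 < r <= r0 -> (r / r0) ^+ k <= cabs (W (rc r * u)).
Proof.
move=> /andP[K0 Kk] Wa dW hK r /andP[rp rr].
have q0 : 0 < r / r0 by rewrite divr_gt0.
have q1 : r / r0 <= 1 by rewrite ler_pdivrMr // mul1r.
pose p := ln (r / r0); have p0 : p <= 0 by rewrite /p ln_le0.
pose g s := spiral a p 0 s : C.
have gE s : g s = rc (r0 * expR (p * s)) * u.
  by rewrite /g /spiral mul0r cos0 sin0 /a rcM [(1 +i* 0)%C]/(1 : C) mulr1 mulrAC.
have gr (s : R) : 0 <= s <= 1 -> 0 < r0 * expR (p * s) <= r0.
  move=> /andP[s0 s1]; rewrite mulr_gt0 ?expR_gt0 //= -[leRHS]mulr1 ler_wpM2l ?(ltW r0_gt0) //.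
  by rewrite -[leRHS]expR0 ler_expR mulr_le0_ge0.
pose G s := cabs (W (g s)) ^+ 2.
pose G' s := 2 * inner (W (g s)) ((p +i* 0)%C * g s * (t (g s) * W (g s))).
(* The sign is reversed because [gronwall] only gives upper bounds. *)
have dG (s : R) : 0 <= s <= 1 -> is_derive s (1 : R) (fun s => - G s) (- G' s).
  move=> hs; apply: is_deriveN; apply: is_derive_cabs2; last exact: spiral_diff.
  by apply: dW; rewrite gE; apply: ray_in_disc; apply: gr.
have hG (s : R) : 0 <= s <= 1 -> - G' s <= 2 * p * K * (- G s).
  move=> hs; rewrite /G' mulrA inner_mul /G.
  have -> : complex.Re ((p +i* 0)%C * g s * t (g s)) = p * complex.Re (g s * t (g s)).
    by rewrite -[(p +i* 0)%C * _ * _]mulrA -[(p +i* 0)%C]/(rc p) Re_rcM.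
  have := hK _ (gr s hs); rewrite -gE => h.
  have := sqr_ge0 (cabs (W (g s))); move: (cabs _ ^+ 2) (complex.Re _) h => x y h x0.
  have h2 : p * K * x <= p * y * x by rewrite ler_wpM2r // ler_wnM2l.
  by move: h2; lra.
have := gronwall dG hG; rewrite /G.
have g0 : g 0 = a by rewrite /g spiral0.
have g1 : g 1 = rc r * u.
  by rewrite gE mulr1 /p lnK ?posrE // mulrCA divff ?mulr1 // gt_eqF.
rewrite g0 g1 Wa cabs1 expr1n mulrN1 lerN2 => h.
have e1 : (r / r0) ^+ k ^+ 2 <= expR (2 * p * K).
  rewrite -exprM; apply: (@le_trans _ _ (expR (p * (k * 2)%:R))); last first.
    rewrite ler_expR natrM [2 * p]mulrC -mulrA ler_wnM2l //; lra.
  by rewrite [p * _]mulrC expRM_natl /p lnK ?posrE.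
have : (r / r0) ^+ k ^+ 2 <= cabs (W (rc r * u)) ^+ 2 by apply: le_trans h.
by rewrite ler_pXn2r ?nnegrE ?cabs_ge0 ?exprn_ge0 ?(ltW q0).
Qed.

Variable phi : R.
Hypothesis uphi : u = (cos phi +i* sin phi)%C.
Local Notation S := (sector (0 : C) r0 (phi - pi / 4) (phi + pi / 4)).

Lemma cos_quarter (t : R) : `|t| < pi / 4 -> 1 / 2 < cos t.
Proof.
move=> ht; have /andP[t1 t2] : - (pi / 4) < t < pi / 4 by rewrite -ltr_norml.
have pp := @pi_gt0 R.
have c0 : 0 < cos t by apply: cos_gt0_pihalf; apply/andP; split; lra.
have c2 : 0 < cos (t *+ 2) by apply: cos_gt0_pihalf; rewrite -mulr_natl; apply/andP; split; lra.
move: c2; rewrite cos_mulr2n -mulr_natl; nra.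
Qed.

(** By the law of cosines the point lies in the disc when r < 2 r0 cos(t - phi), which follows from
    r < r0 and a cosine above 1/2. *)
Lemma sector_in_disc x : S x -> cabs (x - a) < r0.
Proof.
case=> r [t [/andP[rp rr] /andP[t1 t2] ->]]; rewrite add0r /a uphi.
have c : 1 / 2 < cos (t - phi) by apply: cos_quarter; rewrite ltr_norml; apply/andP; split; lra.
rewrite -(ltr_pXn2r (n := 2)) ?nnegrE ?cabs_ge0 ?(ltW r0_gt0) // cabs_sqr.
rewrite cosB in c; rewrite /= !mul0r subr0 addr0.
have e1 := cos2Dsin2 t; have e2 := cos2Dsin2 phi.
rewrite (_ : _ + _ = r ^+ 2 * (cos t ^+ 2 + sin t ^+ 2) + r0 ^+ 2 * (cos phi ^+ 2 + sin phi ^+ 2)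
  - 2 * (r * r0) * (cos t * cos phi + sin t * sin phi)); last by ring.
rewrite e1 e2; move: (cos t * cos phi + sin t * sin phi) c => X c.
have h1 : 0 < r * (r0 - r) by rewrite mulr_gt0 // subr_gt0.
have h2 : 0 < r * r0 * (X - 1 / 2) by rewrite mulr_gt0 ?mulr_gt0 // subr_gt0.
by nra.
Qed.

(** After division by r u the disc has centre 1 and radius 1/3: there |Im| <= 1/3 < 2/3 <= Re, so
    the argument is below π/4, and the modulus is at most 4/3, hence r times it stays below r0. *)
Lemma disc_in_sector r w : 0 < r <= r0 / 2 -> cabs w <= r / 3 -> S (rc r * u + w).
Proof.
move=> /andP[rp rr] hw.
have u0 : u != 0 by rewrite -cabs_gt0 u1.
have r_n0 : rc r != 0 by rewrite -cabs_gt0 cabs_rc normr_gt0 gt_eqF.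
pose w' := w / (rc r * u).
have w'b : cabs w' <= 1 / 3.
  by rewrite /w' cabsM cabsV (cabs_ray rp) ler_pdivrMr //; lra.
have xE : rc r * u + w = rc r * u * (1 + w') by rewrite /w'; field; rewrite u0 r_n0.
have [|t ht tE] := @polar R (1 + w').
  have := Re_le_cabs w'; have := Im_le_cabs w'; rewrite !raddfD /=.
  rewrite add0r => h1; rewrite ler_norml => /andP[h2 h3]; lra.
have b1 : cabs (1 + w') <= 4 / 3.
  by apply: le_trans (cabsD _ _) _; rewrite cabs1; lra.
have b2 : 0 < cabs (1 + w').
  by have := cabs_distl 1 (- w'); rewrite opprK cabs1 cabsN; lra.
exists (r * cabs (1 + w')), (phi + t); move: ht; rewrite ltr_norml => /andP[t1 t2]; split.
- rewrite mulr_gt0 //=; nra.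
- by apply/andP; split; lra.
rewrite add0r xE {1}tE uphi mulrACA -rcM cisD; set y := r * _.
by apply/eqP; rewrite eq_complex /= !mul0r subr0 addr0 !eqxx.
Qed.

End Rays.

Section HolomorphicSolutions.
Variables (R : realType) (N m : nat).
Local Notation C := (Cplx R).
Variables (A : 'I_m.+1 -> 'M[{poly C}]_N) (a : C) (r0 : R) (y : 'I_N -> rseq a).
Hypothesis yrad : forall s, radius_ge (y s) r0.
Hypothesis yG : forall r, opG A (fun i s => iter i (@rder R a) (y s)) r = 0.

Lemma derive1n_ceval (c : rseq a) i x : radius_ge c r0 -> cabs (x - a) < r0 ->
  derive1n i (ceval c) x = ceval (iter i (@rder R a) c) x.
Proof.
move=> hc; elim: i x => [//|i IH] x hx; rewrite derive1nS derive1E.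
have d0 : 0 < r0 - cabs (x - a) by lra.
have : cdiff (derive1n i (ceval c)) x (ceval (iter i.+1 (@rder R a) c) x).
  apply: (cdiff_local d0 _ (ceval_cdiff (rad_iter_rder i hc) hx)) => z hz.
  by rewrite IH //; have := cabsD (z - x) (x - a); rewrite subrKA; lra.
by move/cdiffP => -[_ ->].
Qed.

Lemma derivable_derive1n_ceval (c : rseq a) i x : radius_ge c r0 -> cabs (x - a) < r0 ->
  derivable (derive1n i (ceval c)) x 1.
Proof.
move=> hc hx; have d0 : 0 < r0 - cabs (x - a) by lra.
have : cdiff (derive1n i (ceval c)) x (ceval (iter i.+1 (@rder R a) c) x).
  apply: (cdiff_local d0 _ (ceval_cdiff (rad_iter_rder i hc) hx)) => z hz.
  by rewrite derive1n_ceval //; have := cabsD (z - x) (x - a); rewrite subrKA; lra.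
by move/cdiffP => -[].
Qed.

Lemma formal_holo_solution (S : set C) : (forall x, S x -> cabs (x - a) < r0) ->
  holo_solution A S (fun s => ceval (y s)).
Proof.
move=> hS; split=> [s i x /hS hx|x /hS hx]; first exact: derivable_derive1n_ceval.
apply/colP => r; rewrite summxE [RHS]mxE.
transitivity (ceval (opG A (fun i s => iter i (@rder R a) (y s)) r) x).
  rewrite /opG pair_bigA (@ceval_lincomb _ a r0 _ _ (fun p : 'I_m.+1 * 'I_N => A p.1 r p.2)
    (fun p => iter p.1 (@rder R a) (y p.2)) x (fun p => rad_iter_rder p.1 (yrad p.2)) hx).2 /=.
  rewrite -(pair_bigA _ (fun i s => (A i r s).[x] * ceval (iter i (@rder R a) (y s)) x)) /=.
  apply: eq_bigr => i _; rewrite mxE; apply: eq_bigr => s _.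
  by rewrite !mxE derive1n_ceval.
by rewrite yG /ceval; exact: csum0.
Qed.

End HolomorphicSolutions.

(** * Moderate growth forces an invertible leading matrix *)

Section CompanionChain.
Variables (K : fieldType) (N m' : nat).
Local Notation m := m'.+1.
Variables (A : 'I_m.+1 -> 'M[{poly K}]_N).
Local Notation D := (\det (A ord_max)).
Local Notation I := ('I_m * 'I_N)%type.
Variables (V : lmodType {poly K}) (delta : {additive V -> V}).
Hypothesis injD : forall v : V, D *: v = 0 -> v = 0.
Variable Z : 'I_#|{: I}| -> V.
Hypothesis Zsys : forall p, D *: delta (Z p) = \sum_k compB A p k *: Z k.

Let y i s := iter i delta (Z (enum_rank ((ord0, s) : I))).

(** The rows below the last block read D Z_i' = D Z_(i+1), and D can be cancelled: a solution of the
    system consists of successive derivatives. *)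
Lemma companion_chain i (lt : (i < m)%N) s :
  Z (enum_rank ((Ordinal lt, s) : I)) = y i s.
Proof.
elim: i lt => [|i IH] lt.
  by rewrite /y /=; congr (Z (enum_rank (_, _))); apply: val_inj.
have lti := ltnW lt; rewrite /y iterS -/(y i s) -(IH lti).
apply/esym/eqP; rewrite -subr_eq0; apply/eqP/injD; rewrite scalerBr Zsys.
rewrite (bigD1 (enum_rank ((Ordinal lt, s) : I))) //= mxE !enum_rankK lt /= !eqxx mulr1n.
rewrite addrAC subrr add0r big1 // => k ne; rewrite mxE enum_rankK lt.
case ek: (enum_val k) => [j t]; case: eqP => e1; case: eqP => e2; rewrite ?mulr0n ?scale0r //.
case/eqP: ne; rewrite -[k]enum_valK ek e2; congr (enum_rank (_, _)).
exact: val_inj.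
Qed.

(** The last block of rows only yields adj(A_m) P y = 0. Multiplying by A_m turns it into D P y = 0,
    and D is cancelled. *)
Lemma companion_opG r : opG A y r = 0.
Proof.
have YE p : compY y p = Z p.
  rewrite /compY -[p in RHS]enum_valK; case: (enum_val p) => [[i lt] s] /=.
  by rewrite companion_chain.
have adjG s : \sum_r \adj (A ord_max) s r *: opG A y r = 0.
  have := @companion_system K N m A V delta y (fun _ _ => erefl _)
     (enum_rank ((ord_max, s) : I)).
  rewrite YE Zsys; under [X in _ = X + _ -> _]eq_bigr do rewrite YE.
  rewrite -[LHS]addr0 => /addrI e; rewrite [RHS]e.
  apply: eq_bigr => q _; rewrite [compF A _ q]mxE enum_rankK /= ltnn //.
apply: injD.
transitivity (\sum_s A ord_max r s *: \sum_q \adj (A ord_max) s q *: opG A y q).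
  under eq_bigr do rewrite scaler_sumr.
  rewrite exchange_big /=.
  transitivity (\sum_q (A ord_max *m \adj (A ord_max)) r q *: opG A y q).
    rewrite mul_mx_adj (bigD1 r) //= big1 ?addr0 => [|q ne]; first by rewrite !mxE eqxx mulr1n.
    by rewrite !mxE eq_sym (negbTE ne) mulr0n scale0r.
  apply: eq_bigr => q _; rewrite mxE scaler_suml; apply: eq_bigr => s _.
  by rewrite scalerA.
by rewrite big1 // => s _; rewrite adjG scaler0.
Qed.

End CompanionChain.

Section ModerateBounds.
Variable R : realType.
Local Notation C := (Cplx R).

Lemma moderate_bound N (S : set C) (f : 'I_N -> C -> C) : moderate_growth 0 S f ->
  exists b (d : R), [/\ 0 < d, d <= 1 &
   forall s x, S x -> cabs x < d -> cabs (f s x) * cabs x ^+ b <= 1].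
Proof.
case=> b hb; exists b.
have H s : exists d : R, 0 < d /\ forall x, S x -> cabs x < d -> cabs (f s x) * cabs x ^+ b <= 1.
  have /cvgrPdist_le /(_ 1 ltr01) := hb s.
  rewrite /prop_near1 /within /= => /nbhs_ballP[d /pos_rc[de d0] hd].
  exists (complex.Re d); split=> // x Sx hx.
  have := hd x; rewrite /ball_ /= sub0r normrN normE de rc_lt => /(_ hx Sx).
  by rewrite sub0r normrN subr0 normE -rc1 rc_le cabsM cabsX mulrC.
have /choice[d hd] := H.
exists (\big[Num.min/1]_s d s); split.
- by apply: lt_bigmin => // s _; apply: (hd s).1.
- exact: bigmin_le_id.
- move=> s x Sx hx; apply: (hd s).2 => //; apply: lt_le_trans hx _.
  exact: bigmin_le_cond.
Qed.

Lemma moderate_bound_family (I : finType) N (S : set C) (f : I -> 'I_N -> C -> C) :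
  (forall q, moderate_growth 0 S (f q)) -> exists b (d : R), [/\ 0 < d, d <= 1 &
   forall q s x, S x -> cabs x < d -> cabs (f q s x) * cabs x ^+ b <= 1].
Proof.
move=> h; have /choice[bd hbd] : forall q, exists bd : nat * R, [/\ 0 < bd.2, bd.2 <= 1 &
   forall s x, S x -> cabs x < bd.2 -> cabs (f q s x) * cabs x ^+ bd.1 <= 1].
  by move=> q; have [b [d hd]] := moderate_bound (h q); exists (b, d).
(* For |x| <= 1 a larger exponent only weakens the estimate, so the sum of the exponents serves for
   all q. *)
exists (\sum_q (bd q).1)%N, (\big[Num.min/1]_q (bd q).2); split.
- by apply: lt_bigmin => // q _; case: (hbd q).
- exact: bigmin_le_id.
- move=> q s x Sx hx; have [d0 d1 hq] := hbd q.
  have hx' : cabs x < (bd q).2.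
    apply: lt_le_trans hx _; exact: (bigmin_le_cond _ (fun q => (bd q).2)).
  apply: le_trans (hq s x Sx hx'); rewrite ler_wpM2l ?cabs_ge0 //.
  rewrite ler_wiXn2l ?cabs_ge0 //; first by lra.
  by rewrite (bigD1 q) //= leq_addr.
Qed.

Lemma det_bound n (M : 'M[C]_n) (X : R) : (forall i j, cabs (M i j) <= X) ->
  cabs (\det M) <= n`!%:R * X ^+ n.
Proof.
move=> h; rewrite /determinant; apply: le_trans (cabs_sum _ _ _) _.
apply: (@le_trans _ _ (\sum_(s : {perm 'I_n}) X ^+ n)).
  apply: ler_sum => s _; rewrite cabsM cabsX cabsN cabs1 expr1n mul1r cabs_prod.
  rewrite -[n in X ^+ n]card_ord -prodr_const; apply: ler_prod => i _.
  by rewrite cabs_ge0 h.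
by rewrite sumr_const card_Sn mulr_natl.
Qed.

Lemma adj_bound n (M : 'M[C]_n) (X : R) i j : (forall i j, cabs (M i j) <= X) ->
  cabs (\adj M i j) <= (n.-1)`!%:R * X ^+ n.-1.
Proof.
move=> h; rewrite mxE /cofactor cabsM cabsX cabsN cabs1 expr1n mul1r.
by apply: det_bound => p q; rewrite !mxE.
Qed.

End ModerateBounds.

Section ModerateSystems.
Variables (R : realType) (N m' : nat).
Local Notation C := (Cplx R).
Local Notation m := m'.+1.
Variables (A : 'I_m.+1 -> 'M[{poly C}]_N).
Local Notation D := (\det (A ord_max)).
Local Notation I := ('I_m * 'I_N)%type.
Local Notation d := #|{: I}|.

(* Cauchy estimate for |f| <= |x|^(-b) on the circle of radius r/3 around r u,
   with f expanded at r0 u. *)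
Lemma cauchy_ray (u : C) (r0 r : R) (c : nat -> C) b h : cabs u = 1 ->
  radius_ge c r0 -> 0 < r -> r <= r0 / 2 ->
  (forall w, cabs w = r / 3 -> cabs (csum c (rc r * u + w - rc r0 * u)) * cabs (rc r * u + w) ^+ b <= 1) ->
  cabs (csum (iter h (@cder R) c) (rc r * u - rc r0 * u)) * r ^+ (b + h) <=
   h`!%:R * ((3 / 2) ^+ b * 3 ^+ h).
Proof.
move=> u1 hc rp rr H.
have r30 : 0 < r / 3 by lra.
have dist : cabs (rc r * u - rc r0 * u) = r0 - r by apply: ray_dist => //; lra.
have := @csum_cauchy R c r0 (rc r * u - rc r0 * u) (r / 3) ((2 * r / 3) ^- b) h hc r30.
rewrite dist => /(_ _ _) K0.
have {K0} : cabs (csum (iter h (@cder R) c) (rc r * u - rc r0 * u)) <=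
   h`!%:R * ((2 * r / 3) ^- b / (r / 3) ^+ h).
  apply: K0; first by lra.
  move=> w hw; have := H w hw; rewrite [rc r * u - _ + w]addrAC => h1.
  have lw : 2 * r / 3 <= cabs (rc r * u + w).
    have := cabs_distl (rc r * u) (- w); rewrite opprK cabsN (cabs_ray u1 rp); lra.
  have q0 : 0 < 2 * r / 3 by lra.
  rewrite -[leRHS]mul1r ler_pdivlMr ?exprn_gt0 //; apply: le_trans h1.
  rewrite ler_wpM2l ?cabs_ge0 // lerXn2r ?nnegrE ?cabs_ge0 // ltW //.
move=> h2; have rb : 0 <= r ^+ (b + h) by rewrite exprn_ge0 // ltW.
apply: le_trans (ler_wpM2r rb h2) _; rewrite le_eqVlt; apply/orP; left; apply/eqP.
have rbn : r ^+ b != 0 by rewrite expf_neq0 // gt_eqF.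
have rhn : r ^+ h != 0 by rewrite expf_neq0 // gt_eqF.
have b2 : (2 : R) ^+ b != 0 by rewrite expf_neq0.
have b3 : (3 : R) ^+ b != 0 by rewrite expf_neq0.
have h3 : (3 : R) ^+ h != 0 by rewrite expf_neq0.
rewrite !expr_div_n exprMn exprD; field.
by rewrite rhn rbn b2 b3 h3.
Qed.

(** N_h = D^h Y^(h) adj(Y) / det Y. On the ray D^h gains r^(v h), the derivatives lose r^(E+h) with
    E = b + m, the adjugate loses r^(E (d-1)) and the Wronskian r^k; [ray_order] converts the
    balance into an order. *)
Lemma moderate_poles v (D1 : {poly C}) : D = 'X^v * D1 -> D1`_0 != 0 ->
  singular_regular A 0 -> exists b, forall h (p q : 'I_d) j, (j + h + b < v * h)%N ->
    (itN D (compB A) h p q)`_j = 0.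
Proof.
move=> DE D10 sr.
have D0 : D != 0.
  have D1n : D1 != 0 by apply: contraNneq D10 => ->; rewrite coef0.
  by rewrite DE mulf_neq0 // monic_neq0 // monicXn.
set B := compB A.
have [u [rho [K [u1 rho0 K0 hK]]]] := growth_direction (\tr B) D0.
have [rho1 /andP[rho10 rho11] hD1] := poly_nonzero_near0 D10.
have D1a : 0 < cabs D1`_0 by rewrite cabs_gt0.
(* The disc of radius r0 around a lies in |x| < 2 r0 <= rho1, where D vanishes at 0 only, and 0 is
   on its boundary. *)
pose r0 : R := Num.min (Num.min 1 rho) (rho1 / 2).
have r00 : 0 < r0 by rewrite !lt_min ltr01 rho0 divr_gt0.
have r01 : r0 <= 1 by rewrite !ge_min lexx.
have r0rho : r0 <= rho by rewrite !ge_min lexx orbT.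
have r0rho1 : r0 <= rho1 / 2 by rewrite !ge_min lexx orbT.
pose a := rc r0 * u.
have aa : cabs a = r0 by apply: cabs_ray.
have rootD z : root D z -> r0 <= cabs (z - a).
  rewrite rootE DE hornerM hornerXn mulf_eq0 => /orP[|/eqP z0].
    by rewrite expf_eq0 => /andP[_ /eqP ->]; rewrite sub0r cabsN aa.
  case: (lerP (cabs z) rho1) => h; first by have := hD1 z h; rewrite z0 cabs0; lra.
  by have := cabs_distl z a; rewrite aa; lra.
have [Y [Yrad Y0 Ysys]] := exists_fundamental B r00 D0 rootD.
have injD (v0 : rseq a) : D *: v0 = 0 -> v0 = 0 by apply: scale_inj rootD.
have [phi uphi] := unit_cis u1.
pose S := sector (0 : C) r0 (phi - pi / 4) (phi + pi / 4).
pose f (q : 'I_d) (s : 'I_N) := ceval (Y (enum_rank ((ord0, s) : I)) q).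
have Shol q : holo_solution A S (f q).
  apply: (@formal_holo_solution R N m A a r0 (fun s => Y (enum_rank ((ord0, s) : I)) q)).
  - by move=> s; apply: Yrad.
  - by move=> r; apply: (@companion_opG C N m' A (rseq a) (@rder R a) injD (fun p => Y p q) (fun p => Ysys p q)).
  - by move=> x; apply: sector_in_disc.
have pp := @pi_gt0 R.
have [b [dl [dl0 dl1 hb]]] : exists b (dl : R), [/\ 0 < dl, dl <= 1 &
   forall q s x, S x -> cabs x < dl -> cabs (f q s x) * cabs x ^+ b <= 1].
  apply: moderate_bound_family => q; apply: sr (Shol q) => //.
  by rewrite -mulr_natl; apply/andP; split; lra.
(* For r <= r1 the circle of radius r / 3 around r u stays in the sector and in |x| < dl, where
   moderate growth is explicit. *)
pose r1 := Num.min (r0 / 2) (dl / 2).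
have r10 : 0 < r1 by rewrite lt_min !divr_gt0.
have r1r0 : r1 <= r0 / 2 by rewrite ge_min lexx.
have r1dl : r1 <= dl / 2 by rewrite ge_min lexx orbT.
(* Row (i, s) of the fundamental matrix is already an i-th derivative, so its h-th derivative has
   order h + i; the sum covers all i < m. *)
pose Ch h : R := \sum_(i < m) (h + i)`!%:R * ((3 / 2) ^+ b * 3 ^+ (h + i)).
have pos n l : 0 <= n`!%:R * ((3 / 2) ^+ b * 3 ^+ l) :> R.
  by rewrite !mulr_ge0 ?exprn_ge0 //; lra.
have Ch0 h : 0 <= Ch h by apply: sumr_ge0 => i _; apply: pos.
have derb h p q r : 0 < r <= r1 ->
    cabs (fund_der Y h (rc r * u) p q) * r ^+ (b + m + h) <= Ch h.
  move=> /andP[rp rr]; rewrite mxE.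
  rewrite -[p]enum_valK; case: (enum_val p) => [[i lt] s].
  rewrite (@companion_chain C N m' A (rseq a) (@rder R a) injD (fun p => Y p q) (fun p => Ysys p q)).
  rewrite -iterD.
  have r1' : r <= 1 by lra.
  set c := Y (enum_rank ((ord0, s) : I)) q.
  have -> : ceval (iter (h + i) (@rder R a) c) (rc r * u) =
    csum (iter (h + i) (@cder R) c) (rc r * u - rc r0 * u) by [].
  apply: (@le_trans _ _ (cabs (csum (iter (h + i) (@cder R) c)
     (rc r * u - rc r0 * u)) * r ^+ (b + (h + i)))).
    have le : (b + (h + i) <= b + m + h)%N by rewrite -addnA leq_add2l addnC leq_add2r ltnW.
    apply: ler_wpM2l; first exact: cabs_ge0.
    by apply: ler_wiXn2l => //; apply: ltW.
  apply: (@le_trans _ _ ((h + i)`!%:R * ((3 / 2) ^+ b * 3 ^+ (h + i)))).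
    apply: (@cauchy_ray u r0 r c b (h + i) u1 (Yrad _ _) rp) => [|w hw].
      exact: le_trans rr r1r0.
    apply: (hb q s (rc r * u + w)).
      apply: disc_in_sector => //; first by rewrite rp /=; lra.
      by rewrite hw.
    by apply: le_lt_trans (cabsD _ _) _; rewrite (cabs_ray u1 rp) hw; lra.
  rewrite /Ch (bigD1 (Ordinal lt)) //= lerDl.
  by apply: sumr_ge0 => j _; apply: pos.
have [k Kk] : exists k : nat, K <= k%:R.
  by exists (Num.bound K); apply/ltW/archi_boundP.
have Wlow r : 0 < r <= r1 -> (r / r0) ^+ k <= cabs (\det (fund Y (rc r * u))).
  move=> /andP[rp rr].
  apply: (@wronskian_lower R u r0 u1 r00 (fun x => \det (fund Y x))
    (fun x => (\tr B).[x] / D.[x]) K k).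
  - by rewrite K0.
  - by have := fund_a r00 Yrad Y0.
  - by move=> x hx; apply: fund_liouville hx.
  - by move=> r' /andP[r'0 r'r0]; apply: hK; rewrite r'0 /=; lra.
  - by rewrite rp /=; lra.
have [KD KD0 hKD] := poly_bounded D1.
pose E := (b + m)%N.
(* All the losses except the r^h from Cauchy's estimate, none depending on h. *)
exists (k + E + E * d.-1)%N => h p q j lt.
pose Ctot : R := d%:R * (KD ^+ h * Ch h * (d.-1`!%:R * Ch 0%N ^+ d.-1)) * r0 ^+ k.
apply: (@ray_order R _ u (k + E + h + E * d.-1) (v * h) Ctot r1 u1 r10); last first.
  apply: leq_ltn_trans lt.
  by rewrite -!addnA leq_add2l; clear; lia.
move=> r hr; have /andP[rp rr] := hr; set x := rc r * u.
have xr : cabs x = r by apply: cabs_ray.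
have x1 : cabs x <= 1 by rewrite xr; lra.
have xd : cabs (x - a) < r0 by apply: ray_in_disc => //; rewrite rp /=; lra.
have fi := fund_iter Yrad Ysys h xd.
have e1 : map_mx (horner^~ x) (itN D B h) *m (fund Y x *m \adj (fund Y x)) =
   D.[x] ^+ h *: (fund_der Y h x *m \adj (fund Y x)).
  by rewrite mulmxA -fi scalemxAl.
have e2 : (itN D B h p q).[x] * \det (fund Y x) =
   D.[x] ^+ h * \sum_l fund_der Y h x p l * \adj (fund Y x) l q.
  have /matrixP/(_ p q) := e1; rewrite mul_mx_adj mul_mx_scalar !mxE => <-.
  by rewrite mulrC.
have Dx : cabs D.[x] <= KD * r ^+ v.
  rewrite DE hornerM hornerXn cabsM cabsX xr mulrC ler_wpM2r ?exprn_ge0 ?(ltW rp) //.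
  exact: hKD.
have r_n0 : r != 0 by rewrite gt_eqF.
have rX n : 0 < r ^+ n by rewrite exprn_gt0.
have fb i l : cabs (fund Y x i l) <= Ch 0%N / r ^+ E.
  have h1 := derb 0%N i l r hr; rewrite addn0 in h1.
  rewrite ler_pdivlMr; last exact: rX.
  by apply: le_trans h1; rewrite !mxE.
have ab l : cabs (\adj (fund Y x) l q) * r ^+ (E * d.-1) <= d.-1`!%:R * Ch 0%N ^+ d.-1.
  have := adj_bound l q fb; rewrite expr_div_n -exprM mulrA ler_pdivlMr //; exact: rX.
have sb : cabs (\sum_l fund_der Y h x p l * \adj (fund Y x) l q) * r ^+ (E + h + E * d.-1) <=
    d%:R * (Ch h * (d.-1`!%:R * Ch 0%N ^+ d.-1)).
  apply: le_trans (ler_wpM2r (ltW (rX _)) (cabs_sum _ _ _)) _.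
  rewrite -[X in X%:R * _]card_ord mulr_natl -sumr_const mulr_suml; apply: ler_sum => l _.
  rewrite cabsM exprD mulrACA ler_pM ?mulr_ge0 ?cabs_ge0 ?(ltW (rX _)) //; exact: derb.
have nb : cabs (itN D B h p q).[x] * cabs (\det (fund Y x)) * r ^+ (E + h + E * d.-1) <=
   (KD * r ^+ v) ^+ h * (d%:R * (Ch h * (d.-1`!%:R * Ch 0%N ^+ d.-1))).
  rewrite -cabsM e2 cabsM cabsX -mulrA ler_pM ?mulr_ge0 ?exprn_ge0 ?cabs_ge0 ?(ltW (rX _)) ?(ltW rp) //.
  by rewrite lerXn2r ?nnegrE ?cabs_ge0 // mulr_ge0 // ltW.
have rk0 : 0 < r0 ^+ k by rewrite exprn_gt0.
have low : cabs (itN D B h p q).[x] * (r / r0) ^+ k * r ^+ (E + h + E * d.-1) <=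
   (KD * r ^+ v) ^+ h * (d%:R * (Ch h * (d.-1`!%:R * Ch 0%N ^+ d.-1))).
  apply: le_trans nb; rewrite ler_wpM2r ?(ltW (rX _)) // ler_wpM2l ?cabs_ge0 //.
  exact: Wlow.
have e3 : cabs (itN D B h p q).[x] * r ^+ (k + E + h + E * d.-1) =
  cabs (itN D B h p q).[x] * (r / r0) ^+ k * r ^+ (E + h + E * d.-1) * r0 ^+ k.
  rewrite expr_div_n -!addnA exprD; field; by rewrite gt_eqF.
rewrite e3 /Ctot; apply: le_trans (ler_wpM2r (ltW rk0) low) _.
by rewrite le_eqVlt; apply/orP; left; apply/eqP; rewrite exprMn -exprM; ring.
Qed.

End ModerateSystems.

(** * An invertible leading matrix forces moderate growth *)

Section NormalForm.
Variables (K : numFieldType) (N m : nat) (A : 'I_m.+1 -> 'M[{poly K}]_N).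
Hypothesis hN : (0 < N)%N.
Hypothesis hA : \det (A ord_max) != 0.

Lemma leading_neq0 : A ord_max != 0.
Proof.
apply: contraNneq hA => ->.
by rewrite -(scale0r 1%:M) detZ expr0n gtn_eqF // mul0r.
Qed.

(** When m lies in J, the maximal slope is n = m - nu, so A_j has order at least j - n = nu + j - m,
    and x^m A_j is divisible by x^(nu+j). *)
Lemma euler_normal_form : ord_max \in Jset A -> exists nu (C : 'I_m.+1 -> 'M[{poly K}]_N),
  [/\ mxval0 (A ord_max) = (nu%:Z)%:E, max_slope A = (m%:Z - nu%:Z)%:E,
      forall j, 'X^m *: A j = 'X^(nu + j) *: C j, A ord_max = 'X^nu *: C ord_max &
      forall k, euler_mx C k = map_mx (horner^~ k%:R) (indicial_mx A)].
Proof.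
move=> mJ; have Am0 := leading_neq0.
have [n [en zc hJ _]] := max_slopeP Am0.
have [nu vnu mn] := hJ _ mJ; rewrite /= in mn.
have low (j : 'I_m.+1) r s k : (k < nu + j)%N -> ('X^m * A j r s)`_k = 0.
  move=> lt; rewrite coefXnM; case: ltnP => // le.
  by have /matrixP/(_ r s) : coef_mx (A j) (k - m) = 0; [apply: zc; lia | rewrite !mxE].
have /choice[C hC] : forall j, exists Cj : 'M[{poly K}]_N, 'X^m *: A j = 'X^(nu + j) *: Cj.
  move=> j; have /choice[c hc] : forall rs : 'I_N * 'I_N, exists q,
      'X^m * A j rs.1 rs.2 = 'X^(nu + j) * q.
    by move=> rs; apply: coef_low_factor => k; apply: low.
  by exists (\matrix_(r, s) c (r, s)); apply/matrixP => r s; rewrite !mxE (hc (r, s)).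
exists nu, C; split=> //.
- by rewrite en; congr (_%:E); lia.
- apply/matrixP => r s; apply: (@mulfI _ ('X^m)); first by rewrite monic_neq0 // monicXn.
  by have /matrixP/(_ r s) := hC ord_max; rewrite !mxE => ->; rewrite exprD; ring.
- move=> k; rewrite (indicial_nat k Am0 en) /euler_mx; apply: eq_bigr => j _; congr (_ *: _).
  apply/matrixP => r s; rewrite coef_mxE.
  have /matrixP/(_ r s) := hC j; rewrite !mxE => /(congr1 (fun p : {poly K} => p`_(nu + j))).
  rewrite !coefXnM ltnn subnn => <-; rewrite /diag_coef.
  case: ifP => h1; case: ifP => h2; rewrite ?coef_mxE ?mxE //; try (by lia).
  by congr (_`_ _); lia.
Qed.

(** det A_m = x^(nu N) det C, so the order is nu N exactly when det C does not vanish at 0. *)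
Lemma val0_detE nu (C : 'M[{poly K}]_N) : A ord_max = 'X^nu *: C ->
  val0 (\det (A ord_max)) = ((nu%:Z)%:E * (N%:Z)%:E)%E <-> \det (coef_mx C 0) != 0.
Proof.
move=> ACE; have dE : \det (A ord_max) = 'X^(nu * N) * \det C by rewrite ACE detZ -exprM.
have dC : \det (coef_mx C 0) = (\det C)`_0.
  rewrite -horner_coef0 -[RHS]/(horner_eval 0 (\det C)) -det_map_mx; congr (\det _).
  by apply/matrixP => r s; rewrite coef_mxE [RHS]mxE -horner_coef0.
rewrite -EFinM -PoszM dC; split=> [/val0_eqP[]|nz].
  by rewrite dE coefXnM ltnn subnn.
by apply: val0_eq => [|j lt]; rewrite dE coefXnM ?ltnn ?subnn // lt.
Qed.

End NormalForm.

Section FuchsianImpliesModerate.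
Variables (R : realType) (N m : nat).
Local Notation C := (Cplx R).
Variables (A CC : 'I_m.+1 -> 'M[{poly C}]_N) (nu : nat).
Hypothesis ACE : forall j, 'X^m *: A j = 'X^(nu + j) *: CC j.
Hypothesis C0 : \det (coef_mx (CC ord_max) 0) != 0.
Local Notation Dm := (\det (CC ord_max)).

(** The adjugate solves for x^m f^(m) in terms of the lower x^j f^(j) with polynomial coefficients;
    the only denominator is det C_m, a unit near 0. *)
Lemma euler_equation (S : set C) (f : 'I_N -> C -> C) x s : holo_solution A S f -> S x -> x != 0 ->
  Dm.[x] * (x ^+ m * derive1n m (f s) x) =
  - \sum_(j < m) \sum_t ((\adj (CC ord_max) *m CC (widen_ord (leqnSn m) j)) s t).[x] *
     (x ^+ j * derive1n j (f t) x).
Proof.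
move=> [_ hf] Sx x0.
have eq r : \sum_(i < m.+1) \sum_t (CC i r t).[x] * (x ^+ i * derive1n i (f t) x) = 0.
  apply: (@mulfI _ (x ^+ nu)); first by rewrite expf_neq0.
  have /colP/(_ r) := hf x Sx; rewrite summxE [RHS]mxE => /(congr1 (fun y => x ^+ m * y)).
  rewrite !mulr0 => e0; rewrite -[RHS]e0 !mulr_sumr; apply: eq_bigr => i _; rewrite mxE !mulr_sumr.
  apply: eq_bigr => t _; rewrite !mxE.
  have /matrixP/(_ r t) := ACE i; rewrite !mxE => /(congr1 (fun p : {poly C} => p.[x])).
  by rewrite !hornerM !hornerXn => e; rewrite [RHS]mulrA e exprD; ring.
have e2 r : \sum_t (CC ord_max r t).[x] * (x ^+ m * derive1n m (f t) x) =
   - \sum_(i < m) \sum_t (CC (widen_ord (leqnSn m) i) r t).[x] * (x ^+ i * derive1n i (f t) x).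
  by apply/eqP; rewrite -addr_eq0 addrC; have := eq r; rewrite big_ord_recr /= => ->.
transitivity (\sum_r (\adj (CC ord_max) s r).[x] *
   \sum_t (CC ord_max r t).[x] * (x ^+ m * derive1n m (f t) x)).
  under eq_bigr do rewrite mulr_sumr.
  rewrite exchange_big /= (bigD1 s) //= [X in _ + X]big1 ?addr0 => [|t ts].
    under eq_bigr do rewrite mulrA -hornerM.
    rewrite -mulr_suml -horner_sum; congr (_.[_] * _).
    by have /matrixP/(_ s s) := mul_adj_mx (CC ord_max); rewrite !mxE eqxx mulr1n.
  under eq_bigr do rewrite mulrA -hornerM.
  rewrite -mulr_suml -horner_sum.
  have /matrixP/(_ s t) := mul_adj_mx (CC ord_max); rewrite !mxE eq_sym (negbTE ts) => ->.
  by rewrite mulr0n horner0 mul0r.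
under eq_bigr do rewrite e2 mulrN mulr_sumr.
rewrite sumrN exchange_big /=; congr (- _); apply: eq_bigr => j _.
under eq_bigr do rewrite mulr_sumr.
rewrite exchange_big /=; apply: eq_bigr => t _; rewrite mxE horner_sum mulr_suml.
by apply: eq_bigr => r _; rewrite hornerM mulrA.
Qed.

Lemma holo_cdiff (S : set C) (f : 'I_N -> C -> C) x s (i : 'I_m.+1) : holo_solution A S f -> S x ->
  cdiff (derive1n i (f s)) x (derive1n i.+1 (f s) x).
Proof.
move=> [hd _] Sx; apply/cdiffP; rewrite derive1nS derive1E.
exact: (derivableP (hd s i x Sx)).
Qed.

Lemma cdiff_exp n (x : C) : cdiff (fun z => z ^+ n) x (n%:R * x ^+ n.-1).
Proof.
have -> : (fun z : C => z ^+ n) = (@id C) ^+ n by apply/funext => z; rewrite exprfctE.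
apply/cdiffP; refine (is_derive_eq (@is_deriveX _ _ (@id C) n x 1 1 _) _).
by rewrite -[_ *: _]/(_ * _) mulr1.
Qed.

Lemma unif_bounded (I : finType) (p : I -> {poly C}) : exists2 K : R, 0 <= K &
  forall i x, cabs x <= 1 -> cabs (p i).[x] <= K.
Proof.
have /choice[k hk] : forall i, exists k : R, 0 <= k /\ forall x, cabs x <= 1 -> cabs (p i).[x] <= k.
  by move=> i; have [k k0 hk] := poly_bounded (p i); exists k.
exists (\sum_i k i); first by apply: sumr_ge0 => i _; apply: (hk i).1.
move=> i x hx; apply: le_trans ((hk i).2 x hx) _.
by rewrite (bigD1 i) //= lerDl; apply: sumr_ge0 => j _; apply: (hk j).1.
Qed.

Lemma is_derive_fsum (I : Type) (r : seq I) (g : I -> R -> R) (l : I -> R) (s : R) :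
  (forall i, is_derive s (1 : R) (g i) (l i)) ->
  is_derive s (1 : R) (fun x => \sum_(i <- r) g i x) (\sum_(i <- r) l i).
Proof.
move=> h; elim: r => [|i r IH].
  have -> : (fun x => \sum_(i <- [::]) g i x) = (fun _ => 0).
    by apply/funext => x; rewrite big_nil.
  by rewrite big_nil; apply: is_derive_cst.
have -> : (fun x => \sum_(j <- i :: r) g j x) = (fun x => g i x + \sum_(j <- r) g j x).
  by apply/funext => x; rewrite big_cons.
by rewrite big_cons; apply: is_deriveD.
Qed.

(** Keeps the angle strictly inside the sector along a segment in the coordinate log x. *)
Lemma convex_gt (a b c s : R) : 0 <= s <= 1 -> a < b -> a < c -> a < b + (c - b) * s.
Proof.
move=> /andP[s0 s1] ab ac; case: (lerP s (1 / 2)) => h.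
  have h1 : 0 <= (c - a) * s by rewrite mulr_ge0 // subr_ge0 ltW.
  have h2 : 0 < (b - a) * (1 - s) by rewrite mulr_gt0 ?subr_gt0 //; lra.
  nra.
have h1 : 0 < (c - a) * s by rewrite mulr_gt0 ?subr_gt0 //; lra.
have h2 : 0 <= (b - a) * (1 - s) by rewrite mulr_ge0 ?subr_ge0 // ltW.
nra.
Qed.

Lemma cis_polar (r t : R) : ((r * cos t) +i* (r * sin t))%C = rc r * (cos t +i* sin t)%C :> C.
Proof. by apply/eqP; rewrite eq_complex /= !mul0r subr0 addr0 !eqxx. Qed.

Lemma det_coef0 : Dm`_0 != 0.
Proof.
suff -> : Dm`_0 = \det (coef_mx (CC ord_max) 0) by [].
rewrite -horner_coef0 -[LHS]/(horner_eval 0 Dm) -det_map_mx; congr (\det _).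
by apply/matrixP => r s; rewrite coef_mxE [LHS]mxE -horner_coef0.
Qed.

(** Without derivatives [euler_equation] reads det(C_0) f = 0, so f vanishes near 0. *)
Lemma order0_moderate : m = 0%N -> singular_regular A 0.
Proof.
move=> m0 rho alpha beta rho0 ab f hf.
have [rho1 /andP[rho10 rho11] hD] := poly_nonzero_near0 det_coef0.
have D0 : 0 < cabs Dm`_0 by rewrite cabs_gt0 det_coef0.
exists 0%N => s; apply/cvgrPdist_le => e e0; apply/nbhs_ballP.
exists (rc rho1); first by rewrite /= -rc0 rc_lt.
move=> x; rewrite -ball_normE /= sub0r normrN normE rc_lt => hx Sx.
have x0 : x != 0.
  case: Sx => r [t [/andP[rp _] _ ->]]; rewrite add0r cis_polar.
  by rewrite -cabs_gt0 cabsM cabs_cis mulr1 cabs_rc normr_gt0 gt_eqF.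
have := euler_equation s hf Sx x0; rewrite big1 ?oppr0; last first.
  by move=> [j lt]; exfalso; rewrite m0 in lt.
move/eqP; rewrite mulf_eq0 => /orP[/eqP z|].
  by have := hD x (ltW hx); rewrite z cabs0 leNgt divr_gt0.
rewrite mulf_eq0 expf_eq0 (negbTE x0) andbF /= m0 => /eqP z.
by rewrite (_ : f s x = 0) // mulr0 subrr normr0 ltW.
Qed.

Section PositiveOrder.
Hypothesis m_gt0 : (0 < m)%N.
Local Notation I := ('I_m * 'I_N)%type.
Variables (S : set C) (f : 'I_N -> C -> C).
Hypothesis hf : holo_solution A S f.

Definition eulerY (p : I) x := x ^+ p.1 * derive1n p.1 (f p.2) x.
Definition eulerY' (p : I) x := (p.1%:R * x ^+ p.1.-1) * derive1n p.1 (f p.2) x +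
  x ^+ p.1 * derive1n p.1.+1 (f p.2) x.

Lemma eulerY_cdiff p x : S x -> cdiff (eulerY p) x (eulerY' p x).
Proof.
move=> Sx; apply: cdiffM; first exact: cdiff_exp.
exact: (holo_cdiff p.2 (widen_ord (leqnSn m) p.1) hf Sx).
Qed.

Lemma euler_bound : exists (K rho1 : R), [/\ 0 <= K, 0 < rho1 <= 1 &
  forall p x, S x -> x != 0 -> cabs x <= rho1 ->
    cabs (x * eulerY' p x) <= K * \sum_q cabs (eulerY q x)].
Proof.
have [rho1 rho10 hD] := poly_nonzero_near0 det_coef0.
have D0 : 0 < cabs Dm`_0 by rewrite cabs_gt0 det_coef0.
have [K1 K10 hK1] := unif_bounded (fun sp : 'I_N * I =>
  (\adj (CC ord_max) *m CC (widen_ord (leqnSn m) sp.2.1)) sp.1 sp.2.2).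
pose K2 := K1 / (cabs Dm`_0 / 2).
have K20 : 0 <= K2 by rewrite divr_ge0 //; lra.
(* m bounds the factor i from differentiating x^i, 1 accounts for the next component, and K2 for the
   top derivative, replaced through the equation. *)
exists (m%:R + 1 + K2), rho1; split=> //; first by rewrite !addr_ge0.
move=> p x Sx x0 hx; set T := \sum_q _.
have T0 : 0 <= T by apply: sumr_ge0 => q _; apply: cabs_ge0.
have leT q : cabs (eulerY q x) <= T.
  by rewrite /T (bigD1 q) //= lerDl; apply: sumr_ge0 => j _; apply: cabs_ge0.
have x1 : cabs x <= 1 by case/andP: rho10 => _ h; apply: le_trans h.
have -> : x * eulerY' p x = p.1%:R * eulerY p x + x ^+ p.1.+1 * derive1n p.1.+1 (f p.2) x.
  rewrite /eulerY' /eulerY exprS.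
  move: (derive1n p.1 (f p.2) x) (derive1n p.1.+1 (f p.2) x) => F1 F2.
  case: (nat_of_ord p.1) => [|i] /=; first by rewrite !expr0; ring.
  by rewrite (exprS x i); ring.
have h1 : cabs (p.1%:R * eulerY p x) <= m%:R * T.
  by rewrite cabsM cabs_nat ler_pM ?cabs_ge0 // ler_nat ltnW.
have h2 : cabs (x ^+ p.1.+1 * derive1n p.1.+1 (f p.2) x) <= (1 + K2) * T.
  case: (ltnP p.1.+1 m) => lt.
    apply: (@le_trans _ _ T); last by rewrite mulrDl mul1r lerDl mulr_ge0.
    exact: (leT (Ordinal lt, p.2)).
  have -> : p.1.+1 = m by apply/eqP; rewrite eqn_leq lt ltn_ord.
  have Dx := hD x hx; have Dx0 : 0 < cabs Dm.[x] by lra.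
  have e := euler_equation p.2 hf Sx x0.
  rewrite -(ler_pM2l Dx0) -cabsM e cabsN.
  apply: (@le_trans _ _ (K1 * T)).
    apply: le_trans (cabs_sum _ _ _) _.
    rewrite /T -(pair_bigA _ (fun j t => cabs (eulerY (j, t) x))) mulr_sumr.
    apply: ler_sum => j _; rewrite mulr_sumr; apply: le_trans (cabs_sum _ _ _) _.
    apply: ler_sum => t _; rewrite cabsM ler_wpM2r ?cabs_ge0 //.
    exact: (hK1 (p.2, (j, t)) x x1).
  rewrite mulrA ler_wpM2r // mulrDr mulr1; apply: (@le_trans _ _ (cabs Dm.[x] * K2)); last lra.
  apply: (@le_trans _ _ (cabs Dm`_0 / 2 * K2)); last by rewrite ler_wpM2r.
  by rewrite /K2 mulrCA divff ?mulr1 // gt_eqF //; lra.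
apply: le_trans (cabsD _ _) _; lra.
Qed.

Definition energy x : R := \sum_p cabs (eulerY p x) ^+ 2.

Lemma energy_ge0 x : 0 <= energy x.
Proof. by apply: sumr_ge0 => p _; apply: sqr_ge0. Qed.

(* Gronwall along a segment in the coordinate log x. *)
Lemma energy_growth : exists (L : nat) (rho1 : R), 0 < rho1 <= 1 /\
  forall (z : C) (p q : R), (forall s : R, 0 <= s <= 1 -> S (spiral z p q s) /\ 0 < cabs (spiral z p q s) <= rho1) ->
  energy (spiral z p q 1) <= expR (L%:R * (`|p| + `|q|)) * energy z.
Proof.
have [K [rho1 [K0 rho10 hK]]] := euler_bound.
pose n : R := #|{: I}|%:R.
(* One n comes from the sum in [euler_bound], the other from the sum defining [energy]. L is a
   natural number because it becomes an exponent of |x|. *)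
have [L hL] : exists L : nat, 2 * K * n * n <= L%:R.
  by exists (Num.bound (2 * K * n * n)); apply/ltW/archi_boundP; rewrite !mulr_ge0.
exists L, rho1; split=> // z p q hS.
pose g (s : R) := spiral z p q s; pose lam : C := (p +i* q)%C.
pose g' (s : R) := \sum_i 2 * inner (eulerY i (g s)) (lam * g s * eulerY' i (g s)).
have dg (s : R) : 0 <= s <= 1 -> is_derive s (1 : R) (fun s => energy (g s)) (g' s).
  move=> /hS[Sg _]; apply: is_derive_fsum => i; apply: is_derive_cabs2; last exact: spiral_diff.
  exact: eulerY_cdiff.
have hg (s : R) : 0 <= s <= 1 -> g' s <= (L%:R * cabs lam) * energy (g s).
  move=> /hS[Sg /andP[g0 grho]]; set E := energy _; have E0 : 0 <= E by apply: energy_ge0.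
  have leE i : cabs (eulerY i (g s)) ^+ 2 <= E.
    by rewrite /E /energy (bigD1 i) //= lerDl; apply: sumr_ge0 => j _; apply: sqr_ge0.
  have prodE i j : cabs (eulerY i (g s)) * cabs (eulerY j (g s)) <= E.
    have := leE i; have := leE j.
    have := sqr_ge0 (cabs (eulerY i (g s)) - cabs (eulerY j (g s))); nra.
  have gn0 : g s != 0 by rewrite -cabs_gt0.
  apply: (@le_trans _ _ (\sum_(i : I) 2 * (cabs lam * (K * (n * E))))).
    apply: ler_sum => i _; rewrite ler_pM2l //; apply: le_trans (ler_norm _) _.
    apply: le_trans (inner_le _ _) _; rewrite -mulrA cabsM mulrCA ler_wpM2l ?cabs_ge0 //.
    apply: le_trans (ler_wpM2l (cabs_ge0 _) (hK i _ Sg gn0 grho)) _.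
    rewrite mulrCA ler_wpM2l // mulr_sumr /n -sum1_card natr_sum mulr_suml.
    by apply: ler_sum => j _; rewrite mul1r.
  have -> : \sum_(i : I) 2 * (cabs lam * (K * (n * E))) = 2 * K * n * n * (cabs lam * E).
    rewrite sumr_const; transitivity (n * (2 * (cabs lam * (K * (n * E))))); last by ring.
    by rewrite /n [RHS]mulr_natl; congr (_ *+ _); apply: eq_card.
  by rewrite -[leRHS]mulrA; apply: ler_wpM2r hL; rewrite mulr_ge0 ?cabs_ge0.
have := gronwall dg hg; rewrite /g spiral0 => h; apply: le_trans h _.
rewrite ler_wpM2r ?energy_ge0 // ler_expR ler_wpM2l //.
exact: cabs_le_ReIm.
Qed.

End PositiveOrder.

(** Every x near 0 in the sector is joined to a base point x0 on the bisector by a segment in log x.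
    Its radial part contributes exp(L |p|) = (r1 / r)^L, at most r^(-L), and its angular part is
    bounded since |q| <= 2π; hence |f|^2 <= M |x|^(-L). *)
Lemma fuchsian_moderate : singular_regular A 0.
Proof.
case: (posnP m) => [|m0]; first exact: order0_moderate.
move=> rho alpha beta rho0 /andP[ab ba] f hf.
have [L [rho1 [/andP[rho10 rho11] hE]]] := energy_growth hf.
set S := sector _ _ _ _ in hf hE *.
pose r1 := Num.min (rho / 2) rho1.
have r10 : 0 < r1 by rewrite lt_min divr_gt0.
have r1rho : r1 <= rho / 2 by rewrite ge_min lexx.
have r1rho1 : r1 <= rho1 by rewrite ge_min lexx orbT.
pose th0 := (alpha + beta) / 2.
pose x0 : C := rc r1 * (cos th0 +i* sin th0)%C.
pose M := expR (L%:R * (pi *+ 2)) * energy f x0.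
have M0 : 0 <= M by rewrite mulr_ge0 ?expR_ge0 ?energy_ge0.
have bound x : S x -> cabs x < r1 -> energy f x * cabs x ^+ L <= M.
  case=> r [t [/andP[rp rr] /andP[t1 t2] ->]]; rewrite add0r cis_polar.
  rewrite cabsM cabs_cis mulr1 cabs_rc gtr0_norm // => rr1.
  have q0 : 0 < r / r1 by rewrite divr_gt0.
  have q1 : r / r1 <= 1 by rewrite ler_pdivrMr // mul1r ltW.
  pose p := ln (r / r1); have p0 : p <= 0 by rewrite /p ln_le0.
  pose q := t - th0.
  have gE s : spiral x0 p q s =
      rc (r1 * expR (p * s)) * (cos (th0 + q * s) +i* sin (th0 + q * s))%C.
    by rewrite /spiral /x0 rcM -cisD; ring.
  have g1 : spiral x0 p q 1 = rc r * (cos t +i* sin t)%C.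
    by rewrite gE !mulr1 /p lnK ?posrE // mulrCA divff ?mulr1 ?gt_eqF // /q addrC subrK.
  have h : energy f (rc r * (cos t +i* sin t)%C) <=
      expR (L%:R * (`|p| + `|q|)) * energy f x0.
    rewrite -g1; apply: hE => s /andP[s0 s1]; rewrite gE.
    have e1 : expR (p * s) <= 1 by rewrite -expR0 ler_expR mulr_le0_ge0.
    have e0 := expR_gt0 (p * s).
    have re : r1 * expR (p * s) <= r1 by rewrite -[leRHS]mulr1 ler_wpM2l // ltW.
    have re0 : 0 < r1 * expR (p * s) by rewrite mulr_gt0.
    split; last first.
      rewrite cabsM cabs_cis mulr1 cabs_rc gtr0_norm // re0 /=; lra.
    exists (r1 * expR (p * s)), (th0 + q * s); split.
    - by rewrite re0 /=; lra.
    - have a1 : alpha < th0 by rewrite /th0; lra.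
      have a2 : th0 < beta by rewrite /th0; lra.
      have s01 : 0 <= s <= 1 by rewrite s0 s1.
      apply/andP; split; first exact: convex_gt.
      have := @convex_gt (- beta) (- th0) (- t) s s01; rewrite !ltrN2 => /(_ a2 t2).
      by rewrite -opprD mulNr -opprD ltrN2.
    - by rewrite add0r cis_polar.
  have rL : 0 <= r ^+ L by rewrite exprn_ge0 // ltW.
  apply: le_trans (ler_wpM2r rL h) _; rewrite /M mulrAC ler_wpM2r ?energy_ge0 //.
  have ep : expR (L%:R * `|p|) * r ^+ L <= 1.
    rewrite ler0_norm // expRM_natl expRN /p lnK ?posrE // invf_div -exprMn divfK ?gt_eqF //.
    by rewrite exprn_ile1 ?(ltW r10) //; lra.
  have eq : expR (L%:R * `|q|) <= expR (L%:R * (pi *+ 2)).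
    rewrite ler_expR ler_wpM2l // /q /th0 ler_norml; apply/andP; split; lra.
  rewrite mulrDr expRD -[leRHS]mul1r mulrAC ler_pM ?mulr_ge0 ?expR_ge0 //.
(* One power more than needed for boundedness: |x^(L+1) f|^2 <= M |x|^2 tends to 0. The constant M +
   1 is positive and its square dominates M. *)
exists L.+1 => s; apply/cvgrPdist_le => e /pos_rc[-> e0]; apply/nbhs_ballP.
exists (rc (Num.min r1 (complex.Re e / (M + 1)))).
  by rewrite /= -rc0 rc_lt lt_min r10 divr_gt0 //; lra.
move=> x; rewrite -ball_normE /= sub0r normrN normE rc_lt lt_min => /andP[hx1 hx2] Sx.
rewrite sub0r normrN subr0 normE rc_le.
have fb : cabs (f s x) ^+ 2 <= energy f x.
  rewrite /energy (bigD1 (Ordinal m0, s)) //= /eulerY expr0 mul1r lerDl.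
  by apply: sumr_ge0 => j _; apply: sqr_ge0.
have xM : cabs x * (M + 1) <= complex.Re e by rewrite -ler_pdivlMr ?ltW //; lra.
apply: le_trans xM.
have x0' := cabs_ge0 x; have x1 : cabs x <= 1 by lra.
rewrite -(ler_pXn2r (n := 2)) ?nnegrE ?cabs_ge0 ?mulr_ge0 ?addr_ge0 //.
rewrite cabsM cabsX exprMn.
have xL : 0 <= cabs x ^+ L by rewrite exprn_ge0.
have xL1 : cabs x ^+ L <= 1 by rewrite exprn_ile1.
apply: (@le_trans _ _ (cabs x ^+ 2 * (cabs x ^+ L * (energy f x * cabs x ^+ L)))).
  rewrite [leLHS](_ : _ = cabs x ^+ 2 * (cabs x ^+ L * (cabs (f s x) ^+ 2 * cabs x ^+ L))).
    by rewrite ler_wpM2l ?sqr_ge0 // ler_wpM2l // ler_wpM2r.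
  by rewrite (exprSr (cabs x) L); move: (cabs x ^+ L) (cabs x) (cabs (f s x)) => y1 y2 y3; ring.
rewrite exprMn ler_wpM2l ?sqr_ge0 //.
have h := bound x Sx hx1.
apply: (@le_trans _ _ (1 * M)); last nra.
by rewrite ler_pM // mulr_ge0 ?energy_ge0.
Qed.

End FuchsianImpliesModerate.

Lemma moderate_leading_unit (R : realType) (N m : nat)
    (A CC : 'I_m.+1 -> 'M[{poly Cplx R}]_N) (nu k0 : nat) :
  \det (A ord_max) != 0 -> (forall j, 'X^m *: A j = 'X^(nu + j) *: CC j) ->
  (forall k, (k0 <= k)%N -> \det (euler_mx CC k) != 0) ->
  singular_regular A 0 -> \det (coef_mx (CC ord_max) 0) != 0.
Proof.
move=> hA ACE detL sr; apply/negP => det0.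
have [w' w0 hw'] := det0P (etrans (congr1 (fun x => x == 0) (det_tr _)) det0).
pose w := w'^T; have Cw : coef_mx (CC ord_max) 0 *m w = 0.
  by rewrite /w -[coef_mx _ _]trmxK -trmx_mul hw' trmx0.
have [s ws] : exists s, w s 0 != 0.
  apply/not_existsP => z; case/negP: w0; apply/eqP/rowP => s; rewrite [RHS]mxE.
  by have /negP := z s; rewrite negbK mxE => /eqP.
(* For m = 0 there is no companion system, but L(k) is the constant matrix C_0(0), whose determinant
   is nonzero by [detL]. *)
case: m A CC hA ACE detL sr Cw det0 {hw'} => [|m'] A CC hA ACE detL sr Cw det0.
  have := detL k0 (leqnn _); rewrite /euler_mx big_ord_recl big_ord0 addr0 ffactn0 scale1r.
  by rewrite (_ : ord0 = ord_max) ?det0 //; apply: val_inj.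
have [v [D1 [DE D10]]] := poly_order hA.
have [b hb] := moderate_poles DE D10 sr.
exact: (bounded_poles_absurd ACE DE D10 detL hb Cw ws).
Qed.

Unset Implicit Arguments.

Theorem mainTheorem1 (R : realType) (N m : nat)
    (A : 'I_m.+1 -> 'M[{poly Cplx R}]_N)
    (hN : (0 < N)%N) (hA : \det (A ord_max) != 0) :
  (indicial_poly A != 0 ->
     exists2 chi : int, has_index (formal_op A) chi
                      & chi%:E = (max_slope A * (N%:Z)%:E)%E)
  /\
  (ord_max \in Jset A ->
     (val0 (\det (A ord_max)) = (mxval0 (A ord_max) * (N%:Z)%:E)%E ->
        singular_regular A 0)
     /\
     (indicial_poly A != 0 -> singular_regular A 0 ->
        val0 (\det (A ord_max)) = (mxval0 (A ord_max) * (N%:Z)%:E)%E)).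
Proof.
have Am0 := leading_neq0 hN hA.
split=> [l0|mJ].
  have [n en hn] := formal_index Am0 l0.
  by exists (n * N%:Z); rewrite ?en.
have [nu [CC [vnu _ ACE Amax LE]]] := euler_normal_form hN hA mJ.
have [detE1 detE2] := val0_detE Amax; rewrite vnu; split=> [/detE1 C0|l0 sr].
  exact: fuchsian_moderate ACE C0.
apply: detE2; have [k0 hk0] := poly_nat_neq0 l0.
apply: (moderate_leading_unit (k0 := k0) hA ACE _ sr) => k le.
rewrite LE -[map_mx _ _]/(map_mx (horner_eval k%:R) _) det_map_mx; exact: hk0.
Qed.
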